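(* Let $\varphi(\lambda)=i\theta_1^*(\lambda I_n-\beta)^{-1}\theta_2e^{-2i\lambda D}R$, where $\theta_1,\theta_2$ are $n\times p$ matrices, $\beta$ is an $n\times n$ matrix, $R$ is a unitary $p\times p$ matrix, and $$D=\mathrm{diag}\{\tilde d_1I_{p_1},\ldots,\tilde d_\kappa I_{p_\kappa}\},\quad p_1+\ldots+p_\kappa=p,\quad 0\le\tilde d_1<\tilde d_2<\ldots<\tilde d_\kappa .$$ Assume that the matrix identities $$i(\beta X_j-X_j\beta^* )=Q_j,\qquad Q_j:=\nu P_j\nu^*\qquad(1\le j\le\kappa)$$ have solutions $X_j$. Then these identities have self-adjoint solutions; let $X_j=X_j^*$ be such solutions. For every $0<l<\infty$, the operator $$(Sf)(x)=f(x)+\int_0^lK(x,t)f(t)\,dt,\qquad K(x,t)=\frac12\int_{|x-t|}^{x+t}k\Big(\frac{r+x-t}{2}\Big)k\Big(\frac{r+t-x}{2}\Big)^*dr,$$ in $L^2_p(0,l)$, where $k=s'$ and $s$ is defined via $\varphi$ as described in the context, is semiseparable, and its kernel $K(x,t)$ $(0<x,t<l)$ is given by the relation $K(x,t)=K(t,x)^*$ and by the equalities $$K(x,t)=2\theta_1^*\Big(e^{2ix\beta}Z_me^{-2it\beta^*}-e^{2i(x-t)\beta}\widetilde Z_m\Big)\theta_1\qquad(\tilde d_m<t<\tilde d_{m+1})$$ for $t<x<l$, where $$Z_m=\sum_{j=1}^mX_j,\qquad \widetilde Z_m=\sum_{j=1}^m e^{2i\tilde d_j\beta}X_je^{-2i\tilde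 d_j\beta^*}.$$
   Context: $s$ is defined by $$s(x)=\frac{i}{2\pi}e^{-\eta x}\,\mathrm{l.i.m.}_{a\to\infty}\int_{-a}^{a}e^{i\xi x}\lambda^{-1}\varphi(\lambda/2)\,d\xi\qquad(x\ge0,\ \lambda=\xi+i\eta,\ \eta<-2M),$$ where $M>0$ is such that $\sigma(\beta+iMI_n)$ lies in the open upper half-plane, and the limit is in $L^2(0,l)$ entrywise for every $0<l<\infty$. Write $D=\mathrm{diag}\{d_1,\ldots,d_p\}$ (so $d_1\le\ldots\le d_p$), let $\theta_{2,m}$ be the $m$-th column of $\theta_2$, and let $\nu$ be the $n\times p$ matrix whose $m$-th column is $\exp(-2id_m\beta)\theta_{2,m}$, $1\le m\le p$. $P_j=\mathrm{diag}\{0,\ldots,0,I_{p_j},0,\ldots,0\}$ is the $p\times p$ block-diagonal matrix (blocks of sizes $p_1,\ldots,p_\kappa$) with $I_{p_j}$ in the $j$-th block and zeros elsewhere. Convention on intervals: for given $x$ and $t<x$, the notation $\tilde d_m<t<\tilde d_{m+1}$ means $\tilde d_m<t<\min(x,\tilde d_{m+1})$ for those $m$ with $\tilde d_m<x$. If $\tilde d_1>0$, one puts $\tilde d_0=0$ and the interval with $m=0$ is included; if $x>\tilde d_\kappa$, the interval with $m=\kappa$ is included with $\tilde d_{\kappa+1}:=x$. Empty sums ($m=0$) equal $0$. An operator $I+\int_0^lK(x,t)\,\cdot\,dt$ in $L^2_p(0,l)$ is called semiseparable if $K(x,t)=F_1(x)G_1(t)$ for $x>t$ and $K(x,t)=F_2(x)G_2(t)$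 for $x<t$, where, for some positive integer $\tilde p$, $F_1,F_2$ are $p\times\tilde p$ matrix functions and $G_1,G_2$ are $\tilde p\times p$ matrix functions. *)

(* Defs.v *)
From HB Require Import structures.
From mathcomp Require Import all_boot all_order all_algebra.
From mathcomp Require Import spectral complex.
From mathcomp Require Import all_classical all_reals all_analysis.

Set Implicit Arguments.
Unset Strict Implicit.
Unset Printing Implicit Defensive.

Import Order.TTheory GRing.Theory Num.Theory.
Import numFieldNormedType.Exports.

#[global] Open Scope classical_set_scope.
#[global] Open Scope sesquilinear_scope.
#[global] Open Scope ring_scope.

(** Complex numbers are [R[i]] for [R : realType], with [complex.Re] and
    [complex.Im] valued in [R].  [A ^t*] is the conjugate transpose. *)

Section ComplexCalculus.
Variable R : realType.

(* Limits, derivatives and integrals of complex-valued functions are taken on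
   real and imaginary parts; those of matrix functions, entry by entry. *)

Definition limC (u : nat -> R[i]) : R[i] :=
  Complex (limn (fun N => complex.Re (u N))) (limn (fun N => complex.Im (u N))).

Definition expmx (n : nat) (A : 'M[R[i]]_n) : 'M[R[i]]_n :=
  \matrix_(i, j) limC (fun N => (\sum_(k < N) (k`!%:R)^-1 *: A ^+ k) i j).

Definition integralC (D : set R) (f : R -> R[i]) : R[i] :=
  Complex (\int[@lebesgue_measure R]_(x in D) complex.Re (f x))
          (\int[@lebesgue_measure R]_(x in D) complex.Im (f x)).

Definition integralmx (m n : nat) (D : set R) (F : R -> 'M[R[i]]_(m, n)) :
    'M[R[i]]_(m, n) :=
  \matrix_(i, j) integralC D (fun x => F x i j).

Definition derivablemx (m n : nat) (F : R -> 'M[R[i]]_(m, n)) (x : R) : Prop :=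
  forall i j, derivable (fun y => complex.Re (F y i j)) x 1 /\
              derivable (fun y => complex.Im (F y i j)) x 1.

Definition derivmx (m n : nat) (F : R -> 'M[R[i]]_(m, n)) (x : R) :
    'M[R[i]]_(m, n) :=
  \matrix_(i, j) Complex (derive1 (fun y => complex.Re (F y i j)) x)
                         (derive1 (fun y => complex.Im (F y i j)) x).

Definition sqr_normL2 (l : R) (f : R -> R[i]) : \bar R :=
  (\int[@lebesgue_measure R]_(x in `]0%R, l[) ((Normc.normc (f x)) ^+ 2)%:E)%E.

Definition in_L2 (m n : nat) (l : R) (F : R -> 'M[R[i]]_(m, n)) : Prop :=
  forall i j,
    [/\ measurable_fun `]0, l[ (fun x => complex.Re (F x i j)),
        measurable_fun `]0, l[ (fun x => complex.Im (F x i j)) &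
        (sqr_normL2 l (fun x => F x i j) < +oo)%E].

(* [G] is the entrywise limit of [F a] in L^2(0,l), as [a] tends to infinity,
   for every [0 < l < oo]. *)
Definition is_lim_in_mean (m n : nat) (F : R -> R -> 'M[R[i]]_(m, n))
    (G : R -> 'M[R[i]]_(m, n)) : Prop :=
  forall l : R, 0 < l -> in_L2 l G /\
    forall i j, sqr_normL2 l (fun x => F a x i j - G x i j) @[a --> +oo] --> 0%E.

Definition continuous_on_nneg (m n : nat) (F : R -> 'M[R[i]]_(m, n)) : Prop :=
  forall i j, {within `[0, +oo[, continuous (fun x => complex.Re (F x i j))} /\
              {within `[0, +oo[, continuous (fun x => complex.Im (F x i j))}.

End ComplexCalculus.

Section Kernel.
Variable R : realType.
Variable p : nat.

(* e^{iy} for real y *)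
Definition expi (y : R) : R[i] := Complex (cos y) (sin y).

(* [s] is given by its representative that is continuous on [0, oo[; the
   equivalence class in L^2(0,l) has no pointwise derivative.  Values of [s] at
   negative arguments are irrelevant. *)
Definition is_s (phi : R[i] -> 'M[R[i]]_p) (eta : R) (s : R -> 'M[R[i]]_p) :
    Prop :=
  continuous_on_nneg s /\
  exists L : R -> 'M[R[i]]_p,
    is_lim_in_mean
      (fun a x => integralmx `[- a, a]
         (fun xi => let lambda := Complex xi eta in
            (expi (xi * x) * lambda^-1) *: phi (lambda / 2))) L /\
    forall x : R, 0 <= x ->
      s x = ('i%C / (2 * pi)%:C%C * (expR (- (eta * x)))%:C%C) *: L x.

(* [k = s'] makes sense almost everywhere and is locally square integrable *)
Definition has_L2loc_derivative (s : R -> 'M[R[i]]_p) : Prop :=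
  {ae @lebesgue_measure R, forall x, 0 < x -> derivablemx s x} /\
  forall l : R, 0 < l -> in_L2 l (derivmx s).

Definition kernelK (s : R -> 'M[R[i]]_p) (x t : R) : 'M[R[i]]_p :=
  let k := derivmx s in
  2^-1 *: integralmx `[`|x - t|, x + t]
            (fun r => k ((r + x - t) / 2) *m (k ((r + t - x) / 2)) ^t*).

(* the operator I + \int_0^l K(x,t) . dt *)
Definition integral_op (l : R) (K : R -> R -> 'M[R[i]]_p)
    (f : R -> 'cV[R[i]]_p) (x : R) : 'cV[R[i]]_p :=
  f x + integralmx `]0, l[ (fun t => K x t *m f t).

(* semiseparability of [integral_op l K] *)
Definition semiseparable (l : R) (K : R -> R -> 'M[R[i]]_p) : Prop :=
  exists (pt : nat) (F1 F2 : R -> 'M[R[i]]_(p, pt)) (G1 G2 : R -> 'M[R[i]]_(pt, p)),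
    (0 < pt)%N /\
    forall x t : R, 0 < x < l -> 0 < t < l ->
      (t < x -> K x t = F1 x *m G1 t) /\ (x < t -> K x t = F2 x *m G2 t).

End Kernel.

Section Data.
Variable R : realType.
Variables (n kappa : nat) (q : 'I_kappa -> nat).
(* [q j] is p_{j+1} and [dt j] is \tilde d_{j+1}: indices here start at 0. *)
Let p : nat := (\sum_j q j)%N.
Variables (theta1 theta2 : 'M[R[i]]_(n, p)) (beta : 'M[R[i]]_n).
Variables (dt : 'I_kappa -> R).

Definition Dmx : 'M[R[i]]_p := \mxdiag_(j < kappa) ((dt j)%:C%C%:M : 'M[R[i]]_(q j)).

Definition Pmx (j : 'I_kappa) : 'M[R[i]]_p :=
  \mxdiag_(j' < kappa) (if j' == j then 1%:M else 0 : 'M[R[i]]_(q j')).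

Definition phi (U : 'M[R[i]]_p) (lambda : R[i]) : 'M[R[i]]_p :=
  'i%C *: (theta1 ^t* *m invmx (lambda%:M - beta) *m theta2
           *m expmx (- (2 * 'i%C * lambda) *: Dmx) *m U).

Definition nu : 'M[R[i]]_(n, p) :=
  \matrix_(i, m) (expmx (- (2 * 'i%C * Dmx m m) *: beta) *m col m theta2) i 0.

Definition Qmx (j : 'I_kappa) : 'M[R[i]]_n := nu *m Pmx j *m nu ^t*.

Definition solves_identity (j : 'I_kappa) (X : 'M[R[i]]_n) : Prop :=
  'i%C *: (beta *m X - X *m beta ^t*) = Qmx j.

(* e^{2 i x A} *)
Definition exp2i (x : R) (A : 'M[R[i]]_n) : 'M[R[i]]_n :=
  expmx ((2 * 'i%C * x%:C%C) *: A).

Definition Zmx (X : 'I_kappa -> 'M[R[i]]_n) (m : nat) : 'M[R[i]]_n :=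
  \sum_(j < kappa | (j < m)%N) X j.

Definition Ztmx (X : 'I_kappa -> 'M[R[i]]_n) (m : nat) : 'M[R[i]]_n :=
  \sum_(j < kappa | (j < m)%N)
     exp2i (dt j) beta *m X j *m exp2i (- dt j) (beta ^t*).

(* \tilde d_m for 0 <= m <= kappa + 1 (here \tilde d_1 is the first value of
   [dt]), where \tilde d_0 := 0 and \tilde d_{kappa+1} := x.  When
   \tilde d_1 = 0 the interval with m = 0 is empty. *)
Definition dtilde (x : R) (m : nat) : R :=
  if m is m'.+1 then oapp dt x (insub m') else 0.

Definition kernel_formula (X : 'I_kappa -> 'M[R[i]]_n) (m : nat) (x t : R) :
    'M[R[i]]_p :=
  2 *: (theta1 ^t* *m (exp2i x beta *m Zmx X m *m exp2i (- t) (beta ^t*)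
                       - exp2i (x - t) beta *m Ztmx X m) *m theta1).

End Data.

(* Main.v *)
From HB Require Import structures.
Require Import Defs.
From mathcomp Require Import all_boot all_order all_algebra.
From mathcomp Require Import spectral complex.
From mathcomp Require Import all_classical all_reals all_analysis.
From mathcomp Require Import measurable_realfun ring lra.
Import Order.TTheory GRing.Theory Num.Theory.
Import numFieldNormedType.Exports.

Set Implicit Arguments.
Unset Strict Implicit.
Unset Printing Implicit Defensive.

(** Let [B = 2 i beta], [E v = exp (v B)], and let [H] be the primitive of [E]
    with [H 0 = 0].  With [z = i lambda], the [m]-th column of
    [lambda^-1 phi (lambda / 2)] is, up to constants, the combination
    [theta1^* z^-1 (z - B)^-1 theta2_m e^(- z d_m)], and [z^-1 (z - B)^-1] is the
    Laplace transform of [H].  Fourier inversion (by Abel summation) shows that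
    the truncated integrals converge uniformly, so that the [m]-th column of [s]
    is [2 theta1^* H (x - d_m) theta2_m] for [x >= d_m] and [0] before, times [U].
    Hence [k x = 2 theta1^* E x nu chi_x U], where [chi_x] selects the columns
    with [d_m < x].  As [U] is unitary, the integrand of [K] is
    [4 theta1^* E (x - t) (sum_(dt j < v) E v Q_j (E v)^* ) theta1] with
    [v = (r + t - x) / 2], and the Lyapunov identities make
    [E v X_j (E v)^*] a primitive of [2 E v Q_j (E v)^*]. *)

(** * Complex calculus on the real line *)

(** The spectral condition on [beta] puts the eigenvalues of [B] in [Re < 2 M < - eta], so
    [e^(eta x)] beats the growth of [E] and [H]; Cayley-Hamilton gives that growth without a Jordan
    form. Working with [H] rather than [E] is what makes the inversion easy: the extra [z^-1] yields
    decay like [1 / (1 + xi^2)], so the transform is integrable with a tail bound that does not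
    depend on [x], and [H 0 = 0] makes the extension by zero to the negative axis continuous.
    Folding [xi] and [- xi] together leaves a cosine kernel, so real and imaginary parts are
    inverted separately by a theorem on real functions. The statement quantifies over every [s]
    satisfying [is_s], not over one candidate. A limit in mean is determined only almost everywhere;
    the continuity in [is_s] pins [s] down on the positive axis. The derivative of [s] is not
    controlled at the delays, hence the identities off finite sets. *)

Section ComplexCalculus.
Variable R : realType.
Local Notation C := R[i].
Implicit Types (z w : C) (x y : R).

Lemma ReD z w : complex.Re (z + w) = complex.Re z + complex.Re w.
Proof. by case: z w => [a b] [c d]. Qed.

Lemma ImD z w : complex.Im (z + w) = complex.Im z + complex.Im w.
Proof. by case: z w => [a b] [c d]. Qed.

Lemma ReN z : complex.Re (- z) = - complex.Re z.
Proof. by case: z. Qed.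

Lemma ImN z : complex.Im (- z) = - complex.Im z.
Proof. by case: z. Qed.

Lemma ReM z w : complex.Re (z * w) =
  complex.Re z * complex.Re w - complex.Im z * complex.Im w.
Proof. by case: z w => [a b] [c d]. Qed.

Lemma ImM z w : complex.Im (z * w) =
  complex.Re z * complex.Im w + complex.Im z * complex.Re w.
Proof. by case: z w => [a b] [c d]. Qed.

Lemma ReZ x z : complex.Re (x%:C%C * z) = x * complex.Re z.
Proof. by rewrite ReM /= mul0r subr0. Qed.

Lemma ImZ x z : complex.Im (x%:C%C * z) = x * complex.Im z.
Proof. by rewrite ImM /= mul0r addr0. Qed.

Lemma ReV z : complex.Re (z^-1)%R =
  complex.Re z / (complex.Re z ^+ 2 + complex.Im z ^+ 2).
Proof. by case: z. Qed.

Lemma ImV z : complex.Im (z^-1)%R =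
  - (complex.Im z / (complex.Re z ^+ 2 + complex.Im z ^+ 2)).
Proof. by case: z. Qed.

Lemma Re_sum (I : Type) (r : seq I) (P : pred I) (F : I -> C) :
  complex.Re (\sum_(i <- r | P i) F i) = \sum_(i <- r | P i) complex.Re (F i).
Proof. by elim/big_rec2: _ => // i y1 y2 _ <-; rewrite ReD. Qed.

Lemma Im_sum (I : Type) (r : seq I) (P : pred I) (F : I -> C) :
  complex.Im (\sum_(i <- r | P i) F i) = \sum_(i <- r | P i) complex.Im (F i).
Proof. by elim/big_rec2: _ => // i y1 y2 _ <-; rewrite ImD. Qed.

Lemma complexP z w :
  complex.Re z = complex.Re w -> complex.Im z = complex.Im w -> z = w.
Proof. by case: z w => [a b] [c d] /= -> ->. Qed.

(* This norm is easier to estimate than the modulus, to which it is equivalent. *)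
Definition n1 z : R := `|complex.Re z| + `|complex.Im z|.

Lemma n1_ge0 z : 0 <= n1 z. Proof. exact: addr_ge0. Qed.

Lemma Re_le_n1 z : `|complex.Re z| <= n1 z. Proof. by rewrite lerDl. Qed.

Lemma Im_le_n1 z : `|complex.Im z| <= n1 z. Proof. by rewrite lerDr. Qed.

Lemma n1_0 : n1 0 = 0. Proof. by rewrite /n1 /= !normr0 addr0. Qed.

Lemma n1D z w : n1 (z + w) <= n1 z + n1 w.
Proof. by rewrite /n1 ReD ImD addrACA lerD// ler_normD. Qed.

Lemma n1N z : n1 (- z) = n1 z.
Proof. by rewrite /n1 ReN ImN !normrN. Qed.

Lemma n1M z w : n1 (z * w) <= n1 z * n1 w.
Proof.
rewrite /n1 ReM ImM.
apply: (@le_trans _ _ (`|complex.Re z| * `|complex.Re w|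
    + `|complex.Im z| * `|complex.Im w| + (`|complex.Re z| * `|complex.Im w|
    + `|complex.Im z| * `|complex.Re w|))); last by lra.
by rewrite -!normrM; apply: lerD; [exact: ler_normB|exact: ler_normD].
Qed.

Lemma n1_sum (I : Type) (r : seq I) (P : pred I) (F : I -> C) :
  n1 (\sum_(i <- r | P i) F i) <= \sum_(i <- r | P i) n1 (F i).
Proof.
elim/big_rec2: _ => [|i y1 y2 _ h]; first by rewrite n1_0.
by rewrite (le_trans (n1D _ _))// lerD2l.
Qed.

Lemma n1_real x : n1 x%:C%C = `|x|.
Proof. by rewrite /n1 /= normr0 addr0. Qed.

Lemma normc2E z :
  Normc.normc z ^+ 2 = complex.Re z ^+ 2 + complex.Im z ^+ 2.
Proof. by case: z => a b /=; rewrite sqr_sqrtr// addr_ge0// sqr_ge0. Qed.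

Definition isdC (f : R -> C) x (d : C) : Prop :=
  is_derive x 1 (fun y => complex.Re (f y)) (complex.Re d) /\
  is_derive x 1 (fun y => complex.Im (f y)) (complex.Im d).

Lemma isdC_eq f x d d' : isdC f x d -> d = d' -> isdC f x d'.
Proof. by move=> h <-. Qed.

Lemma isdC_cst (c : C) x : isdC (fun=> c) x 0.
Proof. by split; exact: is_derive_cst. Qed.

Lemma isdCD f g x df dg : isdC f x df -> isdC g x dg ->
  isdC (fun y => f y + g y) x (df + dg).
Proof.
move=> [f1 f2] [g1 g2]; split.
  rewrite ReD; under eq_fun do rewrite ReD; exact: is_deriveD.
by rewrite ImD; under eq_fun do rewrite ImD; exact: is_deriveD.
Qed.

Lemma isdCM f g x df dg : isdC f x df -> isdC g x dg ->
  isdC (fun y => f y * g y) x (df * g x + f x * dg).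
Proof.
move=> [f1 f2] [g1 g2]; split.
  rewrite ReD !ReM; under eq_fun do rewrite ReM.
  apply: is_derive_eq.
  by rewrite /GRing.scale /=; ring.
rewrite ImD !ImM; under eq_fun do rewrite ImM.
apply: is_derive_eq.
by rewrite /GRing.scale /=; ring.
Qed.

Lemma isdC_sum (I : Type) (r : seq I) (P : pred I) (f : I -> R -> C) x
    (d : I -> C) : (forall i, isdC (f i) x (d i)) ->
  isdC (fun y => \sum_(i <- r | P i) f i y) x (\sum_(i <- r | P i) d i).
Proof.
move=> h; elim: r => [|i r IH].
  under eq_fun do rewrite big_nil; rewrite big_nil; exact: isdC_cst.
under eq_fun do rewrite big_cons; rewrite big_cons.
by case: (P i) => //; exact: isdCD.
Qed.

Definition expc z : C := (expR (complex.Re z))%:C%C * expi (complex.Im z).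

Lemma Re_expcM z y : complex.Re (expc (z * y%:C%C)) =
  expR (complex.Re z * y) * cos (complex.Im z * y).
Proof. by rewrite /expc ReM ReM ImM /= !(mulr0, mul0r, subr0, add0r). Qed.

Lemma Im_expcM z y : complex.Im (expc (z * y%:C%C)) =
  expR (complex.Re z * y) * sin (complex.Im z * y).
Proof. by rewrite /expc ImM ReM ImM /= !(mulr0, mul0r, subr0, add0r, addr0). Qed.

Lemma isdC_expc z x :
  isdC (fun y => expc (z * y%:C%C)) x (z * expc (z * x%:C%C)).
Proof.
have ha (a : R) : is_derive x 1 (fun y => a * y) a.
  by apply: is_derive_eq; rewrite /GRing.scale /= mulr1.
have he (a : R) : is_derive x 1 (fun y => expR (a * y)) (a * expR (a * x)).
  by have /is_derive_eq := @is_derive1_comp _ (@expR R) _ _ _ _ (is_derive_expR _) (ha a); apply; rewrite mulrC.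
have hc (a : R) : is_derive x 1 (fun y => cos (a * y)) (- (a * sin (a * x))).
  by have /is_derive_eq := @is_derive1_comp _ (@cos R) _ _ _ _ (is_derive_cos _) (ha a); apply; rewrite mulNr mulrC.
have hs (a : R) : is_derive x 1 (fun y => sin (a * y)) (a * cos (a * x)).
  by have /is_derive_eq := @is_derive1_comp _ (@sin R) _ _ _ _ (is_derive_sin _) (ha a); apply; rewrite mulrC.
split.
  under eq_fun do rewrite Re_expcM.
  have := is_deriveM (he (complex.Re z)) (hc (complex.Im z)).
  by move=> /is_derive_eq; apply; rewrite ReM Re_expcM Im_expcM /GRing.scale /=; ring.
under eq_fun do rewrite Im_expcM.
have := is_deriveM (he (complex.Re z)) (hs (complex.Im z)).
by move=> /is_derive_eq; apply; rewrite ImM Re_expcM Im_expcM /GRing.scale /=; ring.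
Qed.

Lemma expc0 : expc 0 = 1.
Proof. by rewrite /expc /= expR0 mul1r /expi cos0 sin0. Qed.

Lemma expcD z w : expc (z + w) = expc z * expc w.
Proof.
rewrite /expc ReD ImD expRD /expi cosD sinD.
by apply: complexP; rewrite !(ReM,ImM) /=; ring.
Qed.

Lemma n1_expc z : n1 (expc z) <= 2 * expR (complex.Re z).
Proof.
rewrite /expc (le_trans (n1M _ _))// n1_real ger0_norm ?expR_ge0// mulrC.
rewrite ler_wpM2r ?expR_ge0// /n1 /= (_ : 2 = 1 + 1 :> R)//.
by rewrite lerD// ler_norml ?cos_geN1 ?cos_le1 ?sin_geN1 ?sin_le1.
Qed.

Definition isdM (m n : nat) (F : R -> 'M[C]_(m, n)) x (D : 'M[C]_(m, n)) :=
  forall i j, isdC (fun y => F y i j) x (D i j).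

Lemma isdM_eq m n (F : R -> 'M[C]_(m, n)) x D D' :
  isdM F x D -> D = D' -> isdM F x D'.
Proof. by move=> h <-. Qed.

Lemma isdM_cst m n (A : 'M[C]_(m, n)) x : isdM (fun=> A) x 0.
Proof. by move=> i j; rewrite mxE; exact: isdC_cst. Qed.

Lemma isdMD m n (F G : R -> 'M[C]_(m, n)) x D E : isdM F x D -> isdM G x E ->
  isdM (fun y => F y + G y) x (D + E).
Proof.
by move=> hF hG i j; rewrite mxE; under eq_fun do rewrite mxE; exact: isdCD.
Qed.

Lemma isdMM m n p (F : R -> 'M[C]_(m, n)) (G : R -> 'M[C]_(n, p)) x D E :
  isdM F x D -> isdM G x E ->
  isdM (fun y => F y *m G y) x (D *m G x + F x *m E).
Proof.
move=> hF hG i j; rewrite !mxE -big_split /=; under eq_fun do rewrite mxE.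
by apply: isdC_sum => k; exact: isdCM.
Qed.

Lemma isdMZ m n (f : R -> C) (F : R -> 'M[C]_(m, n)) x d D :
  isdC f x d -> isdM F x D ->
  isdM (fun y => f y *: F y) x (d *: F x + f x *: D).
Proof.
by move=> hf hF i j; rewrite !mxE; under eq_fun do rewrite mxE; exact: isdCM.
Qed.

Lemma isdM_mulmxl m n p (A : 'M[C]_(m, n)) (G : R -> 'M[C]_(n, p)) x E :
  isdM G x E -> isdM (fun y => A *m G y) x (A *m E).
Proof.
move=> hG; apply: isdM_eq; first exact: (isdMM (isdM_cst A x) hG).
by rewrite mul0mx add0r.
Qed.

Lemma isdM_mulmxr m n p (A : 'M[C]_(n, p)) (G : R -> 'M[C]_(m, n)) x E :
  isdM G x E -> isdM (fun y => G y *m A) x (E *m A).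
Proof.
move=> hG; apply: isdM_eq; first exact: (isdMM hG (isdM_cst A x)).
by rewrite mulmx0 addr0.
Qed.

Lemma isdM_scalel m n (c : C) (F : R -> 'M[C]_(m, n)) x D :
  isdM F x D -> isdM (fun y => c *: F y) x (c *: D).
Proof.
move=> hF; apply: isdM_eq; first exact: (isdMZ (isdC_cst c x) hF).
by rewrite scale0r add0r.
Qed.

Lemma isdM_comp_affine m n (F : R -> 'M[C]_(m, n)) (a b : R) x D :
  isdM F (a * x + b) D -> isdM (fun y => F (a * y + b)) x (a%:C%C *: D).
Proof.
have h (f : R -> R) d : is_derive (a * x + b) 1 f d ->
    is_derive x 1 (fun y => f (a * y + b)) (a * d).
  move=> fd; have hg : is_derive x 1 (fun y => a * y + b) a.
    by apply: is_derive_eq; rewrite addr0 /GRing.scale /= mulr1.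
  by have /is_derive_eq := @is_derive1_comp _ f (fun y => a * y + b) x _ _ fd hg; apply; rewrite mulrC.
move=> hF i j; have [hr hi] := hF i j; split.
  by rewrite mxE ReM /= mul0r subr0; exact: (h (fun y => complex.Re (F y i j))).
by rewrite mxE ImM /= mul0r addr0; exact: (h (fun y => complex.Im (F y i j))).
Qed.

(** The tool behind the identities of the matrix exponential: a suitable product is differentiated
    and the result is zero. *)
Lemma isdM_0_cst m n (F : R -> 'M[C]_(m, n)) :
  (forall x, isdM F x 0) -> forall x y, F x = F y.
Proof.
move=> hF x y; apply/matrixP => i j; apply: complexP.
  apply: (@is_derive_0_is_cst R (fun y => complex.Re (F y i j))) => t.
  by have [+ _] := hF t i j; rewrite mxE.
apply: (@is_derive_0_is_cst R (fun y => complex.Im (F y i j))) => t.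
by have [_] := hF t i j; rewrite mxE.
Qed.

Lemma isdC_Re_continuous f : (forall x, exists d, isdC f x d) ->
  continuous (fun x => complex.Re (f x)).
Proof.
move=> h x; have [d [[+ _] _]] := h x.
by move=> /derivable1_diffP /differentiable_continuous.
Qed.

Lemma isdC_Im_continuous f : (forall x, exists d, isdC f x d) ->
  continuous (fun x => complex.Im (f x)).
Proof.
move=> h x; have [d [_ [+ _]]] := h x.
by move=> /derivable1_diffP /differentiable_continuous.
Qed.

End ComplexCalculus.

(** * The matrix exponential *)

(** Locked, so that conversion does not unfold the limits inside [expmx]. The scalar is a separate
    argument because everything below is calculus in [x] with [A] fixed. *)
HB.lock Definition expxA (R : realType) (n : nat) (A : 'M[R[i]]_n) (x : R) :=
  expmx (x%:C%C *: A).

Section MatrixExponential.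
Variable R : realType.
Local Notation C := R[i].

(** Dominated by [K] times the exponential series at [b |x|]. *)
Lemma cvg_egf (a : nat -> R) (K b x : R) : 0 <= b ->
  (forall k, `|a k| <= K * b ^+ k) ->
  cvgn (pseries (fun k => a k / k`!%:R) x).
Proof.
move=> b0 ha; apply: normed_cvg.
have K0 : 0 <= K by have := ha 0%N; rewrite expr0 mulr1; apply: le_trans.
apply: (@series_le_cvg _ _ (fun k => K * exp_coeff (b * `|x|) k)).
- by move=> k /=; exact: normr_ge0.
- by move=> k; rewrite mulr_ge0// exp_coeff_ge0// mulr_ge0.
- move=> k /=; rewrite /exp_coeff /= normrM normrM normfV normr_nat normrX.
  have -> : `|a k| / k`!%:R * `|x| ^+ k = `|a k| * (`|x| ^+ k / k`!%:R) by ring.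
  have -> : K * ((b * `|x|) ^+ k / k`!%:R) = K * b ^+ k * (`|x| ^+ k / k`!%:R).
    by rewrite exprMn; ring.
  by rewrite ler_wpM2r// divr_ge0// exprn_ge0.
- rewrite (_ : (fun k => _) = K *: exp_coeff (b * `|x|)); last by [].
  exact/is_cvg_seriesZ/is_cvg_series_exp_coeff.
Qed.

(** With the factorials in place, termwise differentiation merely shifts [a]. The geometric bound
    survives shifts, so the series and its first two derived series all converge at [|x| + 1]. *)
Lemma is_derive_egf (a : nat -> R) (K b x : R) : 0 <= b ->
  (forall k, `|a k| <= K * b ^+ k) ->
  is_derive x 1 (fun y => limn (pseries (fun k => a k / k`!%:R) y))
    (limn (pseries (fun k => a k.+1 / k`!%:R) x)).
Proof.
move=> b0 ha.
have diffsE c : pseries_diffs (fun k => c k / k`!%:R) =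
    (fun k => c k.+1 / k`!%:R) :> (nat -> R).
  apply/funext => k; rewrite /pseries_diffs factS natrM invfM.
  by rewrite mulrCA mulVKf// pnatr_eq0.
have hS c L : (forall k, `|c k| <= L * b ^+ k) ->
    forall k, `|c k.+1 : R| <= L * b * b ^+ k.
  by move=> hc k; rewrite -mulrA -exprS.
have hc1 := hS _ _ ha; have hc2 := hS _ _ hc1.
have := @pseries_snd_diffs R (fun k => a k / k`!%:R) (`|x| + 1) x.
rewrite !diffsE; apply; rewrite ?(diffsE (fun k => a k.+1)).
- exact: cvg_egf b0 ha.
- exact: cvg_egf b0 hc1.
- exact: cvg_egf b0 hc2.
- by rewrite [X in _ < X]ger0_norm ?addr_ge0// ltrDl.
Qed.

Definition cvgC (u : nat -> C) (l : C) : Prop :=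
  ((fun N => complex.Re (u N)) @ \oo --> complex.Re l) /\
  ((fun N => complex.Im (u N)) @ \oo --> complex.Im l).

Lemma cvgC_unique u l l' : cvgC u l -> cvgC u l' -> l = l'.
Proof.
move=> [a b] [c d]; apply: complexP.
  by rewrite -(cvg_lim _ a)// -(cvg_lim _ c).
by rewrite -(cvg_lim _ b)// -(cvg_lim _ d).
Qed.

Lemma cvg_sumR (T I : Type) (F : set_system T) (r : seq I) (f : I -> T -> R)
    (l : I -> R) : Filter F -> (forall i, f i @ F --> l i) ->
  (fun x => \sum_(i <- r) f i x) @ F --> \sum_(i <- r) l i.
Proof.
move=> FF h; elim: r => [|i r IH].
  by under eq_fun do rewrite big_nil; rewrite big_nil; exact: cvg_cst.
by under eq_fun do rewrite big_cons; rewrite big_cons; exact: cvgD.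
Qed.

Lemma cvgC_sumZ (I : finType) (c : I -> C) (u : I -> nat -> C) (l : I -> C) :
  (forall i, cvgC (u i) (l i)) ->
  cvgC (fun N => \sum_i c i * u i N) (\sum_i c i * l i).
Proof.
move=> h; split.
  rewrite Re_sum; under eq_fun do rewrite Re_sum.
  apply: cvg_sumR => i; rewrite ReM; under eq_fun do rewrite ReM.
  by have [hr hi] := h i; apply: cvgB; exact: cvgMr.
rewrite Im_sum; under eq_fun do rewrite Im_sum.
apply: cvg_sumR => i; rewrite ImM; under eq_fun do rewrite ImM.
by have [hr hi] := h i; apply: cvgD; exact: cvgMr.
Qed.

Section EGF.
Variables m n : nat.
Implicit Types Ms : nat -> 'M[C]_(m, n).

Definition egf_bounded Ms := exists K b, 0 <= b /\
  forall k i j, n1 (Ms k i j) <= K * b ^+ k.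

(* entrywise exponential generating function *)
Definition egf Ms (x : R) : 'M[C]_(m, n) := \matrix_(i, j) Complex
  (limn (pseries (fun k => complex.Re (Ms k i j) / k`!%:R) x))
  (limn (pseries (fun k => complex.Im (Ms k i j) / k`!%:R) x)).

Lemma egfP Ms x : egf_bounded Ms -> forall i j,
  cvgC (fun N => \sum_(k < N) (x ^+ k / k`!%:R)%:C%C * Ms k i j) (egf Ms x i j).
Proof.
move=> [K [b [b0 h]]] i j.
have hr k : `|complex.Re (Ms k i j)| <= K * b ^+ k by exact: le_trans (Re_le_n1 _) _.
have hi k : `|complex.Im (Ms k i j)| <= K * b ^+ k by exact: le_trans (Im_le_n1 _) _.
rewrite mxE; split => /=.
  rewrite [X in X @ _ --> _](_ : _ = pseries (fun k => complex.Re (Ms k i j) / k`!%:R) x).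
    exact: cvg_egf b0 hr.
  apply/funext => N; rewrite /pseries /series /= big_mkord Re_sum.
  by apply: eq_bigr => k _; rewrite ReM /= mul0r subr0; ring.
rewrite [X in X @ _ --> _](_ : _ = pseries (fun k => complex.Im (Ms k i j) / k`!%:R) x).
  exact: cvg_egf b0 hi.
apply/funext => N; rewrite /pseries /series /= big_mkord Im_sum.
by apply: eq_bigr => k _; rewrite ImM /= mul0r addr0; ring.
Qed.

Lemma isdM_egf Ms x : egf_bounded Ms ->
  isdM (egf Ms) x (egf (fun k => Ms k.+1) x).
Proof.
move=> [K [b [b0 h]]] i j.
have hr k : `|complex.Re (Ms k i j)| <= K * b ^+ k by exact: le_trans (Re_le_n1 _) _.
have hi k : `|complex.Im (Ms k i j)| <= K * b ^+ k by exact: le_trans (Im_le_n1 _) _.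
by split; rewrite mxE /=; under eq_fun do rewrite mxE /=; exact: is_derive_egf b0 _.
Qed.

Lemma egf0 Ms : egf_bounded Ms -> egf Ms 0 = Ms 0%N.
Proof.
move=> h; apply/matrixP => i j; apply: cvgC_unique (egfP _ h i j) _.
have E N : \sum_(k < N.+1) (0 ^+ k / k`!%:R : R)%:C%C * Ms k i j = Ms 0%N i j.
  rewrite big_ord_recl /= expr0 fact0 divr1 mul1r big1 ?addr0// => k _.
  by rewrite /bump /= add1n expr0n /= mul0r mul0r.
by split; rewrite -cvg_shiftS /=; under eq_fun do rewrite E; exact: cvg_cst.
Qed.

End EGF.

Lemma egf_mull m n p (A : 'M[C]_(m, n)) (Ms : nat -> 'M[C]_(n, p)) x :
  egf_bounded Ms -> egf_bounded (fun k => A *m Ms k) ->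
  egf (fun k => A *m Ms k) x = A *m egf Ms x.
Proof.
move=> h hA; apply/matrixP => i j; apply: cvgC_unique (egfP x hA i j) _.
rewrite mxE; have := cvgC_sumZ (A i) (fun k => egfP x h k j).
congr (cvgC _ _); apply/funext => N.
under eq_bigr do rewrite mulr_sumr.
rewrite exchange_big /=; apply: eq_bigr => k _.
by rewrite mxE mulr_sumr; apply: eq_bigr => l _; rewrite mulrCA.
Qed.

Lemma egf_mulr m n p (A : 'M[C]_(n, p)) (Ms : nat -> 'M[C]_(m, n)) x :
  egf_bounded Ms -> egf_bounded (fun k => Ms k *m A) ->
  egf (fun k => Ms k *m A) x = egf Ms x *m A.
Proof.
move=> h hA; apply/matrixP => i j; apply: cvgC_unique (egfP x hA i j) _.
rewrite mxE; under eq_bigr do rewrite mulrC.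
have := cvgC_sumZ (A^~ j) (fun k => egfP x h i k).
congr (cvgC _ _); apply/funext => N.
under eq_bigr do rewrite mulr_sumr.
rewrite exchange_big /=; apply: eq_bigr => k _.
by rewrite mxE mulr_sumr; apply: eq_bigr => l _; rewrite mulrCA [A _ _ * _]mulrC.
Qed.

Section Expmx.
Variable n : nat.
Implicit Types A : 'M[C]_n.

Lemma expr_bounded A : egf_bounded (fun k => A ^+ k).
Proof.
pose b := \sum_i \sum_j n1 (A i j).
have hb i j : n1 (A i j) <= b.
  rewrite /b (bigD1 i)//= (bigD1 j)//= -addrA lerDl addr_ge0//.
    by apply: sumr_ge0 => k _; exact: n1_ge0.
  by apply: sumr_ge0 => k _; apply: sumr_ge0 => l _; exact: n1_ge0.
have b0 : 0 <= b by apply: sumr_ge0 => k _; apply: sumr_ge0 => l _; exact: n1_ge0.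
(* An entry of the product with [A] is a sum of [n] terms, each at most [b] times the previous
   bound, hence the ratio [n b]. *)
exists 1, (n%:R * b); split => [|k]; first by rewrite mulr_ge0.
elim: k => [|k IH] i j.
  rewrite !expr0 mul1r !mxE; case: (i == j); last by rewrite n1_0.
  by rewrite /n1 /= normr1 normr0 addr0.
rewrite mul1r exprS -[A * _]/(A *m _) mxE (le_trans (n1_sum _ _ _))//.
rewrite exprS -mulrA [X in X * _](_ : _ = \sum_(l < n) 1); last first.
  by rewrite sumr_const card_ord.
rewrite mulr_suml; apply: ler_sum => l _; rewrite mul1r.
rewrite (le_trans (n1M _ _))// ler_pM ?n1_ge0//.
by have := IH l j; rewrite mul1r.
Qed.

Lemma egf_boundedS (Ms : nat -> 'M[C]_n) : egf_bounded Ms ->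
  egf_bounded (fun k => Ms k.+1).
Proof.
move=> [K [b [b0 h]]]; exists (K * b), b; split => // k i j.
by rewrite -mulrA -exprS.
Qed.

Lemma exprZmx (c : C) A k : (c *: A) ^+ k = c ^+ k *: A ^+ k.
Proof.
elim: k => [|k IH]; first by rewrite !expr0 scale1r.
rewrite exprS IH -[_ * _]/(_ *m _) -scalemxAl -scalemxAr scalerA -exprS.
by rewrite [A ^+ _.+1]exprS.
Qed.

(** The bridge from the limit of matrix partial sums in [expmx] to scalar power series in [x], which
    can be differentiated termwise. *)
Lemma expxAE A : expxA A = egf (fun k => A ^+ k).
Proof.
apply/funext => x; apply/matrixP => i j.
have [hr hi] := egfP x (expr_bounded A) i j.
have uE N : (\sum_(k < N) k`!%:R^-1 *: (x%:C%C *: A) ^+ k) i j =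
    \sum_(k < N) (x ^+ k / k`!%:R)%:C%C * (A ^+ k) i j.
  rewrite summxE; apply: eq_bigr => k _.
  rewrite mxE exprZmx mxE mulrA; congr (_ * _).
  by rewrite rmorphM rmorphXn fmorphV rmorph_nat mulrC.
rewrite expxA.unlock mxE /limC; apply: complexP => /=.
  by rewrite -(cvg_lim _ hr)//; under eq_fun do rewrite uE.
by rewrite -(cvg_lim _ hi)//; under eq_fun do rewrite uE.
Qed.

Lemma exprS_bounded A : egf_bounded (fun k => A ^+ k.+1).
Proof. exact/egf_boundedS/expr_bounded. Qed.

Lemma egf_exprS A x : egf (fun k => A ^+ k.+1) x = A *m expxA A x.
Proof.
rewrite expxAE -egf_mull; first by congr egf; apply/funext => k; rewrite exprS.
  exact: expr_bounded.
rewrite (_ : (fun k => _) = (fun k => A ^+ k.+1)); first exact: exprS_bounded.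
by apply/funext => k; rewrite exprS.
Qed.

Lemma expxA_comm A x : expxA A x *m A = A *m expxA A x.
Proof.
rewrite -egf_exprS expxAE -egf_mulr.
- by congr egf; apply/funext => k; rewrite exprSr.
- exact: expr_bounded.
- rewrite (_ : (fun k => _) = (fun k => A ^+ k.+1)); first exact: exprS_bounded.
  by apply/funext => k; rewrite exprSr.
Qed.

Lemma isdM_expxA A x : isdM (expxA A) x (A *m expxA A x).
Proof.
by rewrite -egf_exprS expxAE; exact/isdM_egf/expr_bounded.
Qed.

Lemma expxA0 A : expxA A 0 = 1%:M.
Proof. by rewrite expxAE egf0 ?expr0//; exact: expr_bounded. Qed.

Lemma isdM_expxAN A x : isdM (fun y => expxA A (- y)) x (- (A *m expxA A (- x))).
Proof.
have E : (fun y => expxA A (- y)) = (fun y => expxA A (-1 * y + 0)).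
  by apply/funext => y; rewrite mulN1r addr0.
rewrite E; apply: isdM_eq; first exact/isdM_comp_affine/isdM_expxA.
by rewrite mulN1r addr0 rmorphN1 scaleN1r.
Qed.

Lemma expxA_mulNl A x : expxA A (- x) *m expxA A x = 1%:M.
Proof.
have h y : isdM (fun y => expxA A (- y) *m expxA A y) y 0.
  apply: isdM_eq; first exact: isdMM (isdM_expxAN A y) (isdM_expxA A y).
  by rewrite mulNmx -(expxA_comm A (- y)) -mulmxA addNr.
by rewrite (isdM_0_cst h x 0) oppr0 expxA0 mulmx1.
Qed.

Lemma expxA_mulNr A x : expxA A x *m expxA A (- x) = 1%:M.
Proof. by have := expxA_mulNl A (- x); rewrite opprK. Qed.

(** The product of [e^(- x A)] and [F x] has zero derivative. This uniqueness yields the addition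
    formula, the adjoint and the diagonal case. *)
Lemma expxA_unique m A (F : R -> 'M[C]_(n, m)) :
  (forall x, isdM F x (A *m F x)) -> forall x, F x = expxA A x *m F 0.
Proof.
move=> hF x.
have h y : isdM (fun y => expxA A (- y) *m F y) y 0.
  apply: isdM_eq; first exact: isdMM (isdM_expxAN A y) (hF y).
  by rewrite mulNmx -(expxA_comm A (- y)) -mulmxA addNr.
have := isdM_0_cst h x 0; rewrite oppr0 expxA0 mul1mx => <-.
by rewrite mulmxA expxA_mulNr mul1mx.
Qed.

Lemma expxAD A x y : expxA A (x + y) = expxA A x *m expxA A y.
Proof.
have h z : isdM (fun z => expxA A (z + y)) z (A *m expxA A (z + y)).
  have E : (fun z => expxA A (z + y)) = (fun z => expxA A (1 * z + y)).
    by apply/funext => u; rewrite mul1r.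
  rewrite E; apply: isdM_eq; first exact/isdM_comp_affine/isdM_expxA.
  by rewrite mul1r scale1r.
by rewrite (expxA_unique h x) add0r.
Qed.

(** The primitive is the generating function of [0, 1, A, A^2, ...], whose shift generates the
    exponential. Unlike [A^-1 (e^(x A) - 1)] it makes sense for singular [A]. *)
Lemma expxA_primitive A : exists H : R -> 'M[C]_n,
  H 0 = 0 /\ forall x, isdM H x (expxA A x).
Proof.
pose Ms k : 'M[C]_n := if k is k'.+1 then A ^+ k' else 0.
have hMs : egf_bounded Ms.
  have [K [b [b0 h]]] := expr_bounded A.
  (* The shift costs one power, and [b ^+ k <= (b + 1) ^+ k.+1] holds even when [b < 1]. *)
  exists `|K|, (b + 1); split => [|[|k] i j]; first by rewrite addr_ge0.
    by rewrite mxE n1_0 expr0 mulr1.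
  rewrite (le_trans (h k i j))// (@le_trans _ _ (`|K| * b ^+ k))//.
    by rewrite ler_wpM2r ?exprn_ge0// ler_norm.
  rewrite ler_wpM2l// exprS -[leLHS]mul1r ler_pM//= ?exprn_ge0//.
    by rewrite lerDr.
  by rewrite lerXn2r ?nnegrE ?addr_ge0// lerDl.
exists (egf Ms); split=> [|x]; first by rewrite egf0.
by rewrite expxAE; exact: (isdM_egf x hMs).
Qed.

End Expmx.
End MatrixExponential.

(** * Exponential growth bounds *)

Section Growth.
Variable R : realType.
Local Notation C := R[i].

Lemma is_derive_continuous (f df : R -> R) :
  (forall x : R, is_derive x 1 f (df x)) -> continuous f.
Proof.
by move=> h x; have [+ _] := h x => /derivable1_diffP /differentiable_continuous.
Qed.

Lemma ge0_is_derive_le (f df : R -> R) (a b : R) : a <= b ->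
  (forall x : R, is_derive x 1 f (df x)) ->
  (forall x, a <= x <= b -> 0 <= df x) -> f a <= f b.
Proof.
move=> ab h h0; have [|c cab E] := @MVT_segment R f df a b ab (fun x _ => h x).
  exact/continuous_subspaceT/(is_derive_continuous h).
by rewrite -subr_ge0 E mulr_ge0 ?subr_ge0// h0//; move: cab; rewrite in_itv.
Qed.

Lemma is_derive_expRM (a x : R) :
  is_derive x 1 (fun y => expR (a * y)) (a * expR (a * x)).
Proof.
have ha : is_derive x 1 (fun y => a * y) a.
  by apply: is_derive_eq; rewrite /GRing.scale /= mulr1.
by have /is_derive_eq := @is_derive1_comp _ (@expR R) _ _ _ _ (is_derive_expR _) ha;
  apply; rewrite mulrC.
Qed.

(** Both [K / d * expR (d * x) + f x] and [K / d * expR (d * x) - f x] are nondecreasing on the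
    half-line; comparison with their values at [0] gives the bound, for either sign of [d]. *)
Lemma exp_bounded_primitive (f df : R -> R) (K d : R) : d != 0 ->
  (forall x : R, is_derive x 1 f (df x)) ->
  (forall x : R, 0 <= x -> `|df x| <= K * expR (d * x)) ->
  forall x : R, 0 <= x -> `|f x - f 0| <= K / d * (expR (d * x) - 1).
Proof.
move=> d0 hf hK x x0.
have hg (y : R) : is_derive y 1 (fun y => K / d * expR (d * y)) (K * expR (d * y)).
  have E := is_derive_expRM d y.
  have /is_derive_eq := is_deriveM (is_derive_cst (K / d) y 1) E; apply.
  by rewrite /GRing.scale /= mulr0 addr0; field.
have := @ge0_is_derive_le (fun y => K / d * expR (d * y) - f y)
  (fun y => K * expR (d * y) - df y) 0 x x0.
have := @ge0_is_derive_le (fun y => K / d * expR (d * y) + f y)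
  (fun y => K * expR (d * y) + df y) 0 x x0.
have h1 (y : R) : is_derive y 1 (fun y => K / d * expR (d * y) + f y) (K * expR (d * y) + df y).
  exact: is_deriveD (hg y) (hf y).
have h2 (y : R) : is_derive y 1 (fun y => K / d * expR (d * y) - f y) (K * expR (d * y) - df y).
  exact: is_deriveB (hg y) (hf y).
have h3 y : 0 <= y <= x -> 0 <= K * expR (d * y) + df y.
  by move=> /andP[/hK + _]; rewrite ler_norml => /andP[? _]; lra.
have h4 y : 0 <= y <= x -> 0 <= K * expR (d * y) - df y.
  by move=> /andP[/hK + _]; rewrite ler_norml => /andP[_ ?]; lra.
move=> /(_ h1 h3) A /(_ h2 h4) B; move: A B; rewrite mulr0 expR0 => A B.
by rewrite ler_norml; lra.
Qed.

Lemma exp_bounded_primitiveC (f df : R -> C) (K d : R) : d != 0 ->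
  (forall x : R, isdC f x (df x)) ->
  (forall x : R, 0 <= x -> n1 (df x) <= K * expR (d * x)) ->
  forall x : R, 0 <= x -> n1 (f x - f 0) <= 2 * (K / d * (expR (d * x) - 1)).
Proof.
move=> d0 hf hK x x0.
have h1 := @exp_bounded_primitive (fun y => complex.Re (f y))
  (fun y => complex.Re (df y)) K d d0 (fun y => (hf y).1).
have h2 := @exp_bounded_primitive (fun y => complex.Im (f y))
  (fun y => complex.Im (df y)) K d d0 (fun y => (hf y).2).
have {h1} := h1 (fun y y0 => le_trans (Re_le_n1 _) (hK y y0)) x x0.
have {h2} := h2 (fun y y0 => le_trans (Im_le_n1 _) (hK y y0)) x x0.
by rewrite /n1 ReD ImD ReN ImN; lra.
Qed.

Lemma exp_growth_primitiveC (f df : R -> C) (K d : R) : 0 < d ->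
  (forall x : R, isdC f x (df x)) ->
  (forall x : R, 0 <= x -> n1 (df x) <= K * expR (d * x)) ->
  forall x : R, 0 <= x -> n1 (f x) <= n1 (f 0) + 2 * (K / d) * expR (d * x).
Proof.
move=> d0 hf hK x x0.
have K0 : 0 <= K.
  by have := hK 0 (lexx _); rewrite mulr0 expR0 mulr1; apply: le_trans; exact: n1_ge0.
have := @exp_bounded_primitiveC f df K d (lt0r_neq0 d0) hf hK x x0.
have := n1D (f 0) (f x - f 0); rewrite addrC subrK.
have : 0 <= K / d by rewrite divr_ge0// ltW.
by lra.
Qed.

(* With [M ∏_(a <- s) (A - a) = 0], the factors of the product are peeled off
   one at a time: [G = M e^{xA}] satisfies [G' = a G + M (A - a) e^{xA}], where
   the last term is bounded by the induction hypothesis. *)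
Lemma annihilated_growth n' m (A : 'M[C]_n'.+1) (w : R) (s : seq C)
    (M : 'M[C]_(m, n'.+1)) : 0 < w ->
  (forall a, a \in s -> complex.Re a < w) ->
  M *m (\prod_(a <- s) (A - a%:M)) = 0 ->
  exists K, forall (x : R) i j, 0 <= x -> n1 ((M *m expxA A x) i j) <= K * expR (w * x).
Proof.
move=> w0; elim: s M => [|a s IH] M hs.
  rewrite big_nil mulmx1 => ->; exists 0 => x i j _.
  by rewrite mul0mx mxE n1_0 mul0r.
rewrite big_cons -[_ * _]/(_ *m _) mulmxA => /IH[].
  by move=> b bs; apply: hs; rewrite inE bs orbT.
move=> K hK; have {hs} aw : complex.Re a < w by apply: hs; rewrite inE eqxx.
have wa : 0 < w - complex.Re a by rewrite subr_gt0.
have K0 (i : 'I_m) (j : 'I_n'.+1) : 0 <= K.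
  have := hK 0 i j (lexx _); rewrite mulr0 expR0 mulr1.
  by apply: le_trans; exact: n1_ge0.
(* The factor [e^(- a x)] cancels the term [a G], leaving in the derivative only what the induction
   hypothesis bounds. *)
pose F x := expc (- a * x%:C%C) *: (M *m expxA A x).
pose F' x := expc (- a * x%:C%C) *: (M *m (A - a%:M) *m expxA A x).
have dF x : isdM F x (F' x).
  have h1 : isdM (fun y => M *m expxA A y) x (M *m (A *m expxA A x)).
    exact/isdM_mulmxl/isdM_expxA.
  apply: isdM_eq; first exact: isdMZ (isdC_expc (- a) x) h1.
  rewrite /F' mulmxBr mulmxBl scalerBr -!mulmxA mul_scalar_mx -scalemxAr scalerA.
  by rewrite mulNr scaleNr addrC [a * _]mulrC.
pose B := \sum_i \sum_j n1 (M i j).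
have hB i j : n1 (M i j) <= B.
  rewrite /B (bigD1 i)//= (bigD1 j)//= -addrA lerDl addr_ge0//.
    by apply: sumr_ge0 => k _; exact: n1_ge0.
  by apply: sumr_ge0 => k _; apply: sumr_ge0 => l _; exact: n1_ge0.
exists (2 * (B + 2 * (2 * K / (w - complex.Re a)))) => x i j x0.
have hF' y : 0 <= y -> n1 (F' y i j) <= 2 * K * expR ((w - complex.Re a) * y).
  move=> y0; rewrite mxE (le_trans (n1M _ _))//.
  have -> : (w - complex.Re a) * y = - complex.Re a * y + w * y by ring.
  rewrite expRD.
  have := ler_pM (n1_ge0 _) (n1_ge0 _) (n1_expc (- a * y%:C%C)) (hK y i j y0).
  rewrite ReM ReN /= mulr0 subr0 => /le_trans; apply.
  by rewrite le_eqVlt; apply/orP; left; apply/eqP; ring.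
have := exp_growth_primitiveC wa (fun y => dF y i j) hF' x0.
have -> : F 0 i j = M i j by rewrite mxE expxA0 mulmx1 mulr0 expc0 mul1r.
move=> hF.
have -> : (M *m expxA A x) i j = expc (a * x%:C%C) * F x i j.
  by rewrite /F [in RHS]mxE mulrA -expcD mulNr subrr expc0 mul1r.
rewrite (le_trans (n1M _ _))//.
have := ler_pM (n1_ge0 _) (n1_ge0 _) (n1_expc (a * x%:C%C)) hF.
rewrite ReM /= mulr0 subr0 => /le_trans; apply.
have -> : w * x = complex.Re a * x + (w - complex.Re a) * x by ring.
rewrite expRD [leRHS](_ : _ = 2 * expR (complex.Re a * x) *
  ((B + 2 * (2 * K / (w - complex.Re a))) * expR ((w - complex.Re a) * x))); last by ring.
rewrite ler_wpM2l// ?mulr_ge0 ?expR_ge0// [(B + _) * _]mulrDl lerD2r.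
rewrite (le_trans (hB i j))// ler_peMr ?(le_trans _ (hB i j)) ?n1_ge0//.
by rewrite -expR0 ler_expR mulr_ge0// ltW.
Qed.

(** By Cayley-Hamilton the linear factors of the characteristic polynomial annihilate [1], and its
    roots are eigenvalues. The strict inequality leaves room for the polynomial factors due to
    multiple eigenvalues. Size [0] is split off because the ring of square matrices needs a positive
    size. *)
Lemma expxA_growth n (A : 'M[C]_n) (w : R) : 0 < w ->
  (forall a, eigenvalue A a -> complex.Re a < w) ->
  exists K, forall (x : R) i j, 0 <= x -> n1 (expxA A x i j) <= K * expR (w * x).
Proof.
case: n A => [|n'] A w0 hA; first by exists 0 => x [].
have [s hs] := closed_field_poly_normal (char_poly A).
have hsA a : a \in s -> complex.Re a < w.
  move=> sa; apply: hA; rewrite eigenvalue_root_char hs.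
  by rewrite rootZ ?root_prod_XsubC// lead_coef_eq0 monic_neq0// char_poly_monic.
have := @annihilated_growth n' _ A w s 1%:M w0 hsA.
rewrite mul1mx; case.
  have := Cayley_Hamilton A; rewrite hs (monicP (char_poly_monic A)) scale1r.
  rewrite rmorph_prod => <-; apply: eq_bigr => a _.
  by rewrite rmorphB /= horner_mx_X horner_mx_C.
by move=> K hK; exists K => x i j x0; have := hK x i j x0; rewrite mul1mx.
Qed.

End Growth.

(** * Adjoints of matrix functions *)

Section ConjugateTranspose.
Variable R : realType.
Local Notation C := R[i].

Lemma Re_conj (z : C) : complex.Re z^* = complex.Re z.
Proof. by case: z. Qed.

Lemma Im_conj (z : C) : complex.Im z^* = - complex.Im z.
Proof. by case: z. Qed.

Lemma trmxC_mul m n p (A : 'M[C]_(m, n)) (B : 'M[C]_(n, p)) :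
  (A *m B) ^t* = B ^t* *m A ^t*.
Proof. by rewrite trmx_mul map_mxM. Qed.

Lemma isdM_trmxC m n (F : R -> 'M[C]_(m, n)) x D :
  isdM F x D -> isdM (fun y => (F y) ^t*) x (D ^t*).
Proof.
move=> h i j; have [hr hi] := h j i; rewrite !mxE; split.
  by rewrite Re_conj; under eq_fun do rewrite !mxE Re_conj.
rewrite Im_conj; under eq_fun do rewrite !mxE Im_conj.
exact: is_deriveN.
Qed.

Lemma trmxC_expxA n (A : 'M[C]_n) x : (expxA A x) ^t* = expxA (A ^t*) x.
Proof.
rewrite (@expxA_unique _ _ _ (A ^t*) (fun x => (expxA A x) ^t*)).
  by rewrite expxA0 trmx1 map_mx1 mulmx1.
move=> y; apply: isdM_eq; first exact/isdM_trmxC/isdM_expxA.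
by rewrite -expxA_comm trmxC_mul.
Qed.

End ConjugateTranspose.

(** * Fourier inversion by Abel summation *)

Section HalfLine.
Variable R : realType.
Local Notation mu := (@lebesgue_measure R).
Implicit Types (f F g : R -> R) (a b : R).

Lemma continuous_integrable_itv f a b : continuous f ->
  mu.-integrable `[a, b] (EFin \o f).
Proof.
move=> cf; apply: continuous_compact_integrable; first exact: segment_compact.
exact: continuous_subspaceT.
Qed.

Lemma Rintegral_is_derive f F a b : a <= b -> continuous f ->
  (forall x : R, is_derive x 1 F (f x)) ->
  \int[mu]_(x in `[a, b]) f x = F b - F a.
Proof.
move=> + cf hF; rewrite le_eqVlt => /predU1P[->|ab].
  by rewrite set_itv1 Rintegral_set1 subrr.
have cF : continuous F := is_derive_continuous hF.
rewrite /Rintegral (@continuous_FTC2 _ f F)//.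
- exact: continuous_subspaceT.
- split.
  + by move=> x _; have [] := hF x.
  + exact/cvg_at_right_filter/cF.
  + exact/cvg_at_left_filter/cF.
- by move=> x _; rewrite derive1E; have [_ ->] := hF x.
Qed.

Lemma Rintegral_itvy_cvg f a : mu.-integrable `[a, +oo[ (EFin \o f) ->
  \int[mu]_(x in `[a, a + n%:R]) f x @[n --> \oo] -->
  \int[mu]_(x in `[a, +oo[) f x.
Proof.
move=> intf.
have mf : measurable_fun `[a, +oo[ f by apply/measurable_EFinP; case/integrableP: intf.
have sub n : `[a, a + n%:R] `<=` `[a, +oo[.
  by move=> x /=; rewrite !in_itv/= andbT => /andP[].
have intn n : mu.-integrable `[a, a + n%:R] (EFin \o f).
  exact: integrableS intf.
apply: fine_cvg; rewrite fineK; last exact: integrable_fin_num.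
pose fn n x : \bar R := ((f \_ `[a, a + n%:R]) x)%:E.
have fnE n : (\int[mu]_(x in `[a, (a + n%:R)%R]) (f x)%:E =
    \int[mu]_(x in `[a, +oo[) fn n x)%E.
  rewrite [RHS]integral_mkcond [LHS]integral_mkcond; apply: eq_integral => x _.
  rewrite /fn /patch; case: ifPn => [/set_mem h|h].
    by rewrite mem_set//; exact: sub h.
  by case: ifP.
under eq_fun do rewrite fnE.
apply: (@dominated_cvg _ _ _ mu `[a, +oo[%classic _ fn (EFin \o f)
  (EFin \o (fun x => `|f x|))) => //.
- move=> n; apply/measurable_EFinP; apply/measurable_restrict => //.
  by apply: measurable_funS mf => // x [].
- move=> x /=; rewrite in_itv/= andbT => ax.
  apply/cvg_ballP => e e0; near=> n.
  rewrite /fn patchE mem_set; first exact: ballxx.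
  rewrite /= in_itv/= ax/= -lerBlDl.
  near: n; exact: nbhs_infty_ger.
- exact: integrable_norm.
- move=> n x _; rewrite /fn lee_fin patchE; case: ifP => // _.
  by rewrite normr0.
Unshelve. all: by end_near. Qed.

(** For [f] of any sign: integrability makes the integral the limit of those over [[a, a + n]], and
    the primitive evaluates each of them. *)
Lemma Rintegral_itvy_is_derive f F a (l : R) : continuous f ->
  (forall x : R, is_derive x 1 F (f x)) -> F x @[x --> +oo] --> l ->
  mu.-integrable `[a, +oo[ (EFin \o f) ->
  \int[mu]_(x in `[a, +oo[) f x = l - F a.
Proof.
move=> cf hF Fl intf.
have h1 := Rintegral_itvy_cvg intf.
have h2 : F (a + n%:R) - F a @[n --> \oo] --> l - F a.
  apply: cvgB; last exact: cvg_cst.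
  apply: (@cvg_comp _ _ _ (fun n : nat => a + n%:R) F _ _ _ _ Fl).
  apply/cvgryPge => A; near=> n; rewrite -lerBlDl; near: n; exact: nbhs_infty_ger.
rewrite -(cvg_lim _ h1)// -(cvg_lim _ h2)//.
have E n : \int[mu]_(x in `[a, a + n%:R]) f x = F (a + n%:R) - F a.
  by rewrite (@Rintegral_is_derive _ F)// lerDl.
by under eq_fun do rewrite E.
Unshelve. all: by end_near. Qed.

Lemma cvgr_expRNM (d : R) : 0 < d -> expR (- d * x) @[x --> +oo] --> 0.
Proof.
move=> d0; have h : d * x @[x --> +oo] --> +oo by apply: gt0_cvgMry => //; exact: cvg_id.
have := @cvg_comp _ _ _ (fun x => d * x) (fun x => expR (- x)) _ _ _ h (@cvgr_expR R).
by rewrite (_ : _ \o _ = (fun x => expR (- d * x)))//; apply/funext => x /=; rewrite mulNr.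
Qed.

Lemma integrable_expRN (d a : R) : 0 < d ->
  mu.-integrable `[a, +oo[ (EFin \o (fun x => expR (- d * x))).
Proof.
move=> d0; apply/integrableP; split.
  apply/measurable_EFinP; apply: measurable_funTS; apply: continuous_measurable_fun.
  by apply: is_derive_continuous => x; exact: is_derive_expRM.
under eq_integral do rewrite /= ger0_norm ?expR_ge0//.
rewrite (@ge0_continuous_FTC2y _ _ (fun x => - d^-1 * expR (- d * x)) _ 0).
- by rewrite ltry.
- by move=> x _; exact: expR_ge0.
- apply: continuous_subspaceT.
  by apply: is_derive_continuous => x; exact: is_derive_expRM.
- rewrite -[X in _ --> X](mulr0 (- d^-1)); apply: cvgMr.
  exact: cvgr_expRNM.
- move=> x _.
  have h := is_deriveM (is_derive_cst (- d^-1) x 1) (is_derive_expRM (- d) x).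
  exact: (@ex_derive _ _ _ _ _ _ _ h).
- apply: cvg_at_right_filter; apply: cvgMr.
  exact: (is_derive_continuous (is_derive_expRM (- d))).
- move=> x _; rewrite derive1E.
  have h := is_deriveM (is_derive_cst (- d^-1) x 1) (is_derive_expRM (- d) x).
  rewrite (@derive_val _ _ _ _ _ _ _ h) /GRing.scale /= mulr0 addr0.
  by rewrite mulrA mulrNN mulVf ?mul1r// gt_eqF.
Qed.

End HalfLine.

Section AbelSummation.
Variable R : realType.
Local Notation mu := (@lebesgue_measure R).

Lemma is_derive_cosM (w x : R) :
  is_derive x 1 (fun t => cos (t * w)) (- (w * sin (x * w))).
Proof.
have h : is_derive x 1 (fun t => t * w) w.
  by apply: is_derive_eq; rewrite /GRing.scale /= mulr1 mulr0 add0r.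
by have /is_derive_eq := @is_derive1_comp _ (@cos R) _ _ _ _ (is_derive_cos _) h;
  apply; rewrite mulNr mulrC.
Qed.

Lemma is_derive_sinM (w x : R) :
  is_derive x 1 (fun t => sin (t * w)) (w * cos (x * w)).
Proof.
have h : is_derive x 1 (fun t => t * w) w.
  by apply: is_derive_eq; rewrite /GRing.scale /= mulr1 mulr0 add0r.
by have /is_derive_eq := @is_derive1_comp _ (@sin R) _ _ _ _ (is_derive_sin _) h;
  apply; rewrite mulrC.
Qed.

Lemma cvg_norm0 (f g : R -> R) : (forall x, `|f x| <= g x) ->
  g x @[x --> +oo] --> 0 -> f x @[x --> +oo] --> 0.
Proof.
move=> fg g0; apply: norm_cvg0.
apply: (@squeeze_cvgr _ _ _ _ (cst 0) g) => //; last exact: cvg_cst.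
by apply: nearW => x; rewrite normr_ge0 fg.
Qed.

(** The damped cosine integral is the Poisson kernel at height [e], not normalized: its total mass
    in [w] is [pi]. *)
Lemma integral_expR_cos (e w : R) : 0 < e ->
  \int[mu]_(t in `[0, +oo[) (expR (- e * t) * cos (t * w)) = e / (e ^+ 2 + w ^+ 2).
Proof.
move=> e0; have D0 : 0 < e ^+ 2 + w ^+ 2 by rewrite ltr_wpDr ?sqr_ge0// exprn_gt0.
pose f t := expR (- e * t) * cos (t * w).
(* An antiderivative of [f] that tends to [0] at infinity, so the integral is [- F 0]. *)
pose F t := expR (- e * t) * (w * sin (t * w) - e * cos (t * w)) / (e ^+ 2 + w ^+ 2).
have hF (t : R) : is_derive t 1 F (f t).
  have h1 := is_derive_expRM (- e) t.
  have h2 := is_deriveB (is_deriveM (is_derive_cst w t 1) (is_derive_sinM w t))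
     (is_deriveM (is_derive_cst e t 1) (is_derive_cosM w t)).
  have h3 := is_deriveM (is_deriveM h1 h2) (is_derive_cst ((e ^+ 2 + w ^+ 2)^-1)%R t 1).
  apply: (is_derive_eq h3); rewrite scaler0 add0r /GRing.scale /= /cst /f !fctE; field.
  by rewrite gt_eqF.
have cf : continuous f.
  move=> t; apply: cvgM.
    exact: (is_derive_continuous (is_derive_expRM (- e))).
  exact: (is_derive_continuous (is_derive_cosM w)).
have intf : mu.-integrable `[0, +oo[ (EFin \o f).
  apply: le_integrable (integrable_expRN 0 e0) => //.
    by apply/measurable_EFinP/measurable_funTS; exact: continuous_measurable_fun.
  move=> x _ /=; rewrite lee_fin /f normrM [leRHS]ger0_norm ?expR_ge0//.
  rewrite ger0_norm ?expR_ge0// ler_piMr ?expR_ge0//.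
  by rewrite ler_norml cos_geN1 cos_le1.
rewrite (@Rintegral_itvy_is_derive _ f F 0 0)//.
  rewrite sub0r /F mulr0 expR0 mul0r sin0 cos0 mulr0 mulr1 sub0r mul1r.
  by rewrite mulNr opprK.
apply: (@cvg_norm0 _ (fun t => expR (- e * t) * ((`|w| + e) / (e ^+ 2 + w ^+ 2)))).
  move=> t; rewrite /F !normrM (ger0_norm (expR_ge0 _)) normfV (gtr0_norm D0) -mulrA.
  rewrite ler_wpM2l ?expR_ge0// ler_wpM2r ?invr_ge0 ?(ltW D0)//.
  apply: (le_trans (ler_normB _ _)); rewrite !normrM (gtr0_norm e0) lerD//.
    by rewrite ler_piMr// ler_norml sin_geN1 sin_le1.
  by rewrite ler_piMr ?(ltW e0)// ler_norml cos_geN1 cos_le1.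
rewrite -[X in _ --> X](mul0r ((`|w| + e) / (e ^+ 2 + w ^+ 2))).
by apply: cvgMl; exact: cvgr_expRNM.
Qed.

Lemma integralT_oneDsqrV : (\int[mu]_u ((oneDsqr u)^-1)%R%:E = (pi : R)%:E)%E.
Proof.
rewrite (@ge0_symfun_integralT _ (fun u => (oneDsqr u)^-1)%R).
- rewrite -set_itvcy integral0y_oneDsqr -EFinM; congr EFin.
  by rewrite mulrC mulfVK.
- by move=> x; rewrite invr_ge0 (le_trans _ (oneDsqr_ge1 _)).
- exact: continuous_oneDsqrV.
- by move=> x /=; rewrite /oneDsqr sqrrN.
Qed.

(** The change of variable [v = y + e u]. It is stated for nonnegative [G] in the extended reals, so
    that it can also serve to prove integrability. *)
Lemma poisson_substitution (G : R -> R) (e y : R) : 0 < e -> continuous G ->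
  (forall v, 0 <= G v) ->
  (\int[mu]_v (G v * (e / (e ^+ 2 + (y - v) ^+ 2)))%:E =
   \int[mu]_u (G (y + e * u) / oneDsqr u)%:E)%E.
Proof.
move=> e0 cG G0; have D0 v : 0 < e ^+ 2 + (y - v) ^+ 2.
  by rewrite ltr_wpDr ?sqr_ge0// exprn_gt0.
have dF (x : R) : is_derive x 1 (fun u => y + e * u) e.
  by apply: is_derive_eq; rewrite /GRing.scale /=; ring.
have F'E : derive1 (fun u => y + e * u) = cst e.
  by apply/funext => x; rewrite derive1E; have [_ ->] := dF x.
rewrite (@increasing_ge0_integration_by_substitutionT _ (fun u => y + e * u)).
- apply: eq_integral => u _; congr EFin; rewrite F'E !fctE /= /oneDsqr.
  have u1 : 1 + u ^+ 2 != 0 by rewrite gt_eqF// ltr_wpDr ?sqr_ge0.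
  have -> : e ^+ 2 + (y - (y + e * u)) ^+ 2 = e ^+ 2 * (1 + u ^+ 2) by ring.
  by field; rewrite u1 gt_eqF.
- by move=> a b ab; rewrite ltrD2l ltr_pM2l.
- by rewrite F'E => x; exact: cvg_cst.
- by rewrite F'E; exact: is_cvg_cst.
- by rewrite F'E; exact: is_cvg_cst.
- by move=> x; have [] := dF x.
- apply/cvgrNyPle => A; have : \forall x \near -oo, x <= (A - y) / e.
    exact: nbhs_ninfty_le.
  by apply: filterS => x; rewrite ler_pdivlMr// mulrC lerBrDl.
- apply/cvgryPge => A; have : \forall x \near +oo, (A - y) / e <= x.
    exact: nbhs_pinfty_ge.
  by apply: filterS => x; rewrite ler_pdivrMr// mulrC lerBlDl.
- move=> v; apply: cvgM; first exact: cG.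
  apply: cvgMr; apply: cvgV; first by rewrite gt_eqF.
  apply: cvgD; first exact: cvg_cst.
  by apply: (@cvg_comp _ _ _ (fun v => y - v) (fun z => z ^+ 2));
    [apply: cvgB; [exact: cvg_cst|exact: cvg_id]|exact: exprn_continuous].
- by move=> v; rewrite mulr_ge0// divr_ge0 ?(ltW e0) ?(ltW (D0 _))//.
Qed.

Lemma integrable_oneDsqrV : mu.-integrable setT (fun u => ((oneDsqr u)^-1)%R%:E).
Proof.
apply/integrableP; split.
  apply/measurable_EFinP; apply: continuous_measurable_fun.
  exact: continuous_oneDsqrV.
under eq_integral => u _.
  rewrite gee0_abs; last by rewrite lee_fin invr_ge0 (le_trans _ (oneDsqr_ge1 _)).
  over.
by rewrite /= integralT_oneDsqrV ltry.
Qed.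

(** The Poisson kernel is an approximate identity of mass [pi]: after rescaling, the kernel is the
    fixed weight [1 / (1 + u^2)] and [e n] survives only inside the argument of a bounded continuous
    function, so dominated convergence applies. *)
Lemma poisson_cvg (T : R -> R) (y K : R) (e : R^nat) : continuous T ->
  (forall v, `|T v| <= K) -> mu.-integrable setT (EFin \o T) ->
  (forall n, 0 < e n) -> e n @[n --> \oo] --> 0 ->
  (\int[mu]_v (T v * (e n / (e n ^+ 2 + (y - v) ^+ 2))))%R @[n --> \oo] --> T y * pi.
Proof.
move=> cT TK intT e0 e_cvg.
have K0 : 0 <= K := le_trans (normr_ge0 _) (TK 0).
(* Adding [K] makes the function nonnegative, as the substitution requires; the constant contributes
   exactly [K * pi], which is subtracted again. *)
pose G v := T v + K.
have cG : continuous G by move=> x; apply: cvgD; [exact: cT|exact: cvg_cst].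
have G0 v : 0 <= G v by have := TK v; rewrite ler_norml /G => /andP[? _]; lra.
have D0 n v : 0 < e n ^+ 2 + (y - v) ^+ 2.
  by rewrite ltr_wpDr ?sqr_ge0// exprn_gt0.
have GK v : G v <= 2 * K by have := TK v; rewrite ler_norml /G => /andP[_ ?]; lra.
have sub (H : R -> R) L : continuous H -> (forall v, 0 <= H v) -> (forall v, H v <= L) ->
    forall n, mu.-integrable setT (fun v => (H v * (e n / (e n ^+ 2 + (y - v) ^+ 2)))%:E).
  move=> cH H0 HL n; apply/integrableP; split.
    apply/measurable_EFinP; apply: continuous_measurable_fun => v.
    apply: cvgM; first exact: cH.
    apply: cvgMr; apply: cvgV; first by rewrite gt_eqF.
    apply: cvgD; first exact: cvg_cst.
    by apply: (@cvg_comp _ _ _ (fun v => y - v) (fun z => z ^+ 2));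
      [apply: cvgB; [exact: cvg_cst|exact: cvg_id]|exact: exprn_continuous].
  under eq_integral => v _.
    rewrite gee0_abs; last first.
      by rewrite lee_fin mulr_ge0// divr_ge0 ?(ltW (e0 _)) ?(ltW (D0 _ _)).
    over.
  rewrite poisson_substitution//.
  have : mu.-integrable setT (fun u => (H (y + e n * u) / oneDsqr u)%:E).
    apply: le_integrable (integrableZl measurableT L integrable_oneDsqrV) => //.
    - apply/measurable_EFinP; apply: continuous_measurable_fun => u; apply: cvgM.
        apply: (@cvg_comp _ _ _ (fun u => y + e n * u) H); last exact: cH.
        by apply: cvgD; [exact: cvg_cst|apply: cvgMr; exact: cvg_id].
      exact: continuous_oneDsqrV.
    - move=> u _; rewrite -EFinM lee_fin.
      have o0 : 0 <= ((oneDsqr u)^-1)%R by rewrite invr_ge0 (le_trans _ (oneDsqr_ge1 _)).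
      by rewrite !normrM (ger0_norm o0) ler_wpM2r// (le_trans _ (ler_norm _))// ger0_norm.
  by move=> /(integrable_fin_num measurableT); rewrite ltey_eq => ->.
have c1 : continuous (cst 1 : R -> R) by move=> x; exact: cvg_cst.
have cK : continuous (cst K : R -> R) by move=> x; exact: cvg_cst.
have TE n : \int[mu]_v (T v * (e n / (e n ^+ 2 + (y - v) ^+ 2))) =
    fine (\int[mu]_u (G (y + e n * u) / oneDsqr u)%:E) - K * pi.
  have -> : K * pi = \int[mu]_v (K * (e n / (e n ^+ 2 + (y - v) ^+ 2))).
    rewrite /Rintegral (@poisson_substitution (cst K))//.
    rewrite -[LHS]/(fine (K * pi)%:E) EFinM -integralT_oneDsqrV.
    by rewrite -integralZl//; exact: integrable_oneDsqrV.
  rewrite -poisson_substitution// -[fine _]/(\int[mu]_v (G v * (e n / (e n ^+ 2 + (y - v) ^+ 2)))).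
  rewrite -RintegralB//.
  - by apply: eq_Rintegral => v _; rewrite /G; ring.
  - exact: (sub G (2 * K)).
  - exact: (sub (cst K) K).
under eq_fun do rewrite TE.
have -> : T y * pi = G y * pi - K * pi by rewrite /G; ring.
apply: cvgB; last exact: cvg_cst.
apply: fine_cvg.
have -> : (G y * pi)%:E = (\int[mu]_u (G y / oneDsqr u)%:E)%E.
  rewrite EFinM -integralT_oneDsqrV -integralZl//; exact: integrable_oneDsqrV.
apply: (@dominated_cvg _ _ _ mu setT _ (fun n u => (G (y + e n * u) / oneDsqr u)%:E)
  (fun u => (G y / oneDsqr u)%:E) (fun u => ((2 * K)%:E * ((oneDsqr u)^-1)%R%:E)%E)) => //.
- move=> n; apply/measurable_EFinP; apply: continuous_measurable_fun => u; apply: cvgM.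
    apply: (@cvg_comp _ _ _ (fun u => y + e n * u) G); last exact: cG.
    by apply: cvgD; [exact: cvg_cst|apply: cvgMr; exact: cvg_id].
  exact: continuous_oneDsqrV.
- move=> u _; apply: cvg_EFin; first exact: nearW.
  have h : y + e n * u @[n --> \oo] --> y.
    rewrite -[X in _ --> X]addr0; apply: cvgD; first exact: cvg_cst.
    by rewrite -(mul0r u); exact: cvgMl.
  apply: cvgMl; exact: (@cvg_comp _ _ _ (fun n => y + e n * u) G _ _ _ h (cG y)).
- exact/integrableZl/integrable_oneDsqrV.
- move=> n u _; rewrite -EFinM lee_fin.
  have o0 : 0 <= ((oneDsqr u)^-1)%R by rewrite invr_ge0 (le_trans _ (oneDsqr_ge1 _)).
  by rewrite !normrM (ger0_norm o0) ler_wpM2r// ger0_norm.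
Qed.

End AbelSummation.

Section MeasurableCompositions.
Variables (d : measure_display) (X : measurableType d) (R : realType).
Implicit Types (D : set X) (g : X -> R).

Lemma measurable_fun_cos D g : measurable_fun D g ->
  measurable_fun D (fun x => cos (g x)).
Proof.
by move=> mg; apply: (measurableT_comp _ mg);
  exact: (continuous_measurable_fun (@continuous_cos R)).
Qed.

Lemma measurable_fun_expR D g : measurable_fun D g ->
  measurable_fun D (fun x => expR (g x)).
Proof.
by move=> mg; apply: (measurableT_comp _ mg);
  exact: (continuous_measurable_fun (@continuous_expR R)).
Qed.

End MeasurableCompositions.

Section FourierInversion.
Variable R : realType.
Local Notation mu := (@lebesgue_measure R).
Variables (T : R -> R) (y K : R).
Hypothesis cT : continuous T.
Hypothesis TK : forall v, `|T v| <= K.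
Hypothesis intT : mu.-integrable setT (EFin \o T).

Definition cos_transform (xi : R) : R :=
  \int[mu]_v (T v * cos (xi * (y - v))).

(** The damped integrand on the whole plane: the indicator confines the frequency to the half-line,
    so that Fubini can be used on [setT]. *)
Let abel (e : R) (z : R * R) : R :=
  \1_(`[0, +oo[%classic : set R) z.1 * expR (- e * z.1) * (T z.2 * cos (z.1 * (y - z.2))).

Let mabel e : measurable_fun setT (abel e).
Proof.
have m1 : measurable_fun setT (fun z : R * R => z.1) by exact: measurable_fst.
have m2 : measurable_fun setT (fun z : R * R => z.2) by exact: measurable_snd.
rewrite /abel; apply: measurable_funM.
  apply: measurable_funM; first exact: measurableT_comp.
  by apply/measurable_fun_expR/measurable_funM => //; exact: measurable_cst.
apply: measurable_funM.
  by apply: measurableT_comp m2; exact: continuous_measurable_fun.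
apply/measurable_fun_cos/measurable_funM => //.
by apply: measurable_funB => //; exact: measurable_cst.
Qed.

Let int_cos xi : mu.-integrable setT (fun v => (T v * cos (xi * (y - v)))%:E).
Proof.
apply: le_integrable intT => //.
  apply/measurable_EFinP; apply: measurable_funM.
    exact: continuous_measurable_fun.
  apply/measurable_fun_cos/measurable_funM; first exact: measurable_cst.
  by apply: measurable_funB => //; exact: measurable_cst.
move=> v _; rewrite lee_fin normrM ler_piMr//.
by rewrite ler_norml cos_geN1 cos_le1.
Qed.

Let int_abel e : 0 < e -> (mu \x mu)%E.-integrable setT (EFin \o abel e).
Proof.
have mE : measurable_fun setT (EFin \o abel e).
  by apply/measurable_EFinP; exact: mabel.
move=> e0; apply/(@integrable12ltyP _ _ _ _ R mu mu _ mE).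
have le1 (x v : R) : (`|(EFin \o abel e) (x, v)| <=
    (\1_(`[0, +oo[%classic : set R) x * expR (- e * x))%:E * `|(T v)%:E|)%E.
  rewrite -EFinM lee_fin /abel /= normrM normrM (ger0_norm (expR_ge0 _)).
  rewrite ger0_norm ?mulr_ge0 ?expR_ge0//.
  rewrite ler_wpM2l ?mulr_ge0 ?expR_ge0// normrM ler_piMr//.
  by rewrite ler_norml cos_geN1 cos_le1.
have fin : (\int[mu]_v `|(T v)%:E| < +oo)%E by case/integrableP : intT.
set I := (\int[mu]_v `|(T v)%:E|)%E in fin.
have I0 : (0 <= I)%E by exact: integral_ge0.
have mTE : measurable_fun setT (fun v => `|(T v)%:E|%E).
  apply: measurableT_comp => //; apply/measurable_EFinP.
  exact: continuous_measurable_fun.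
apply: (@le_lt_trans _ _ (\int[mu]_x ((\1_(`[0%R, +oo[%classic : set R) x * expR (- e * x))%:E * I)%E)%E).
  apply: ge0_le_integral => //.
  - by move=> x _; exact: integral_ge0.
  - have mA : measurable_fun setT (abse \o (EFin \o abel e)) by exact: measurableT_comp.
    have A0 z : (0 <= (abse \o (EFin \o abel e)) z)%E by exact: abse_ge0.
    exact: (@measurable_fun_fubini_tonelli_F _ _ _ _ R mu _ mA A0).
  - apply: emeasurable_funM; last exact: measurable_cst.
    apply/measurable_EFinP; apply: measurable_funM => //.
    by apply/measurable_fun_expR/measurable_funM => //; exact: measurable_cst.
  - move=> x _; have k0 : (0%:E <= (\1_(`[0%R, +oo[%classic : set R) x * expR (- e * x))%:E)%E.
      by rewrite lee_fin mulr_ge0 ?expR_ge0.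
    rewrite -ge0_integralZl//.
    apply: ge0_le_integral => //.
    + apply: measurableT_comp => //; apply/measurable_EFinP.
      by apply: measurableT_comp (mabel e) _; exact: measurable_pair1.
    + by apply: emeasurable_funM => //; exact: measurable_cst.
have -> : I = (fine I)%:E by rewrite fineK// ge0_fin_numE.
have E x : ((\1_(`[0%R, +oo[%classic : set R) x * expR (- e * x))%:E =
    ((fun t => (expR (- e * t))%:E) \_ `[0%R, +oo[) x)%E.
  rewrite patchE indicE; case: ifPn => _; first by rewrite mul1r.
  by rewrite mul0r.
have intI : mu.-integrable setT (fun x => (\1_(`[0%R, +oo[%classic : set R) x * expR (- e * x))%:E).
  under eq_fun do rewrite E.
  apply/integrable_restrict => //; rewrite setTI.
  exact: integrable_expRN.
rewrite integralZr// lte_mul_pinfty ?lee_fin ?fine_ge0//.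
  by apply: integral_ge0 => x _; rewrite lee_fin mulr_ge0 ?expR_ge0.
- exact: integrable_fin_num.
- by rewrite ltry.
Qed.

Let abel_F e xi : (\int[mu]_v (abel e (xi, v))%:E =
  (\1_(`[0, +oo[%classic : set R) xi * expR (- e * xi) * cos_transform xi)%:E)%E.
Proof.
rewrite /abel /=; under eq_integral do rewrite EFinM.
rewrite integralZl// [RHS]EFinM; congr (_ * _)%E.
by rewrite /cos_transform /Rintegral fineK//; exact: integrable_fin_num.
Qed.

(** Fubini gives measurability of the marginal damped with [e = 1]; multiplying by [expR x] removes
    the damping. *)
Lemma measurable_cos_transform : measurable_fun `[(0 : R), +oo[ cos_transform.
Proof.
have : measurable_fun setT (fun xi : R => \int[mu]_v (abel 1 (xi, v))%:E)%E.
  exact: (measurable_fubini_F (int_abel ltr01)).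
under eq_fun do rewrite abel_F.
move=> /measurable_EFinP h.
have h2 : measurable_fun `[(0 : R), +oo[ (fun x => expR x * (\1_(`[0, +oo[%classic : set R) x * expR (- 1 * x) *
          cos_transform x)).
  apply: measurable_funM; last exact: measurable_funTS.
  exact: measurable_fun_expR.
apply: eq_measurable_fun h2 => x x0; rewrite indicE x0 mul1r mulrA -expRD.
by rewrite mulN1r subrr expR0 mul1r.
Qed.

(** The damping makes the double integral absolutely convergent; exchanging the order leaves the
    Poisson kernel as inner integral. *)
Let abel_sum e : 0 < e ->
  \int[mu]_(xi in `[0, +oo[) (expR (- e * xi) * cos_transform xi) =
  \int[mu]_v (T v * (e / (e ^+ 2 + (y - v) ^+ 2))).
Proof.
move=> e0; rewrite /Rintegral; congr fine.
transitivity (\int[mu]_xi \int[mu]_v (EFin \o abel e) (xi, v))%E.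
  rewrite integral_mkcond; apply: eq_integral => xi _; rewrite /= abel_F.
  by rewrite patchE indicE; case: ifPn => _; rewrite ?mul1r// !mul0r.
rewrite Fubini; last exact: int_abel.
apply: eq_integral => v _ /=.
under eq_integral => x _.
  rewrite /abel /= (_ : _ * _ * _ = T v * (\1_(`[0, +oo[%classic : set R) x *
    (expR (- e * x) * cos (x * (y - v))))); last by ring.
  rewrite EFinM; over.
have ic : mu.-integrable `[0, +oo[ (fun x => (expR (- e * x) * cos (x * (y - v)))%:E).
  apply: le_integrable (integrable_expRN 0 e0) => //.
    apply/measurable_EFinP; apply: measurable_funM.
      by apply/measurable_fun_expR/measurable_funM => //; exact: measurable_cst.
    by apply/measurable_fun_cos/measurable_funM => //; exact: measurable_cst.
  move=> x _ /=; rewrite lee_fin normrM ler_piMr//.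
  by rewrite ler_norml cos_geN1 cos_le1.
have E x : ((\1_(`[0%R, +oo[%classic : set R) x * (expR (- e * x) * cos (x * (y - v))))%:E =
    ((fun t => (expR (- e * t) * cos (t * (y - v)))%:E) \_ `[0%R, +oo[) x)%E.
  by rewrite patchE indicE; case: ifPn => _; rewrite ?mul1r// mul0r.
under eq_integral do rewrite E.
rewrite integralZl//; last by apply/integrable_restrict => //; rewrite setTI.
rewrite -integral_mkcond EFinM; congr (_ * _)%E.
rewrite -(integral_expR_cos _ e0) /Rintegral fineK//.
exact: integrable_fin_num.
Qed.

(* Abel summation: insert [expR (- e * xi)] and let [e] tend to [0]. *)
Lemma cos_transform_inversion :
  mu.-integrable `[0, +oo[ (EFin \o cos_transform) ->
  \int[mu]_(xi in `[0, +oo[) cos_transform xi = pi * T y.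
Proof.
move=> intc.
pose e (n : nat) : R := ((n.+1%:R : R)^-1)%R.
have e0 n : 0 < e n by rewrite invr_gt0.
have ecvg : e n @[n --> \oo] --> 0 by exact: cvg_harmonic.
have h1 := @poisson_cvg R T y K e cT TK intT e0 ecvg.
suff h2 : (\int[mu]_v (T v * (e n / (e n ^+ 2 + (y - v) ^+ 2))))%R @[n --> \oo] -->
    \int[mu]_(xi in `[0, +oo[) cos_transform xi.
  by rewrite mulrC -(cvg_lim _ h1)// -(cvg_lim _ h2).
have E n := esym (abel_sum (e0 n)).
under eq_fun do rewrite E.
apply: fine_cvg; rewrite fineK; last exact: integrable_fin_num.
apply: (@dominated_cvg _ _ _ mu `[0, +oo[%classic _
  (fun n xi => (expR (- e n * xi) * cos_transform xi)%:E)
  (EFin \o cos_transform) (fun x => `|cos_transform x|%:E)) => //.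
- move=> n; apply/measurable_EFinP; apply: measurable_funM.
    by apply/measurable_fun_expR/measurable_funM => //; exact: measurable_cst.
  exact: measurable_cos_transform.
- move=> x _; apply: cvg_EFin; first exact: nearW.
  rewrite -[X in _ --> X]mul1r; apply: cvgMl.
  rewrite -expR0; apply: continuous_cvg; first exact: continuous_expR.
  rewrite -(mul0r x); apply: cvgMl; rewrite -oppr0; exact: cvgN.
- exact: integrable_norm.
- move=> n x; rewrite /= in_itv /= andbT => x0; rewrite lee_fin normrM ler_piMl//.
  rewrite ger0_norm ?expR_ge0// -expR0 ler_expR mulNr oppr_le0.
  by rewrite mulr_ge0// ltW.
Qed.

End FourierInversion.

(** * The resolvent as a Laplace transform *)

Section ComplexIntegral.
Variable R : realType.
Local Notation C := R[i].
Local Notation mu := (@lebesgue_measure R).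
Implicit Types (D : set R) (f g : R -> C).

Definition intC D f : Prop :=
  mu.-integrable D (fun x => (complex.Re (f x))%:E) /\
  mu.-integrable D (fun x => (complex.Im (f x))%:E).

Definition contC f : Prop :=
  continuous (fun x => complex.Re (f x)) /\ continuous (fun x => complex.Im (f x)).

Lemma contC_intC f a b : contC f -> intC `[a, b] f.
Proof. by move=> [h1 h2]; split; exact: continuous_integrable_itv. Qed.

Lemma contC_cst (z : C) : contC (fun=> z).
Proof. by split=> x; exact: cvg_cst. Qed.

Lemma contCM f g : contC f -> contC g -> contC (fun x => f x * g x).
Proof.
move=> [f1 f2] [g1 g2]; split => x.
  under eq_fun do rewrite ReM.
  by apply: cvgB; apply: cvgM; [exact: f1|exact: g1|exact: f2|exact: g2].
under eq_fun do rewrite ImM.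
by apply: cvgD; apply: cvgM; [exact: f1|exact: g2|exact: f2|exact: g1].
Qed.

Lemma isdC_contC f : (forall x, exists d, isdC f x d) -> contC f.
Proof. by move=> h; split; [exact: isdC_Re_continuous|exact: isdC_Im_continuous]. Qed.

Lemma intCM D (z : C) f : measurable D -> intC D f -> intC D (fun x => z * f x).
Proof.
move=> mD [f1 f2]; split.
  under eq_fun do rewrite ReM EFinB !EFinM.
  by apply: integrableB => //; exact: integrableZl.
under eq_fun do rewrite ImM EFinD !EFinM.
by apply: integrableD => //; exact: integrableZl.
Qed.

Lemma intCD D f g : measurable D -> intC D f -> intC D g ->
  intC D (fun x => f x + g x).
Proof.
move=> mD [f1 f2] [g1 g2]; split.
  by under eq_fun do rewrite ReD EFinD; exact: integrableD.
by under eq_fun do rewrite ImD EFinD; exact: integrableD.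
Qed.

Lemma integralCM D (z : C) f : measurable D -> intC D f ->
  integralC D (fun x => z * f x) = z * integralC D f.
Proof.
move=> mD [f1 f2]; apply: complexP.
  rewrite ReM /=; under eq_Rintegral do rewrite ReM.
  rewrite RintegralB ?RintegralZl//.
    by under [X in _.-integrable _ X]eq_fun do rewrite /= EFinM; exact: integrableZl.
  by under [X in _.-integrable _ X]eq_fun do rewrite /= EFinM; exact: integrableZl.
rewrite ImM /=; under eq_Rintegral do rewrite ImM.
rewrite RintegralD ?RintegralZl//.
  by under [X in _.-integrable _ X]eq_fun do rewrite /= EFinM; exact: integrableZl.
by under [X in _.-integrable _ X]eq_fun do rewrite /= EFinM; exact: integrableZl.
Qed.

Lemma integralCD D f g : measurable D -> intC D f -> intC D g ->
  integralC D (fun x => f x + g x) = integralC D f + integralC D g.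
Proof.
move=> mD [f1 f2] [g1 g2]; apply: complexP.
  by rewrite ReD /=; under eq_Rintegral do rewrite ReD; rewrite RintegralD.
by rewrite ImD /=; under eq_Rintegral do rewrite ImD; rewrite RintegralD.
Qed.

Lemma intC_sum D (I : Type) (r : seq I) (F : I -> R -> C) : measurable D ->
  (forall i, intC D (F i)) -> intC D (fun x => \sum_(i <- r) F i x).
Proof.
move=> mD h; elim: r => [|i r IH].
  by under eq_fun do rewrite big_nil; split => /=; exact: integrable0.
by under eq_fun do rewrite big_cons; exact: intCD.
Qed.

Lemma integralC_sum D (I : Type) (r : seq I) (F : I -> R -> C) : measurable D ->
  (forall i, intC D (F i)) ->
  integralC D (fun x => \sum_(i <- r) F i x) = \sum_(i <- r) integralC D (F i).
Proof.
move=> mD h; elim: r => [|i r IH].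
  under eq_fun do rewrite big_nil; rewrite big_nil /integralC /= /Rintegral integral0.
  by [].
under eq_fun do rewrite big_cons; rewrite big_cons -IH.
by apply: integralCD => //; exact: intC_sum.
Qed.

Lemma integralC_half_line (q Q : R -> C) (K d : R) : 0 < d ->
  (forall x, isdC Q x (q x)) -> contC q ->
  (forall x : R, 0 <= x -> n1 (Q x) <= K * expR (- d * x)) ->
  (forall x : R, 0 <= x -> n1 (q x) <= K * expR (- d * x)) ->
  intC `[0, +oo[ q /\ integralC `[0, +oo[ q = - Q 0.
Proof.
move=> d0 hQ [cq1 cq2] bQ bq.
have int_bd (g : R -> R) : continuous g ->
    (forall x : R, 0 <= x -> `|g x| <= K * expR (- d * x)) ->
    mu.-integrable `[0, +oo[ (EFin \o g).
  move=> cg bg.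
  have hi : mu.-integrable `[0, +oo[ (fun x => (K%:E * (expR (- d * x))%:E)%E).
    by apply: integrableZl => //; exact: integrable_expRN.
  apply: le_integrable hi => //.
    by apply/measurable_EFinP/measurable_funTS; exact: continuous_measurable_fun.
  move=> x; rewrite /= in_itv/= andbT => x0; rewrite lee_fin.
  by rewrite (le_trans (bg x x0))// ler_norm.
have cvg_bd (g : R -> R) : (forall x : R, 0 <= x -> `|g x| <= K * expR (- d * x)) ->
    g x @[x --> +oo] --> 0.
  move=> bg; apply: norm_cvg0.
  apply: (@squeeze_cvgr _ _ _ _ (cst 0) (fun x => K * expR (- d * x))).
  - have : \forall x \near +oo, (0 : R) <= x by exact: nbhs_pinfty_ge.
    by apply: filterS => x x0; rewrite normr_ge0 bg.
  - exact: cvg_cst.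
  - by rewrite -[X in _ --> X](mulr0 K); apply: cvgMr; exact: cvgr_expRNM.
have i1 := int_bd _ cq1 (fun x x0 => le_trans (Re_le_n1 _) (bq x x0)).
have i2 := int_bd _ cq2 (fun x x0 => le_trans (Im_le_n1 _) (bq x x0)).
split; first by split.
have l1 := cvg_bd (fun x => complex.Re (Q x)) (fun x x0 => le_trans (Re_le_n1 _) (bQ x x0)).
have l2 := cvg_bd (fun x => complex.Im (Q x)) (fun x x0 => le_trans (Im_le_n1 _) (bQ x x0)).
apply: complexP.
  by rewrite ReN /= (Rintegral_itvy_is_derive cq1 (fun x => (hQ x).1) l1 i1) sub0r.
by rewrite ImN /= (Rintegral_itvy_is_derive cq2 (fun x => (hQ x).2) l2 i2) sub0r.
Qed.

Lemma n1_integralC_half_line (q : R -> C) (K d : R) : 0 < d ->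
  intC `[0, +oo[ q ->
  (forall x : R, 0 <= x -> n1 (q x) <= K * expR (- d * x)) ->
  n1 (integralC `[0, +oo[ q) <= 2 * (K / d).
Proof.
move=> d0 [i1 i2] bq.
have E : \int[mu]_(x in `[0, +oo[) (K * expR (- d * x)) = K / d.
  rewrite RintegralZl//; last exact: integrable_expRN.
  congr (_ * _).
  have hF (x : R) : is_derive x 1 (fun x => - d^-1%R * expR (- d * x)) (expR (- d * x)).
    have h := is_deriveM (is_derive_cst (- d^-1)%R x 1) (is_derive_expRM (- d) x).
    apply: (is_derive_eq h); rewrite /GRing.scale /= mulr0 addr0.
    by rewrite mulrA mulrNN mulVf ?mul1r// gt_eqF.
  have hl : - d^-1%R * expR (- d * x) @[x --> +oo] --> (0 : R).
    by rewrite -[X in _ --> X](mulr0 (- d^-1)%R); apply: cvgMr; exact: cvgr_expRNM.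
  rewrite (Rintegral_itvy_is_derive _ hF hl (integrable_expRN 0 d0)).
    by rewrite mulr0 expR0 mulr1 sub0r opprK.
  exact: (is_derive_continuous (is_derive_expRM (- d))).
have iK : mu.-integrable `[0, +oo[ (EFin \o (fun x => K * expR (- d * x))).
  rewrite (_ : _ \o _ = (fun x => (K%:E * (expR (- d * x))%:E)%E)).
    by apply: integrableZl => //; exact: integrable_expRN.
  by apply/funext => x; rewrite /= EFinM.
have bnd (g : R -> R) : mu.-integrable `[0, +oo[ (EFin \o g) ->
    (forall x : R, 0 <= x -> `|g x| <= K * expR (- d * x)) ->
    `|\int[mu]_(x in `[0, +oo[) g x| <= K / d.
  move=> ig bg; rewrite -E (le_trans (le_normr_Rintegral _ ig))//.
  apply: le_Rintegral => //; first exact: integrable_norm.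
  by move=> x /=; rewrite in_itv/= andbT => /bg.
rewrite /n1 /= (_ : 2 = 1 + 1 :> R)// mulrDl mul1r lerD// bnd//.
  by move=> x x0; rewrite (le_trans (Re_le_n1 _))// bq.
by move=> x x0; rewrite (le_trans (Im_le_n1 _))// bq.
Qed.

End ComplexIntegral.

Section Resolvent.
Variable R : realType.
Local Notation C := R[i].
Local Notation mu := (@lebesgue_measure R).
Variables (n : nat) (B : 'M[C]_n) (w c : R) (H : R -> 'M[C]_n).
Hypotheses (w_gt0 : 0 < w) (w_lt_c : w < c).
Hypothesis spec : forall a, eigenvalue B a -> complex.Re a < w.
Hypotheses (H0 : H 0 = 0) (dH : forall x, isdM H x (expxA B x)).

Local Notation z := (Complex c).

Definition resolvent (xi : R) : 'M[C]_n := invmx ((Complex c xi)%:M - B).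

Let c_gt0 : 0 < c. Proof. exact: lt_trans w_gt0 w_lt_c. Qed.

Lemma resolvent_unit xi : (Complex c xi)%:M - B \in unitmx.
Proof.
rewrite unitmxE unitfE; apply/negP => /det0P[v v0 hv].
have : eigenvalue B (Complex c xi).
  apply/eigenvalueP; exists v => //.
  by apply/eqP; rewrite -subr_eq0 -oppr_eq0 opprB -hv mulmxBr mul_mx_scalar.
by move/spec => /=; rewrite ltNge ltW.
Qed.

Lemma z_neq0 xi : Complex c xi != 0.
Proof. by apply/eqP => -[] /eqP; rewrite gt_eqF. Qed.

Let growth : exists K, [/\ 0 <= K,
  forall (x : R) i j, 0 <= x -> n1 (expxA B x i j) <= K * expR (w * x) &
  forall (x : R) i j, 0 <= x -> n1 (H x i j) <= K * expR (w * x)].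
Proof.
have [K hK] := expxA_growth w_gt0 spec.
have K0 : 0 <= `|K| + 2 * (`|K| / w).
  by rewrite addr_ge0// mulr_ge0// divr_ge0// ltW.
exists (`|K| + 2 * (`|K| / w)); split => // x i j x0.
  rewrite (le_trans (hK x i j x0))// ler_wpM2r ?expR_ge0//.
  by rewrite (le_trans (ler_norm _))// lerDl mulr_ge0// divr_ge0// ltW.
have := exp_growth_primitiveC w_gt0 (fun x => dH x i j) (fun x x0 => hK x i j x0) x0.
rewrite H0 mxE n1_0 add0r => /le_trans; apply.
rewrite ler_wpM2r ?expR_ge0// (@le_trans _ _ (2 * (`|K| / w)))//.
  by rewrite ler_wpM2l// ler_wpM2r ?ler_norm// invr_ge0 ltW.
by rewrite lerDr.
Qed.

(** [PsiE] and [PsiH] are antiderivatives of [e^(- z v) e^(v B)] and [e^(- z v) H v]; the second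
    comes from the first by one integration by parts. Both decay at infinity, so the Laplace
    transforms are read off at [v = 0]. *)
Let PsiE xi v := expc (- z xi * v%:C%C) *: (- (resolvent xi *m expxA B v)).
Let PsiH xi v := expc (- z xi * v%:C%C) *:
  (- (z xi)^-1 *: (H v + resolvent xi *m expxA B v)).

Let resolvent_expxA xi v : resolvent xi *m (B *m expxA B v) =
  z xi *: (resolvent xi *m expxA B v) - expxA B v.
Proof.
have h := mulVmx (resolvent_unit xi).
rewrite -[X in _ = _ - X]mul1mx -h -/(resolvent xi) -mulmxA.
rewrite mulmxBl mul_scalar_mx mulmxBr -scalemxAr opprB addrC subrK.
by [].
Qed.

Let dPsiE xi v : isdM (PsiE xi) v (expc (- z xi * v%:C%C) *: expxA B v).
Proof.
have hE : isdM (fun v => - (resolvent xi *m expxA B v)) v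
    (- (resolvent xi *m (B *m expxA B v))).
  have E t : - (resolvent xi *m expxA B t) = (- resolvent xi) *m expxA B t.
    by rewrite mulNmx.
  rewrite -mulNmx; under eq_fun do rewrite E.
  exact/isdM_mulmxl/isdM_expxA.
apply: isdM_eq; first exact: isdMZ (isdC_expc (- z xi) v) hE.
rewrite resolvent_expxA opprB scalerBr mulNr scaleNr scalerN opprK.
by rewrite scalerA [z xi * _]mulrC addrC subrK.
Qed.

Let dPsiH xi v : isdM (PsiH xi) v (expc (- z xi * v%:C%C) *: H v).
Proof.
have hE : isdM (fun v => - (z xi)^-1 *: (H v + resolvent xi *m expxA B v)) v
    (- (z xi)^-1 *: (expxA B v + resolvent xi *m (B *m expxA B v))).
  by apply/isdM_scalel/isdMD => //; exact/isdM_mulmxl/isdM_expxA.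
apply: isdM_eq; first exact: isdMZ (isdC_expc (- z xi) v) hE.
rewrite resolvent_expxA.
have -> : expxA B v + (z xi *: (resolvent xi *m expxA B v) - expxA B v) =
    z xi *: (resolvent xi *m expxA B v) by rewrite addrC subrK.
rewrite [- (z xi)^-1 *: (z xi *: _)]scalerA [- (z xi)^-1%R * z xi]mulNr mulVf ?z_neq0// scaleN1r.
rewrite scalerA (_ : - z xi * expc (- z xi * v%:C%C) * - (z xi)^-1 = expc (- z xi * v%:C%C)).
  by rewrite scalerDr scalerN addrK.
by rewrite mulrAC mulrNN mulfV ?z_neq0// mul1r.
Qed.

Let decay_Psi : forall K (X : R -> 'M[C]_n), 0 <= K ->
  (forall (x : R) i j, 0 <= x -> n1 (X x i j) <= K * expR (w * x)) ->
  forall xi (x : R) i j, 0 <= x ->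
  n1 ((expc (- z xi * x%:C%C) *: X x) i j) <= 2 * K * expR (- (c - w) * x).
Proof.
move=> K X K0 hX xi x i j x0; rewrite mxE (le_trans (n1M _ _))//.
have := ler_pM (n1_ge0 _) (n1_ge0 _) (n1_expc (- z xi * x%:C%C)) (hX x i j x0).
move=> /le_trans; apply; rewrite ReM ReN /= mulr0 subr0.
rewrite (_ : - (c - w) * x = - c * x + w * x); last by ring.
by rewrite expRD le_eqVlt; apply/orP; left; apply/eqP; ring.
Qed.

Let growth_mul K (X : R -> 'M[C]_n) (A : 'M[C]_n) : 0 <= K ->
  (forall (x : R) i j, 0 <= x -> n1 (X x i j) <= K * expR (w * x)) ->
  exists2 L, 0 <= L &
    forall (x : R) i j, 0 <= x -> n1 ((A *m X x) i j) <= L * expR (w * x).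
Proof.
move=> K0 hX.
exists (\sum_i \sum_l n1 (A i l) * K).
  by do 2 apply: sumr_ge0 => ? _; rewrite mulr_ge0// n1_ge0.
move=> x i j x0; rewrite mxE (le_trans (n1_sum _ _ _))//.
have hi : \sum_l n1 (A i l) * K <= \sum_i \sum_l n1 (A i l) * K.
  rewrite [leRHS](bigD1 i)//= lerDl.
  by do 2 apply: sumr_ge0 => ? _; rewrite mulr_ge0// n1_ge0.
apply: (le_trans _ (ler_wpM2r (expR_ge0 _) hi)).
rewrite mulr_suml; apply: ler_sum => l _; rewrite (le_trans (n1M _ _))//.
by rewrite -mulrA ler_wpM2l ?n1_ge0// hX.
Qed.

Lemma contC_expcH xi i j : contC (fun v => expc (- z xi * v%:C%C) * H v i j).
Proof.
by apply: isdC_contC => x; eexists; apply: isdCM; [exact: isdC_expc|exact: dH].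
Qed.

(** Minus the value of [PsiH] at [0], where the term in [H] vanishes. *)
Lemma laplace_H xi i j :
  intC `[0, +oo[ (fun v => expc (- z xi * v%:C%C) * H v i j) /\
  integralC `[0, +oo[ (fun v => expc (- z xi * v%:C%C) * H v i j) =
  (z xi)^-1 * resolvent xi i j.
Proof.
have [K [K0 hE hH]] := growth.
have [L L0 hL] := growth_mul (resolvent xi) K0 hE.
have hX (x : R) a b : 0 <= x -> n1 ((- (z xi)^-1 *: (H x + resolvent xi *m expxA B x)) a b) <=
    n1 ((z xi)^-1)%R * (K + L) * expR (w * x).
  move=> x0; rewrite mxE (le_trans (n1M _ _))// n1N -mulrA ler_wpM2l ?n1_ge0//.
  by rewrite mxE (le_trans (n1D _ _))// mulrDl lerD// ?hH ?hL.
have KL0 : 0 <= n1 ((z xi)^-1)%R * (K + L) by rewrite mulr_ge0 ?n1_ge0// addr_ge0.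
have KM : 0 <= Num.max (n1 ((z xi)^-1)%R * (K + L)) K by rewrite le_max K0 orbT.
have cw : 0 < c - w by rewrite subr_gt0.
have h1 x : isdC (fun v => PsiH xi v i j) x (expc (- z xi * x%:C%C) * H x i j).
  by have := dPsiH xi x i j; rewrite mxE.
have h3 (x : R) : 0 <= x -> n1 (PsiH xi x i j) <=
    2 * Num.max (n1 ((z xi)^-1)%R * (K + L)) K * expR (- (c - w) * x).
  move=> x0; apply: (@decay_Psi _
    (fun v => - (z xi)^-1 *: (H v + resolvent xi *m expxA B v)) KM _ xi x i j x0) => y a b y0.
  rewrite (le_trans (hX y a b y0))//.
  by rewrite ler_wpM2r ?expR_ge0// le_max lexx.
have h4 (x : R) : 0 <= x -> n1 (expc (- z xi * x%:C%C) * H x i j) <=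
    2 * Num.max (n1 ((z xi)^-1)%R * (K + L)) K * expR (- (c - w) * x).
  move=> x0; have := decay_Psi KM (X := H) _ xi i j x0.
  rewrite mxE; apply => y a b y0; rewrite (le_trans (hH y a b y0))//.
  by rewrite ler_wpM2r ?expR_ge0// le_max lexx orbT.
have [ih ->] := integralC_half_line cw h1 (contC_expcH xi i j) h3 h4.
split => //; rewrite /PsiH mxE mulr0 expc0 mul1r H0 expxA0 mulmx1 add0r mxE.
by rewrite mulNr opprK.
Qed.

(** The resolvent is the Laplace transform of [e^(v B)], and the modulus of the integrand is
    controlled through [Re z = c] alone, hence uniformly along the vertical line. *)
Lemma resolvent_bounded : exists2 K, 0 <= K & forall xi i j, n1 (resolvent xi i j) <= K.
Proof.
have [K [K0 hE hH]] := growth.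
have cw : 0 < c - w by rewrite subr_gt0.
exists (2 * (2 * K / (c - w))); first by rewrite !mulr_ge0// invr_ge0 ltW.
move=> xi i j.
(* This [L] depends on [xi]; it only makes the antiderivative vanish at infinity. The final estimate
   rests on [bq], whose constant does not depend on [xi]. *)
have [L L0 hL] := growth_mul (- resolvent xi) K0 hE.
pose q v := expc (- z xi * v%:C%C) * expxA B v i j.
have bq (x : R) : 0 <= x -> n1 (q x) <= 2 * K * expR (- (c - w) * x).
  by move=> x0; have := decay_Psi K0 hE xi i j x0; rewrite mxE.
have KM : 0 <= Num.max L K by rewrite le_max K0 orbT.
have h1 x : isdC (fun v => PsiE xi v i j) x (q x).
  by have := dPsiE xi x i j; rewrite mxE.
have h2 : contC q.
  by apply: isdC_contC => x; eexists; apply: isdCM; [exact: isdC_expc|exact: isdM_expxA].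
have h3 (x : R) : 0 <= x -> n1 (PsiE xi x i j) <= 2 * Num.max L K * expR (- (c - w) * x).
  move=> x0; apply: (@decay_Psi _
    (fun v => - (resolvent xi *m expxA B v)) KM _ xi x i j x0) => y a b y0.
  rewrite -mulNmx (le_trans (hL y a b y0))//.
  by rewrite ler_wpM2r ?expR_ge0// le_max lexx.
have h4 (x : R) : 0 <= x -> n1 (q x) <= 2 * Num.max L K * expR (- (c - w) * x).
  move=> x0; rewrite (le_trans (bq x x0))// ler_wpM2r ?expR_ge0//.
  by rewrite ler_wpM2l// le_max lexx orbT.
have [ih E] := integralC_half_line cw h1 h2 h3 h4.
have <- : integralC `[0, +oo[ q = resolvent xi i j.
  by rewrite E /PsiE mxE mulr0 expc0 mul1r expxA0 mulmx1 mxE opprK.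
exact: n1_integralC_half_line.
Qed.

Lemma n1_invz_sqr xi : n1 ((z xi)^-1)%R * n1 ((z xi)^-1)%R <= 2 / (c ^+ 2 + xi ^+ 2).
Proof.
have D0 : 0 < c ^+ 2 + xi ^+ 2 by rewrite ltr_pwDl ?sqr_ge0// exprn_gt0.
rewrite /n1 ReV ImV /= normrN !normrM normfV (gtr0_norm D0) -mulrDl.
rewrite mulrACA -invfM -expr2 ler_pdivrMr ?mulr_gt0//.
have -> : 2 / (c ^+ 2 + xi ^+ 2) * ((c ^+ 2 + xi ^+ 2) * (c ^+ 2 + xi ^+ 2)) =
  2 * (c ^+ 2 + xi ^+ 2) by field; rewrite gt_eqF.
rewrite -(real_normK (num_real c)) -(real_normK (num_real xi)).
by have := sqr_ge0 (`|c| - `|xi|); lra.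
Qed.

(* By the resolvent identity [(z - B)^-1 = z^-1 (1 + B (z - B)^-1)]. *)
Lemma laplace_H_bound : exists2 K, 0 <= K & forall xi i j,
  n1 ((z xi)^-1 * resolvent xi i j) <= K / oneDsqr xi.
Proof.
have [K K0 hK] := resolvent_bounded.
pose b := \sum_i \sum_l n1 (B i l) * K.
have b0 : 0 <= b by do 2 apply: sumr_ge0 => ? _; rewrite mulr_ge0// n1_ge0.
(* The factor [1 + c ^- 2] compares [1 + xi ^+ 2] with [c ^+ 2 + xi ^+ 2], and [1 + b] bounds the
   entries of [1 + B (z - B)^-1]. *)
exists (2 * (1 + c ^- 2) * (1 + b)) => [|xi i j].
  by rewrite !mulr_ge0// addr_ge0// invr_ge0 exprn_ge0// ltW.
have E : resolvent xi = (z xi)^-1 *: (1%:M + B *m resolvent xi).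
  have := mulmxV (resolvent_unit xi); rewrite -/(resolvent xi) mulmxBl mul_scalar_mx.
  by move=> <-; rewrite subrK scalerA mulVf ?z_neq0// scale1r.
rewrite E mxE mulrA (le_trans (n1M _ _))//.
have h1 : n1 ((1%:M + B *m resolvent xi) i j) <= 1 + b.
  rewrite mxE (le_trans (n1D _ _))// lerD//.
    rewrite mxE; case: (i == j); last by rewrite n1_0.
    by rewrite /n1 /= normr1 normr0 addr0.
  have hi : \sum_l n1 (B i l) * K <= b.
    rewrite /b [leRHS](bigD1 i)//= lerDl.
    by do 2 apply: sumr_ge0 => ? _; rewrite mulr_ge0// n1_ge0.
  rewrite mxE (le_trans (n1_sum _ _ _))// (le_trans _ hi)//.
  apply: ler_sum => l _; rewrite (le_trans (n1M _ _))//.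
  by rewrite ler_wpM2l ?n1_ge0.
have h2 : n1 ((z xi)^-1 * (z xi)^-1) <= 2 * (1 + c ^- 2) / oneDsqr xi.
  rewrite (le_trans (n1M _ _))// (le_trans (n1_invz_sqr xi))// -mulrA ler_wpM2l//.
  have D0 : 0 < c ^+ 2 + xi ^+ 2 by rewrite ltr_pwDl ?sqr_ge0// exprn_gt0.
  have o0 : 0 < oneDsqr xi by rewrite (lt_le_trans _ (oneDsqr_ge1 _)).
  rewrite ler_pdivlMr// mulrC ler_pdivrMr// /oneDsqr.
  have -> : (1 + c ^- 2) * (c ^+ 2 + xi ^+ 2) = c ^+ 2 + xi ^+ 2 + 1 + xi ^+ 2 / c ^+ 2.
    by field; rewrite gt_eqF.
  have := sqr_ge0 c; have : 0 <= xi ^+ 2 / c ^+ 2 by rewrite divr_ge0 ?sqr_ge0.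
  by lra.
rewrite [leRHS]mulrAC.
exact: ler_pM (n1_ge0 _) (n1_ge0 _) h2 h1.
Qed.

End Resolvent.

(** * Inversion of the Laplace transform of [H] *)

Section ResolventInversion.
Variable R : realType.
Local Notation C := R[i].
Local Notation mu := (@lebesgue_measure R).

Lemma Rintegral_sym_itv (f : R -> R) (a : R) : 0 <= a -> continuous f ->
  \int[mu]_(x in `[- a, a]) f x = \int[mu]_(x in `[0, a]) (f x + f (- x)).
Proof.
move=> a0 cf.
have cfN : continuous (fun x => f (- x)).
  by move=> x; apply: (@continuous_comp _ _ _ -%R f); [exact: opp_continuous|exact: cf].
rewrite RintegralD//; [|exact: continuous_integrable_itv..].
have := @Rintegral_itvB R f (BLeft (- a)) (BRight a) 0 (continuous_integrable_itv _ _ cf).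
rewrite !bnd_simp oppr_le0 => /(_ a0 a0).
rewrite Rintegral_itv_obnd_cbnd; last first.
  apply: (integrableS _ _ _ (continuous_integrable_itv 0 a cf)) => //.
  by apply: subset_itvr; rewrite bnd_simp.
move=> <-.
have := @integration_by_substitution_oppr R f 0 a a0 (continuous_subspaceT cf).
rewrite oppr0 => E.
have -> : \int[mu]_(x in `[0, a]) f (- x) = \int[mu]_(x in `[- a, 0]) f x.
  by rewrite /Rintegral E.
by rewrite subrK.
Qed.

(** The tail of [1 / (1 + x^2)] beyond [a] is [pi / 2 - atan a]. This explicit rate depends on [f]
    only through [K], which is the source of uniform convergence. *)
Lemma Rintegral_tail_oneDsqr (f : R -> R) (K a : R) : 0 <= a -> 0 <= K ->
  mu.-integrable `[0, +oo[ (EFin \o f) ->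
  (forall x : R, 0 <= x -> `|f x| <= K / oneDsqr x) ->
  `|\int[mu]_(x in `[0, a]) f x - \int[mu]_(x in `[0, +oo[) f x| <=
  K * (pi / 2 - atan a).
Proof.
move=> a0 K0 intf bf.
have iO : mu.-integrable `[0, +oo[ (EFin \o (fun x => (oneDsqr x)^-1)%R).
  exact: integrableS (integrable_oneDsqrV R).
have := @Rintegral_itvB R _ (BLeft 0) +oo%O a iO; rewrite !bnd_simp => /(_ a0 isT).
rewrite integral0_oneDsqr// {1}/Rintegral integral0y_oneDsqr /= => ->.
have := @Rintegral_itvB R _ (BLeft 0) +oo%O a intf; rewrite !bnd_simp => /(_ a0 isT).
rewrite distrC => ->.
have sub : `]a, +oo[ `<=` `[0, +oo[.
  by move=> x /=; rewrite !in_itv/= !andbT => /ltW; exact: le_trans.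
have intf' : mu.-integrable `]a, +oo[ (EFin \o f) by exact: integrableS intf.
have iO' : mu.-integrable `]a, +oo[ (EFin \o (fun x => (oneDsqr x)^-1)%R).
  exact: integrableS iO.
rewrite -RintegralZl// (le_trans (le_normr_Rintegral _ intf'))//.
apply: le_Rintegral => //; first exact: integrable_norm.
  rewrite (_ : _ \o _ = (fun x => (K%:E * ((oneDsqr x)^-1)%R%:E)%E)).
    exact: integrableZl.
  by apply/funext => x; rewrite /= EFinM.
by move=> x xa; apply: bf; have /= := sub x xa; rewrite in_itv/= andbT.
Qed.

Lemma lipschitz_continuous (f : R -> R) (L : R) :
  (forall x y, `|f x - f y| <= L * `|x - y|) -> continuous f.
Proof.
move=> hf x; apply/cvgrPdist_lt => e e0.
have L1 : 0 < `|L| + 1 by rewrite ltr_wpDl.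
have eL : 0 < e / (`|L| + 1) by rewrite divr_gt0.
have /cvgrPdist_lt /(_ _ eL) : id t @[t --> x] --> x by exact: cvg_id.
apply: filterS => t ht; rewrite (le_lt_trans (hf x t))//.
rewrite (@le_lt_trans _ _ ((`|L| + 1) * `|x - t|))//.
  by rewrite ler_wpM2r// (le_trans (ler_norm _))// lerDl.
by rewrite mulrC -ltr_pdivlMr.
Qed.

Lemma expiD (x y : R) : expi (x + y) = expi x * expi y.
Proof.
by apply: complexP; rewrite !(ReM, ImM) /= ?cosD ?sinD//; ring.
Qed.

Lemma expi_sum (x : R) : expi x + expi (- x) = (2 * cos x)%:C%C.
Proof. by apply: complexP; rewrite ?ReD ?ImD /= ?cosN ?sinN ?subrr//; ring. Qed.

Lemma n1_expi (x : R) : n1 (expi x) <= 2.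
Proof.
by rewrite /n1 /= (_ : 2 = 1 + 1 :> R)// lerD// ler_norml ?cos_geN1 ?cos_le1 ?sin_geN1 ?sin_le1.
Qed.

Lemma contC_expi (y : R) : contC (fun xi => expi (xi * y)).
Proof.
by split; [exact: (is_derive_continuous (is_derive_cosM y))|
  exact: (is_derive_continuous (is_derive_sinM y))].
Qed.

Variables (n : nat) (B : 'M[C]_n) (w c : R) (H : R -> 'M[C]_n).
Hypotheses (w_gt0 : 0 < w) (w_lt_c : w < c).
Hypothesis spec : forall a, eigenvalue B a -> complex.Re a < w.
Hypotheses (H0 : H 0 = 0) (dH : forall x, isdM H x (expxA B x)).
Local Notation z := (Complex c).

Let c_gt0 : 0 < c. Proof. exact: lt_trans w_gt0 w_lt_c. Qed.

(** Hilbert's resolvent identity and the uniform bound on the resolvent make its entries Lipschitz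
    in [xi]. *)
Lemma contC_resolvent i j : contC (fun xi => resolvent B c xi i j).
Proof.
have [K K0 hK] := resolvent_bounded w_gt0 w_lt_c spec H0 dH.
have L x y : n1 (resolvent B c x i j - resolvent B c y i j) <=
    \sum_(k < n) (K * K) * `|x - y|.
  have -> : resolvent B c x i j - resolvent B c y i j =
      ((z y - z x) *: (resolvent B c x *m resolvent B c y)) i j.
    have hx := mulVmx (resolvent_unit w_lt_c spec x).
    have hy := mulmxV (resolvent_unit w_lt_c spec y).
    rewrite -/(resolvent B c x) in hx; rewrite -/(resolvent B c y) in hy.
    have -> : (z y - z x) *: (resolvent B c x *m resolvent B c y) =
      resolvent B c x *m (((z y)%:M - B) - ((z x)%:M - B)) *m resolvent B c y.
      rewrite opprB addrA subrK -scalar_mx_is_additive.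
      by rewrite mul_mx_scalar -scalemxAl.
    by rewrite mulmxBr hx mulmxBl -mulmxA hy mulmx1 mul1mx !mxE.
  rewrite mxE (le_trans (n1M _ _))//.
  have -> : n1 (z y - z x) = `|x - y|.
    by rewrite /n1 ReD ImD ReN ImN /= subrr normr0 add0r distrC.
  rewrite -mulr_suml mulrC ler_wpM2r// mxE (le_trans (n1_sum _ _ _))//.
  by apply: ler_sum => k _; rewrite (le_trans (n1M _ _))// ler_pM ?n1_ge0.
split; apply: (@lipschitz_continuous _ (\sum_(k < n) (K * K))) => x y.
  rewrite mulr_suml (le_trans _ (L x y))//.
  by rewrite -ReN -ReD Re_le_n1.
rewrite mulr_suml (le_trans _ (L x y))//.
by rewrite -ImN -ImD Im_le_n1.
Qed.

Lemma contC_invz : contC (fun xi => (z xi)^-1%R).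
Proof.
have D0 (x : R) : c ^+ 2 + x ^+ 2 != 0.
  by rewrite gt_eqF// ltr_pwDl ?sqr_ge0// exprn_gt0.
have h : continuous (fun x : R => (c ^+ 2 + x ^+ 2)^-1%R).
  move=> x; apply: cvgV => //; apply: cvgD; first exact: cvg_cst.
  exact: exprn_continuous.
split => x.
  under eq_fun do rewrite ReV /=.
  by apply: cvgMr; exact: h.
under eq_fun do rewrite ImV /=.
by apply: cvgN; apply: cvgM; [exact: cvg_id|exact: h].
Qed.

Definition resolvent_wave (y : R) i j (xi : R) : C :=
  expi (xi * y) * ((z xi)^-1 * resolvent B c xi i j).

Lemma contC_resolvent_wave y i j : contC (resolvent_wave y i j).
Proof.
apply: contCM; first exact: contC_expi.
by apply: contCM; [exact: contC_invz|exact: contC_resolvent].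
Qed.

(** This is [e^(- c v) H v] for [v >= 0] and [0] for [v <= 0], because [H 0 = 0]. Writing the
    cut-off with [Num.max] makes continuity a matter of composition. *)
Definition causal_primitive i j (v : R) : C :=
  expc (- c%:C%C * (Num.max v 0)%:C%C) * H (Num.max v 0) i j.

Let h i j (v : R) : C := expc (- c%:C%C * v%:C%C) * H v i j.

Let contC_h i j : contC (h i j).
Proof.
by apply: isdC_contC => x; eexists; apply: isdCM; [exact: isdC_expc|exact: dH].
Qed.

Let h_int i j : intC `[0, +oo[ (h i j).
Proof. by have [] := laplace_H w_gt0 w_lt_c spec H0 dH 0 i j. Qed.

Let max_cont : continuous (fun v : R => Num.max v 0).
Proof.
by move=> v; apply: (@continuous_max _ _ id (cst 0)); [exact: cvg_id|exact: cvg_cst].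
Qed.

Let contC_T i j : contC (causal_primitive i j).
Proof.
have [h1 h2] := contC_h i j; split => v.
  exact: (@continuous_comp _ _ _ (fun v : R => Num.max v 0) (fun v => complex.Re (h i j v)) _
    (max_cont (x := v)) (h1 _)).
exact: (@continuous_comp _ _ _ (fun v : R => Num.max v 0) (fun v => complex.Im (h i j v)) _
    (max_cont (x := v)) (h2 _)).
Qed.

Lemma causal_primitive_ge0 i j v : 0 <= v -> causal_primitive i j v = h i j v.
Proof. by move=> v0; rewrite /causal_primitive max_l. Qed.

Lemma causal_primitive_le0 i j v : v <= 0 -> causal_primitive i j v = 0.
Proof. by move=> v0; rewrite /causal_primitive max_r// H0 mxE mulr0. Qed.

Let T_bounded i j : exists K, forall v, n1 (causal_primitive i j v) <= K.
Proof.
have [K hK] := expxA_growth w_gt0 spec.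
have K0 : 0 <= K.
  by have := hK 0 i j (lexx _); rewrite mulr0 expR0 mulr1; apply: le_trans; exact: n1_ge0.
have hH v (v0 : 0 <= v) := exp_growth_primitiveC w_gt0 (fun x => dH x i j) (fun x x0 => hK x i j x0) v0.
exists (2 * (2 * (K / w))) => v; have [v0|v0] := leP v 0.
  by rewrite causal_primitive_le0// n1_0 !mulr_ge0 ?invr_ge0 ?(ltW w_gt0)//.
rewrite (causal_primitive_ge0 _ _ (ltW v0)) /h (le_trans (n1M _ _))//.
have := hH v (ltW v0); rewrite H0 mxE n1_0 add0r => hv.
have := ler_pM (n1_ge0 _) (n1_ge0 _) (n1_expc (- c%:C%C * v%:C%C)) hv.
move=> /le_trans; apply; rewrite ReM ReN ImN /= mulr0 subr0.
rewrite [leLHS](_ : _ = 2 * (2 * (K / w)) * expR (- c * v + w * v)); last first.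
  by rewrite expRD; ring.
rewrite -[leRHS]mulr1 ler_wpM2l//; first by rewrite !mulr_ge0 ?invr_ge0 ?(ltW w_gt0).
by rewrite -expR0 ler_expR -mulrDl mulr_le0_ge0 ?(ltW v0)// addrC subr_le0 ltW.
Qed.

(** Here and below [rho] is the real or the imaginary part, since the inversion theorem concerns
    real functions. *)
Let T_int (rho : C -> R) (i j : 'I_n) : rho 0 = 0 ->
  mu.-integrable `[0, +oo[ (fun v => (rho (h i j v))%:E) ->
  mu.-integrable setT (fun v => (rho (causal_primitive i j v))%:E).
Proof.
move=> rho0 hi.
rewrite (_ : (fun v => _) = (fun v => (rho (h i j v))%:E) \_ `[0, +oo[).
  by apply/(integrable_mkcond _ _).1.
apply/funext => v; rewrite patchE; case: ifPn => [|].
  by rewrite inE /= in_itv/= andbT => v0; rewrite causal_primitive_ge0.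
rewrite notin_setE /= in_itv/= andbT => /negP; rewrite -ltNge => v0.
by rewrite causal_primitive_le0 ?ltW// rho0.
Qed.

Let wave_int y xi i j :
  intC `[0, +oo[ (fun v => expi (xi * y) * (expc (- z xi * v%:C%C) * H v i j)) /\
  resolvent_wave y i j xi =
  integralC `[0, +oo[ (fun v => expi (xi * y) * (expc (- z xi * v%:C%C) * H v i j)).
Proof.
have [i1 e1] := laplace_H w_gt0 w_lt_c spec H0 dH xi i j.
by split; [exact: intCM|rewrite integralCM// e1].
Qed.

(** In the Laplace integral for [z = c + i xi] the weight [e^(- c v)] does not depend on [xi], so
    adding the frequencies [xi] and [- xi] leaves the real factor [2 cos (xi (y - v))]. Real and
    imaginary parts of [h] then separate. *)
Let wave_sym y xi i j :
  intC `[0, +oo[ (fun v => (2 * cos (xi * (y - v)))%:C%C * h i j v) /\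
  resolvent_wave y i j xi + resolvent_wave y i j (- xi) =
  integralC `[0, +oo[ (fun v => (2 * cos (xi * (y - v)))%:C%C * h i j v).
Proof.
have [i1 ->] := wave_int y xi i j; have [i2 ->] := wave_int y (- xi) i j.
have E v : expi (xi * y) * (expc (- z xi * v%:C%C) * H v i j) +
    expi (- xi * y) * (expc (- z (- xi) * v%:C%C) * H v i j) =
    (2 * cos (xi * (y - v)))%:C%C * h i j v.
  have F t : expc (- z t * v%:C%C) = expc (- c%:C%C * v%:C%C) * expi (- (t * v)).
    rewrite /expc !(ReM, ImM, ReN, ImN) /= !(mulr0, mul0r, oppr0, subr0, add0r, addr0).
    have -> : expi 0 = 1 :> C by rewrite /expi cos0 sin0.
    by rewrite mulr1 [- t * v]mulNr.
  rewrite -expi_sum (F xi) (F (- xi)) /h.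
  have -> : expi (xi * (y - v)) = expi (xi * y) * expi (- (xi * v)).
    by rewrite -expiD; congr expi; ring.
  have -> : expi (- (xi * (y - v))) = expi (- xi * y) * expi (- (- xi * v)).
    by rewrite -expiD; congr expi; ring.
  by ring.
have EF := funext E; split; first by rewrite -EF; exact: intCD.
by rewrite -integralCD// EF.
Qed.

Let cosT (rho : C -> R) i j y xi :=
  cos_transform (fun v => rho (causal_primitive i j v)) y xi.

Let cosTE (rho : C -> R) i j y xi : rho 0 = 0 ->
  cosT rho i j y xi = \int[mu]_(v in `[0, +oo[) (rho (h i j v) * cos (xi * (y - v))).
Proof.
move=> rho0; rewrite /cosT /cos_transform [RHS]Rintegral_mkcond.
apply: eq_Rintegral => v _; rewrite patchE; case: ifPn => [|].
  by rewrite inE /= in_itv/= andbT => v0; rewrite causal_primitive_ge0.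
rewrite notin_setE /= in_itv/= andbT => /negP; rewrite -ltNge => v0.
by rewrite causal_primitive_le0 ?ltW// rho0 mul0r.
Qed.

Let cos_int (f : R -> R) y xi : mu.-integrable `[0, +oo[ (fun v => (f v)%:E) ->
  mu.-integrable `[0, +oo[ (EFin \o (fun v => f v * cos (xi * (y - v)))).
Proof.
move=> hi; have mf : measurable_fun `[(0 : R), +oo[ f.
  by apply/measurable_EFinP; case/integrableP : hi.
apply: le_integrable hi => //.
  apply/measurable_EFinP; apply: measurable_funM => //.
  apply/measurable_fun_cos/measurable_funM; first exact: measurable_cst.
  by apply: measurable_funB => //; exact: measurable_cst.
move=> v _; rewrite lee_fin normrM ler_piMr//.
by rewrite ler_norml cos_geN1 cos_le1.
Qed.

Let wave_symE y xi i j :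
  resolvent_wave y i j xi + resolvent_wave y i j (- xi) =
  Complex (2 * cosT (@complex.Re R) i j y xi) (2 * cosT (@complex.Im R) i j y xi).
Proof.
have [i1 ->] := wave_sym y xi i j; have [h1 h2] := h_int i j.
apply: complexP => /=; rewrite cosTE// -RintegralZl//; try exact: cos_int;
  apply: eq_Rintegral => v _; rewrite ?ReM ?ImM /=; ring.
Qed.

(** The error [eps] depends neither on [y] nor on the entry. In [2 * pi], the [pi] comes from the
    cosine inversion and the [2] from folding the interval. *)
Lemma fourier_resolvent : exists eps : R -> R, eps a @[a --> +oo] --> 0 /\
  forall y i j a, 0 <= a ->
    n1 (integralC `[- a, a] (resolvent_wave y i j) -
        (2 * pi)%:C%C * causal_primitive i j y) <= eps a.
Proof.
have [K K0 hK] := laplace_H_bound w_gt0 w_lt_c spec H0 dH.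
(* From the outside: one factor [2] for adding real and imaginary parts, one for the [2 cos] of the
   folding, one for [n1 (expi _) <= 2]. *)
exists (fun a => 2 * (2 * (2 * K * (pi / 2 - atan a)))); split.
  rewrite -[X in _ --> X](mulr0 2); apply: cvgMr.
  rewrite -[X in _ --> X](mulr0 2); apply: cvgMr.
  rewrite -[X in _ --> X](mulr0 (2 * K)); apply: cvgMr.
  rewrite -[X in _ --> X](subrr (pi / 2)); apply: cvgB; first exact: cvg_cst.
  exact: cvgy_atan.
move=> y i j a a0.
have wb xi : n1 (resolvent_wave y i j xi) <= 2 * K / oneDsqr xi.
  rewrite (le_trans (n1M _ _))// -mulrA.
  by apply: ler_pM (n1_ge0 _) (n1_ge0 _) (n1_expi _) (hK xi i j).
have wsb xi : n1 (resolvent_wave y i j xi + resolvent_wave y i j (- xi)) <=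
    2 * (2 * K / oneDsqr xi).
  rewrite (le_trans (n1D _ _))// mulr_natl mulr2n lerD//.
  by have := wb (- xi); rewrite /oneDsqr sqrrN.
have [g1 g2] := contC_resolvent_wave y i j.
have [t1 t2] := contC_T i j; have [h1 h2] := h_int i j.
have [KT hKT] := T_bounded i j.
have key (rho : C -> R) : rho 0 = 0 -> continuous (fun xi => rho (resolvent_wave y i j xi)) ->
    continuous (fun v => rho (causal_primitive i j v)) ->
    mu.-integrable `[0, +oo[ (fun v => (rho (h i j v))%:E) ->
    (forall u, `|rho u| <= n1 u) ->
    (forall xi, rho (resolvent_wave y i j xi) + rho (resolvent_wave y i j (- xi)) =
       2 * cosT rho i j y xi) ->
    (forall u v, rho (u + v) = rho u + rho v) ->
    `|\int[mu]_(xi in `[- a, a]) rho (resolvent_wave y i j xi) -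
      2 * pi * rho (causal_primitive i j y)| <= 2 * (2 * K * (pi / 2 - atan a)).
  move=> rho0 cg cT hi rho_n1 rhoE rhoD.
  have iT := T_int rho0 hi.
  have bT v : `|rho (causal_primitive i j v)| <= KT by rewrite (le_trans (rho_n1 _)).
  have bcos xi : `|cosT rho i j y xi| <= 2 * K / oneDsqr xi.
    have := le_trans (rho_n1 _) (wsb xi); rewrite rhoD rhoE normrM ger0_norm//.
    by rewrite ler_pM2l.
  have mcos : measurable_fun `[(0 : R), +oo[ (cosT rho i j y).
    exact: (measurable_cos_transform y cT iT).
  have icos : mu.-integrable `[0, +oo[ (EFin \o cosT rho i j y).
    have hO : mu.-integrable `[0, +oo[ (fun x => ((2 * K)%:E * ((oneDsqr x)^-1)%R%:E)%E).
      apply: integrableZl => //; exact: integrableS (integrable_oneDsqrV R).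
    apply: le_integrable hO => //; first exact/measurable_EFinP.
    by move=> x _; rewrite -EFinM lee_fin (le_trans (bcos x))// ler_norm.
  rewrite Rintegral_sym_itv//; under eq_Rintegral do rewrite rhoE.
  rewrite RintegralZl//; last first.
    by apply: integrableS icos => //; move=> x /=; rewrite !in_itv/= => /andP[->].
  rewrite -mulrA -mulrBr normrM ger0_norm// ler_wpM2l//.
  rewrite -(cos_transform_inversion cT bT iT icos).
  apply: Rintegral_tail_oneDsqr => //; first by rewrite mulr_ge0.
rewrite /n1 ReD ImD ReN ImN ReZ ImZ.
have k1 := key (@complex.Re R) erefl g1 t1 h1 (@Re_le_n1 R) _ (@ReD R).
have k2 := key (@complex.Im R) erefl g2 t2 h2 (@Im_le_n1 R) _ (@ImD R).
rewrite [leRHS]mulr_natl mulr2n; apply: lerD.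
  by apply: k1 => xi; rewrite -ReD wave_symE.
by apply: k2 => xi; rewrite -ImD wave_symE.
Qed.

End ResolventInversion.

(** * The function s *)

Section MeanSquare.
Variable R : realType.
Local Notation C := R[i].
Local Notation mu := (@lebesgue_measure R).

(* No measurability is assumed: the integral of a nonnegative function is the
   supremum of the integrals of the simple functions below it. *)
Lemma le_ge0_integral (d : measure_display) (T : measurableType d)
    (nu : {measure set T -> \bar R}) (D : set T) (f g : T -> \bar R) :
  (forall x, D x -> (0 <= f x)%E) -> (forall x, D x -> (f x <= g x)%E) ->
  (\int[nu]_(x in D) f x <= \int[nu]_(x in D) g x)%E.
Proof.
move=> f0 fg.
have g0 x : D x -> (0 <= g x)%E by move=> Dx; exact: le_trans (f0 x Dx) (fg x Dx).
rewrite !ge0_integralE//; apply: le_ereal_sup => _ [h /= hf <-]; exists h => //= x.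
rewrite (le_trans (hf x))// !patchE; case: ifPn => // /set_mem; exact: fg.
Qed.

Lemma sqr_normL2_le (f : R -> C) (e l : R) : 0 <= l ->
  (forall x, 0 < x < l -> n1 (f x) <= e) ->
  (sqr_normL2 l f <= (e ^+ 2 * l)%:E)%E.
Proof.
move=> l0 fe; rewrite /sqr_normL2.
apply: (@le_trans _ _ (\int[mu]_(x in `]0%R, l[) (e ^+ 2)%:E)%E).
  apply: le_ge0_integral => x; first by rewrite lee_fin sqr_ge0.
  rewrite /= in_itv/= => xl; rewrite lee_fin normc2E.
  have := fe x xl; rewrite /n1; move: (normr_ge0 (complex.Re (f x))) (normr_ge0 (complex.Im (f x))).
  rewrite -(real_normK (num_real (complex.Re (f x)))) -(real_normK (num_real (complex.Im (f x)))).
  by nra.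
rewrite integral_cst//= lebesgue_measure_itv/= lte_fin.
have [_|_] := ltP 0 l; first by rewrite sube0 -EFinM.
by rewrite mule0 lee_fin mulr_ge0// sqr_ge0.
Qed.

Lemma sqr_normL2_ge (f : R -> C) (e a b l : R) : 0 <= e -> 0 <= a -> a <= b -> b <= l ->
  (forall x, a < x < b -> e ^+ 2 <= Normc.normc (f x) ^+ 2) ->
  ((e ^+ 2 * (b - a))%:E <= sqr_normL2 l f)%E.
Proof.
move=> e0 a0 ab bl fe; rewrite /sqr_normL2.
have -> : (e ^+ 2 * (b - a))%:E = (\int[mu]_(x in `]0%R, l[) ((cst (e ^+ 2)%:E \_ `]a, b[) x))%E.
  rewrite -integral_mkcondr (_ : _ `&` _ = `]a, b[%classic).
    rewrite integral_cst//= lebesgue_measure_itv/= lte_fin.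
    have [_|ba] := ltP a b; first by rewrite -EFinB -EFinM.
    by rewrite (@le_anti _ _ a b) ?ab ?ba// subrr mulr0 mule0.
  apply/seteqP; split => x; first by case.
  rewrite /= !in_itv/= => /andP[ax xb]; rewrite ax xb; split => //.
  by rewrite (le_lt_trans a0 ax) (lt_le_trans xb bl).
apply: le_ge0_integral => x _; rewrite patchE; case: ifPn => //.
- by rewrite lee_fin sqr_ge0.
- by rewrite inE /= in_itv/= lee_fin => /fe.
- by rewrite lee_fin sqr_ge0.
Qed.

Lemma cvg0_eventually_lt (u : R -> \bar R) (e : R) : 0 < e ->
  u a @[a --> +oo] --> 0%E -> \forall a \near +oo, (u a < e%:E)%E.
Proof.
move=> e0 /fine_cvgP[h1 /cvgrPdist_lt /(_ _ e0) h2].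
apply: filterS2 h1 h2 => a ua; rewrite sub0r normrN /= => ue.
by rewrite -(fineK ua) lte_fin (le_lt_trans (ler_norm _)).
Qed.

(** If the limits differed at [x0], continuity would keep one component of [G - G0] of size at least
    [d / 2] on an interval. There [F a] is eventually within [d / 4] of [G0], hence at least [d / 4]
    away from [G], and the mean-square distance could not tend to [0]. *)
Lemma mean_square_limit_unique (F : R -> R -> C) (G G0 : R -> C) (l x0 : R) :
  sqr_normL2 l (fun x => F a x - G x) @[a --> +oo] --> 0%E ->
  (forall e, 0 < e -> \forall a \near +oo, forall x, 0 < x < l -> n1 (F a x - G0 x) <= e) ->
  {for x0, continuous (fun x => complex.Re (G x - G0 x))} ->
  {for x0, continuous (fun x => complex.Im (G x - G0 x))} ->
  0 < x0 < l -> G x0 = G0 x0.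
Proof.
move=> FG FG0 cr ci /andP[x0_gt0 x0_lt].
suff key (rho : C -> R) : (forall u v, rho (u - v) = rho u - rho v) ->
    (forall u, `|rho u| <= n1 u) -> (forall u, rho u ^+ 2 <= Normc.normc u ^+ 2) ->
    {for x0, continuous (fun x => rho (G x - G0 x))} -> rho (G x0 - G0 x0) = 0.
  apply/eqP; rewrite -subr_eq0; apply/eqP/complexP => /=.
    apply: (key (@complex.Re R)) => //.
    - by move=> u v; rewrite ReD ReN.
    - exact: Re_le_n1.
    - by move=> u; rewrite normc2E lerDl sqr_ge0.
  apply: (key (@complex.Im R)) => //.
  - by move=> u v; rewrite ImD ImN.
  - exact: Im_le_n1.
  - by move=> u; rewrite normc2E lerDr sqr_ge0.
move=> rhoB rho_n1 rho_normc c; apply/eqP/negPn/negP => d0.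
pose d := `|rho (G x0 - G0 x0)|; have {}d0 : 0 < d by rewrite normr_gt0.
have d2 : 0 < d / 2 by rewrite divr_gt0.
have d4 : 0 < d / 4 by rewrite divr_gt0.
have : \forall x \near x0, [/\ 0 < x, x < l & d / 2 <= `|rho (G x - G0 x)|].
  near=> x; split.
  - by near: x; exact: lt_nbhsr.
  - by near: x; exact: lt_nbhsl.
  - have : `|rho (G x0 - G0 x0) - rho (G x - G0 x)| < d / 2.
      by near: x; move/cvgrPdist_lt : c; apply.
    by have := lerB_dist (rho (G x0 - G0 x0)) (rho (G x - G0 x)); rewrite -/d; lra.
move=> /nbhs_ballP[r /= r0 hr].
(* Half the radius, so that the closed interval around [x0] lies inside the ball. *)
have [r1 r1E] : exists r1, r1 = r / 2 by exists (r / 2).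
have r10 : 0 < r1 by rewrite r1E divr_gt0.
have inball x : x0 - r1 <= x <= x0 + r1 -> [/\ 0 < x, x < l & d / 2 <= `|rho (G x - G0 x)|].
  move=> /andP[h1 h2]; apply: hr; rewrite /ball /= ltr_norml.
  by apply/andP; split; lra.
have [b1 _ _] := inball (x0 - r1) (ltac:(by apply/andP; split; lra)).
have [_ b2 _] := inball (x0 + r1) (ltac:(by apply/andP; split; lra)).
have e0 : 0 < (d / 4) ^+ 2 * (x0 + r1 - (x0 - r1)) by rewrite mulr_gt0 ?exprn_gt0//; lra.
have [a [ha1 ha2]] : exists a, (sqr_normL2 l (fun x => F a x - G x)%R <
    ((d / 4) ^+ 2 * (x0 + r1 - (x0 - r1)))%:E)%E /\
    forall x, 0 < x < l -> n1 (F a x - G0 x) <= d / 4.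
  have h1 := cvg0_eventually_lt e0 FG; have h2 := FG0 _ d4.
  near (@pinfty_nbhs R) => a; exists a; split; first by near: a.
  by near: a.
move: ha1; apply/negP; rewrite -leNgt; apply: sqr_normL2_ge; [exact: ltW|exact: ltW| |exact: ltW|].
  by lra.
move=> x /andP[h1 h2]; have [x1 x2 x3] := inball x (ltac:(by apply/andP; split; exact: ltW)).
apply: le_trans (rho_normc _); rewrite -[leRHS]real_normK ?num_real//.
rewrite lerXn2r ?nnegrE ?normr_ge0 ?(ltW d4)//.
have h3 := le_trans (rho_n1 _) (ha2 x (ltac:(by rewrite x1 x2))).
have -> : F a x - G x = (F a x - G0 x) - (G x - G0 x) by ring.
rewrite rhoB distrC.
by have := lerB_dist (rho (G x - G0 x)) (rho (F a x - G0 x)); lra.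
Unshelve. all: by end_near. Qed.

End MeanSquare.

Lemma ler_sum_term (R : numDomainType) (I : finType) (F : I -> R) (i : I) :
  (forall j, 0 <= F j) -> F i <= \sum_j F j.
Proof. by move=> F0; rewrite (bigD1 i)//= lerDl sumr_ge0. Qed.

(** * Exponentials of diagonal matrices *)

Section DiagonalMatrices.
Variable R : realType.
Local Notation C := R[i].

Lemma expxA_diag p (a : 'rV[C]_p) (x : R) :
  expxA (diag_mx a) x = diag_mx (\row_m expc (a 0 m * x%:C%C)).
Proof.
pose F (x : R) : 'M[C]_p := diag_mx (\row_m expc (a 0 m * x%:C%C)).
have -> : diag_mx (\row_m expc (a 0 m * x%:C%C)) = F x by [].
rewrite (@expxA_unique _ _ _ (diag_mx a) F).
  rewrite (_ : F 0 = 1%:M) ?mulmx1//.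
  by apply/matrixP => i j; rewrite !mxE mulr0 expc0.
move=> y i j; rewrite mul_diag_mx [X in isdC _ _ X]mxE.
have E : (fun t => F t i j) = (fun t => expc (a 0 i * t%:C%C) * (i == j)%:R).
  by apply/funext => t; rewrite !mxE mulr_natr.
rewrite E -[F y i j]/((fun t => F t i j) y) E.
apply: isdC_eq; first exact: isdCM (isdC_expc _ _) (isdC_cst _ _).
by rewrite mulr0 addr0 mulrA.
Qed.

(** [tagnat.sig1 m] is the block containing the index [m]; the lemma trades the block structure for
    a row of diagonal entries. *)
Lemma mxdiag_scalar kappa (q : 'I_kappa -> nat) (a : 'I_kappa -> C) :
  \mxdiag_(j < kappa) ((a j)%:M : 'M[C]_(q j)) = diag_mx (\row_m a (tagnat.sig1 m)).
Proof.
under eq_mxdiag do rewrite -diag_const_mx.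
rewrite -diag_mxrow; congr diag_mx; apply/rowP => m.
by rewrite !mxE.
Qed.

End DiagonalMatrices.

(** * The truncated integrals of [phi] and their limit *)

Section PhiToS.
Variable R : realType.
Local Notation C := R[i].
Local Notation mu := (@lebesgue_measure R).
Variables (n kappa : nat) (q : 'I_kappa -> nat).
Local Notation p := (\sum_j q j)%N.
Variables (theta1 theta2 : 'M[C]_(n, p)) (beta : 'M[C]_n) (dt : 'I_kappa -> R).

(** The [d_m] of [D = diag (d_1, ..., d_p)], each delay repeated along its block. *)
Definition dcol (m : 'I_p) : R := dt (tagnat.sig1 m).

Definition two_i_beta : 'M[C]_n := (2 * 'i%C) *: beta.

Lemma exp2iE x : exp2i x beta = expxA two_i_beta x.
Proof. by rewrite expxA.unlock /exp2i /two_i_beta scalerA [x%:C%C * _]mulrC. Qed.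

(** The sign changes because the adjoint of [2 i beta] is [- 2 i] times the adjoint of [beta]. *)
Lemma exp2i_trmxC x : exp2i x (beta ^t*) = expxA (two_i_beta ^t*) (- x).
Proof.
rewrite expxA.unlock /exp2i; congr expmx.
apply/matrixP => i j; rewrite !mxE rmorphM /= mulrA; congr (_ * _).
by apply: complexP; rewrite !(ReM, ImM, Re_conj, Im_conj) /=; ring.
Qed.

Lemma DmxE : Dmx q dt = diag_mx (\row_m (dcol m)%:C%C).
Proof. exact: mxdiag_scalar. Qed.

Lemma PmxE j : Pmx R q j = diag_mx (\row_m (tagnat.sig1 m == j)%:R).
Proof.
rewrite -(@mxdiag_scalar R kappa q (fun j' => (j' == j)%:R)).
by apply: eq_mxdiag => j'; case: (j' == j); rewrite ?scalemx1// raddf0.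
Qed.

Lemma nuE i m : nu theta2 beta dt i m = (expxA two_i_beta (- dcol m) *m theta2) i m.
Proof.
have hD : - (2 * 'i%C * (diag_mx (\row_m (dcol m)%:C%C) : 'M[C]_p) m m) =
    (- dcol m)%:C%C * (2 * 'i%C).
  rewrite mxE eqxx mulr1n mxE.
  by apply: complexP; rewrite !(ReM, ImM, ReN, ImN) /=; ring.
rewrite mxE DmxE hD expxA.unlock /two_i_beta scalerA.
rewrite [LHS]mxE [RHS]mxE; apply: eq_bigr => k _; congr (_ * _).
by rewrite mxE.
Qed.

Variables (U : 'M[C]_p) (M eta : R).
Hypotheses (M_gt0 : 0 < M) (eta_lt : eta < - (2 * M)).
Hypothesis spec_beta : forall a : C,
  eigenvalue (beta + ('i%C * M%:C%C)%:M) a -> 0 < complex.Im a.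

(** If [a] is an eigenvalue of [2 i beta], then [a / (2 i)] is one of [beta]; its imaginary part
    [- Re a / 2] exceeds [- M]. *)
Lemma two_i_beta_spec a : eigenvalue two_i_beta a -> complex.Re a < 2 * M.
Proof.
move=> /eigenvalueP[v hv v0].
have i2 : (2 * 'i%C : C) != 0 by rewrite mulf_neq0// ?pnatr_eq0// eq_complex /= oner_eq0 andbF.
have : eigenvalue (beta + ('i%C * M%:C%C)%:M) ((2 * 'i%C)^-1 * a + 'i%C * M%:C%C).
  apply/eigenvalueP; exists v => //.
  rewrite mulmxDr mul_mx_scalar scalerDl -[(_ * a) *: v]scalerA -hv /two_i_beta -scalemxAr.
  by rewrite scalerA mulVf// scale1r.
move/spec_beta; rewrite ImD !ImM ReV ImV !(ReM, ImM) /=.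
rewrite !(mul0r, mulr0, mulr1, mul1r, sub0r, subr0, add0r, addr0, oppr0).
case: a {hv} => a b /=.
have -> : - ((1 + 1) / (0 ^+ 2 + (1 + 1) ^+ 2)) * a = - (a / 2) :> R by field.
by lra.
Qed.

Let c_gt : 2 * M < - eta. Proof. by rewrite ltrNr. Qed.
Let w_gt0 : 0 < 2 * M. Proof. by rewrite mulr_gt0. Qed.

(** The part of an entry that is free of [xi] and [x]. The constant is [- 2 i = i * i * 2 i]: one
    [i] from [phi], one from [lambda^-1 = i z^-1], and [2 i] from
    [(lambda / 2 - beta)^-1 = 2 i (z - B)^-1]. Of [e^(- z d_m)] only the modulus [e^(- c d_m)], with
    [c = - eta], stays here; the oscillating factor becomes the shift [x - d_m] of the wave. *)
Definition phi_coef (i k m : 'I_p) (a b : 'I_n) : C :=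
  (- (2 * 'i%C)) * (theta1 ^t*) i a * theta2 b m * U m k *
  expc (- (- eta)%:C%C * (dcol m)%:C%C).

Lemma phi_entry (xi x : R) i k :
  ((expi (xi * x) * (Complex xi eta)^-1) *:
    phi theta1 theta2 beta dt U (Complex xi eta / 2)) i k =
  \sum_m \sum_b \sum_a phi_coef i k m a b *
    resolvent_wave two_i_beta (- eta) (x - dcol m) a b xi.
Proof.
have i0 : 'i%C != 0 :> C by rewrite eq_complex /= oner_eq0 andbF.
have i2 : (2 * 'i%C : C) != 0 by rewrite mulf_neq0// pnatr_eq0.
set lam := Complex xi eta; set z := Complex (- eta) xi.
have zE : z = 'i%C * lam by apply: complexP; rewrite !(ReM, ImM) /=; ring.
have z0 : z != 0 := z_neq0 w_gt0 c_gt xi.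
have l0 : lam != 0 by apply: contra_neq z0 => l0; rewrite zE l0 mulr0.
have invE : invmx ((lam / 2)%:M - beta) = (2 * 'i%C) *: resolvent two_i_beta (- eta) xi.
  have E : (lam / 2)%:M - beta = (2 * 'i%C)^-1 *: (z%:M - two_i_beta).
    rewrite scalerBr /two_i_beta scalerA mulVf// scale1r zE scale_scalar_mx.
    by congr (_%:M - _); field.
  rewrite E invmxZ ?invrK//.
  by rewrite unitmxZ ?unitfE ?invr_eq0// (resolvent_unit c_gt two_i_beta_spec).
have expE : expmx (- (2 * 'i%C * (lam / 2)) *: Dmx q dt) =
    diag_mx (\row_m expc (- z * (dcol m)%:C%C)).
  have -> : - (2 * 'i%C * (lam / 2)) *: Dmx q dt =
      1%:C%C *: diag_mx (\row_m (- z * (dcol m)%:C%C)).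
    rewrite scale1r DmxE.
    apply/matrixP => s t; rewrite !mxE mulrnAr; congr (_ * _ *+ _).
    by rewrite zE; field.
  have := expxA_diag (\row_m (- z * (dcol m)%:C%C)) 1.
  rewrite expxA.unlock => ->; congr diag_mx; apply/rowP => m.
  by rewrite !mxE mulr1.
rewrite /phi expE invE mxE mxE !mxE mulr_sumr mulr_sumr.
apply: eq_bigr => m _.
rewrite mul_mx_diag !mxE.
rewrite !(mulr_suml, mulr_sumr); apply: eq_bigr => b _.
rewrite !mxE !(mulr_suml, mulr_sumr); apply: eq_bigr => a _.
rewrite !mxE /phi_coef /resolvent_wave -/z.
have -> : expc (- z * (dcol m)%:C%C) = expc (- (- eta)%:C%C * (dcol m)%:C%C) * expi (- (xi * dcol m)).
  rewrite /expc !(ReM, ImM, ReN, ImN) /= !(mulr0, mul0r, oppr0, subr0, add0r, addr0).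
  have -> : expi 0 = 1 :> C by rewrite /expi cos0 sin0.
  by rewrite mulr1 [- xi * _]mulNr.
have -> : expi (xi * (x - dcol m)) = expi (xi * x) * expi (- (xi * dcol m)) :> C.
  by rewrite -expiD; congr expi; ring.
have -> : (lam^-1 = 'i%C * z^-1)%R.
  by rewrite zE invfM mulrA mulfV ?mul1r.
have ii : 'i%C * 'i%C = -1 :> C by rewrite -expr2 sqr_i.
move: (z^-1)%R (resolvent _ _ _ _ _) (expi _) (expi _) (expc _) => w r e1 e2 e3.
transitivity ('i%C * 'i%C * (2 * 'i%C) * (theta1 ^t*) i a * theta2 b m * U m k * e3 * (e1 * e2 * (w * r))).
  by rewrite !mxE; ring.
by rewrite ii !mxE; ring.
Qed.

Variable H : R -> 'M[C]_n.
Hypotheses (H0 : H 0 = 0) (dH : forall x, isdM H x (expxA two_i_beta x)).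

Definition phi_limit (x : R) : 'M[C]_p := \matrix_(i, k)
  \sum_m \sum_b \sum_a phi_coef i k m a b *
    ((2 * pi)%:C%C * causal_primitive (- eta) H a b (x - dcol m)).

Definition phi_integral (a x : R) : 'M[C]_p := integralmx `[- a, a]
  (fun xi => let lambda := Complex xi eta in
    (expi (xi * x) * lambda^-1) *: phi theta1 theta2 beta dt U (lambda / 2)).

(** A finite combination of waves, each converging uniformly in its shift, converges uniformly in
    [x]. *)
Lemma phi_integral_cvg (e : R) : 0 < e -> \forall a \near +oo, forall x i k,
  n1 (phi_integral a x i k - phi_limit x i k) <= e.
Proof.
move=> e0.
have [eps [eps0 heps]] := fourier_resolvent w_gt0 c_gt two_i_beta_spec H0 dH.
(* The sum of all coefficients serves every entry at once; dividing by [K + 1] avoids a zero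
   denominator. *)
pose K := \sum_i \sum_k \sum_m \sum_b \sum_a n1 (phi_coef i k m a b).
have K0 : 0 <= K by do 5 apply: sumr_ge0 => ? _; exact: n1_ge0.
have h1 : \forall a \near +oo, `|eps a| < e / (K + 1).
  have eK : 0 < e / (K + 1) by rewrite divr_gt0// ltr_wpDl.
  by move/cvgrPdist_lt : eps0 => /(_ _ eK); apply: filterS => a; rewrite sub0r normrN.
have h2 : \forall a \near +oo, (0 : R) <= a by exact: nbhs_pinfty_ge.
apply: filterS2 h1 h2 => a ha a0 x i k.
have wi m b a' : intC `[- a, a] (fun xi => phi_coef i k m a' b *
    resolvent_wave two_i_beta (- eta) (x - dcol m) a' b xi).
  apply: intCM => //; apply: contC_intC.
  exact: (contC_resolvent_wave w_gt0 c_gt two_i_beta_spec H0 dH).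
have E : phi_integral a x i k = \sum_m \sum_b \sum_a' phi_coef i k m a' b *
    integralC `[- a, a] (resolvent_wave two_i_beta (- eta) (x - dcol m) a' b).
  rewrite mxE; under [X in integralC _ X]eq_fun do rewrite phi_entry.
  rewrite integralC_sum//; last by move=> m; do 2 apply: intC_sum => // ?.
  apply: eq_bigr => m _; rewrite integralC_sum//; last by move=> b; apply: intC_sum.
  apply: eq_bigr => b _; rewrite integralC_sum//; apply: eq_bigr => a' _.
  rewrite integralCM//; apply: contC_intC.
  exact: (contC_resolvent_wave w_gt0 c_gt two_i_beta_spec H0 dH).
have -> : phi_integral a x i k - phi_limit x i k =
    \sum_m \sum_b \sum_a' phi_coef i k m a' b *
    (integralC `[- a, a] (resolvent_wave two_i_beta (- eta) (x - dcol m) a' b) -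
     (2 * pi)%:C%C * causal_primitive (- eta) H a' b (x - dcol m)).
  rewrite E mxE -sumrB; apply: eq_bigr => m _; rewrite -sumrB; apply: eq_bigr => b _.
  by rewrite -sumrB; apply: eq_bigr => a' _; rewrite -mulrBr.
have Kik : \sum_m \sum_b \sum_a' n1 (phi_coef i k m a' b) <= K.
  have h k' : 0 <= \sum_m \sum_b \sum_a' n1 (phi_coef i k' m a' b).
    by do 3 apply: sumr_ge0 => ? _; exact: n1_ge0.
  apply: (le_trans (ler_sum_term k h)).
  have h2 i' : 0 <= \sum_k \sum_m \sum_b \sum_a' n1 (phi_coef i' k m a' b).
    by do 4 apply: sumr_ge0 => ? _; exact: n1_ge0.
  exact: (ler_sum_term i h2).
apply: (@le_trans _ _ (\sum_m \sum_b \sum_a' n1 (phi_coef i k m a' b) * (e / (K + 1)))).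
  rewrite (le_trans (n1_sum _ _ _))//; apply: ler_sum => m _.
  rewrite (le_trans (n1_sum _ _ _))//; apply: ler_sum => b _.
  rewrite (le_trans (n1_sum _ _ _))//; apply: ler_sum => a' _.
  rewrite (le_trans (n1M _ _))// ler_wpM2l ?n1_ge0//.
  by rewrite (le_trans (heps _ _ _ _ a0))// (le_trans (ler_norm _))// ltW.
have -> : \sum_m \sum_b \sum_a' n1 (phi_coef i k m a' b) * (e / (K + 1)) =
    (\sum_m \sum_b \sum_a' n1 (phi_coef i k m a' b)) * (e / (K + 1)).
  rewrite mulr_suml; apply: eq_bigr => m _; rewrite mulr_suml; apply: eq_bigr => b _.
  by rewrite mulr_suml.
have K1 : 0 < K + 1 by rewrite ltr_wpDl.
rewrite (le_trans (ler_wpM2r _ Kik)) ?divr_ge0 ?(ltW e0) ?(ltW K1)//.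
by rewrite mulrA ler_pdivrMr// mulrC ler_pM2l// lerDl.
Qed.

Definition s_explicit (x : R) : 'M[C]_p := 2 *: (theta1 ^t* *m
  (\matrix_(a, m) (H (Num.max (x - dcol m) 0) *m theta2) a m) *m U).

(** The weights [e^(- c d_m)] and [e^(- c (x - d_m))] multiply to [e^(eta x)], which the prefactor
    cancels together with [2 pi], and [i * (- 2 i) = 2]. For [x <= d_m] both sides vanish by
    [H 0 = 0]. *)
Lemma phi_limit_s x :
  ('i%C / (2 * pi)%:C%C * (expR (- (eta * x)))%:C%C) *: phi_limit x = s_explicit x.
Proof.
apply/matrixP => i k; rewrite !mxE !mulr_sumr; apply: eq_bigr => m _.
rewrite !mxE !(mulr_suml, mulr_sumr).
under [RHS]eq_bigr => a _ do rewrite !mxE !(mulr_suml, mulr_sumr).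
rewrite exchange_big; apply: eq_bigr => a _; rewrite !mulr_sumr; apply: eq_bigr => b _.
have pi0 : (2 * pi)%:C%C != 0 :> C.
  by rewrite eq_complex /= eqxx andbT gt_eqF// mulr_gt0// pi_gt0.
rewrite /phi_coef /causal_primitive !mxE.
have [xd|xd] := leP (x - dcol m) 0; first by rewrite H0 !mxE; ring.
have -> : ((expR (- (eta * x)))%:C%C = (expc (- (- eta)%:C%C * (dcol m)%:C%C) *
   expc (- (- eta)%:C%C * (x - dcol m)%:C%C))^-1 :> C)%R.
  rewrite -expcD -mulrDr -rmorphD addrC subrK /expc.
  rewrite !(ReM, ImM, ReN, ImN) /= !(mulr0, mul0r, oppr0, subr0, add0r, addr0).
  have -> : expi 0 = 1 :> C by rewrite /expi cos0 sin0.
  by rewrite mulr1 -fmorphV -expRN; congr ((expR _)%:C%C); ring.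
have e0 (w : C) : expc w != 0.
  apply/eqP => ew; have := expcD w (- w); rewrite subrr ew mul0r expc0 => /eqP.
  by rewrite oner_eq0.
have ii : 'i%C * 'i%C = -1 :> C by rewrite -expr2 sqr_i.
move: (e0 (- (- eta)%:C%C * (dcol m)%:C%C)) (e0 (- (- eta)%:C%C * (x - dcol m)%:C%C)).
move: (expc _) (expc _) ((2 * pi)%:C%C) pi0 (H _ _ _) => e1 e2 pp pp0 h e10 e20.
transitivity (- ('i%C * 'i%C) * 2 * (theta1 ^t*) i b * h * theta2 a m * U m k); last first.
  by rewrite ii !mxE; ring.
by rewrite !mxE; field; rewrite e10 e20 pp0.
Qed.

End PhiToS.

(** * Continuity of complex functions and membership in L^2 *)

Section ContinuousComplexFunctions.
Variable R : realType.
Local Notation C := R[i].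
Local Notation mu := (@lebesgue_measure R).

(** The pointwise form is needed for an arbitrary [s], whose continuity is given only on the closed
    half-line. *)
Definition contC_at (f : R -> C) (x : R) : Prop :=
  {for x, continuous (fun x => complex.Re (f x))} /\
  {for x, continuous (fun x => complex.Im (f x))}.

Lemma contC_contC_at (f : R -> C) x : contC f -> contC_at f x.
Proof. by move=> [h1 h2]; split; [exact: h1|exact: h2]. Qed.

Lemma contC_atM (f g : R -> C) x : contC_at f x -> contC_at g x -> contC_at (fun x => f x * g x) x.
Proof.
move=> [f1 f2] [g1 g2]; split; rewrite /prop_for /continuous_at.
  under eq_fun do rewrite ReM.
  rewrite ReM; apply: cvgB; apply: cvgM; [exact: f1|exact: g1|exact: f2|exact: g2].
under eq_fun do rewrite ImM.
rewrite ImM; apply: cvgD; apply: cvgM; [exact: f1|exact: g2|exact: f2|exact: g1].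
Qed.

Lemma contC_atB (f g : R -> C) x : contC_at f x -> contC_at g x -> contC_at (fun x => f x - g x) x.
Proof.
move=> [f1 f2] [g1 g2]; split; rewrite /prop_for /continuous_at.
  under eq_fun do rewrite ReD ReN.
  by rewrite ReD ReN; apply: cvgB.
under eq_fun do rewrite ImD ImN.
by rewrite ImD ImN; apply: cvgB.
Qed.

Lemma contC_at_near (f g : R -> C) x :
  (\forall y \near x, f y = g y) -> contC_at f x -> contC_at g x.
Proof.
move=> fg [h1 h2]; have E := nbhs_singleton fg; split; rewrite /prop_for /continuous_at -E.
  by apply: cvg_trans h1; apply: near_eq_cvg; apply: filterS fg => y ->.
by apply: cvg_trans h2; apply: near_eq_cvg; apply: filterS fg => y ->.
Qed.

Lemma contC_comp (f : R -> C) (g : R -> R) : contC f -> continuous g ->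
  contC (fun x => f (g x)).
Proof.
move=> [h1 h2] cg; split => x.
  exact: (@continuous_comp _ _ _ g (fun y => complex.Re (f y)) x (cg x) (h1 (g x))).
exact: (@continuous_comp _ _ _ g (fun y => complex.Im (f y)) x (cg x) (h2 (g x))).
Qed.

Lemma contC_sum (I : Type) (r : seq I) (F : I -> R -> C) :
  (forall i, contC (F i)) -> contC (fun x => \sum_(i <- r) F i x).
Proof.
move=> h; split => x.
  by under eq_fun do rewrite Re_sum; apply: cvg_sumR => i; exact: (h i).1.
by under eq_fun do rewrite Im_sum; apply: cvg_sumR => i; exact: (h i).2.
Qed.

Lemma contC_mulmx m n p (F : R -> 'M[C]_(m, n)) (G : R -> 'M[C]_(n, p)) :
  (forall i j, contC (fun x => F x i j)) -> (forall i j, contC (fun x => G x i j)) ->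
  forall i j, contC (fun x => (F x *m G x) i j).
Proof.
move=> cF cG i j; under eq_fun do rewrite mxE.
by apply: contC_sum => k; exact: contCM.
Qed.

Lemma isdM_contC m n (F : R -> 'M[C]_(m, n)) : (forall x, exists D, isdM F x D) ->
  forall i j, contC (fun x => F x i j).
Proof.
by move=> h i j; apply: isdC_contC => x; have [D hD] := h x; exists (D i j); exact: hD.
Qed.

Lemma isdC_near (f g : R -> C) (x : R) (d : C) :
  (\forall y \near x, f y = g y) -> isdC f x d -> isdC g x d.
Proof.
move=> fg [h1 h2]; split; [apply: near_eq_is_derive h1|apply: near_eq_is_derive h2];
  by apply: filterS fg => y ->.
Qed.

Lemma max0_continuous (d : R) : continuous (fun x : R => Num.max (x - d) 0).
Proof.
move=> v; apply: (@continuous_max _ _ (fun x => x - d) (cst 0)); last exact: cvg_cst.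
by apply: cvgB; [exact: cvg_id|exact: cvg_cst].
Qed.

Lemma contC_in_L2 m n (F : R -> 'M[C]_(m, n)) (l : R) :
  (forall i j, contC (fun x => F x i j)) -> in_L2 l F.
Proof.
move=> cF i j; have [h1 h2] := cF i j; split.
- by apply: measurable_funTS; exact: continuous_measurable_fun.
- by apply: measurable_funTS; exact: continuous_measurable_fun.
rewrite /sqr_normL2.
have cN : continuous (fun x => complex.Re (F x i j) ^+ 2 + complex.Im (F x i j) ^+ 2).
  by move=> x; apply: cvgD; rewrite expr2; under eq_fun do rewrite expr2;
    apply: cvgM; first [exact: h1|exact: h2].
have iN : mu.-integrable `]0, l[ (EFin \o (fun x => complex.Re (F x i j) ^+ 2 + complex.Im (F x i j) ^+ 2)).
  apply: integrableS (continuous_integrable_itv 0 l cN) => //.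
  exact: subset_itv_oo_cc.
under eq_integral do rewrite normc2E.
rewrite -ge0_fin_numE; last by apply: integral_ge0 => x _; rewrite lee_fin addr_ge0// sqr_ge0.
exact: integrable_fin_num.
Qed.

Lemma ereal_cvg0 (u : R -> \bar R) : (forall a, (0 <= u a)%E) ->
  (forall e : R, 0 < e -> \forall a \near +oo, (u a <= e%:E)%E) ->
  u a @[a --> +oo] --> 0%E.
Proof.
move=> u0 h; apply/fine_cvgP; split.
  by apply: filterS (h 1 ltr01) => a ua; rewrite ge0_fin_numE// (le_lt_trans ua)// ltry.
apply/cvgrPdist_le => e e0; apply: filterS (h e e0) => a ua.
rewrite sub0r normrN /= ger0_norm ?fine_ge0//.
by rewrite -lee_fin fineK// ge0_fin_numE// (le_lt_trans ua)// ltry.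
Qed.

Lemma sqr_normL2_ge0 l (f : R -> C) : (0 <= sqr_normL2 l f)%E.
Proof. by apply: integral_ge0 => x _; rewrite lee_fin sqr_ge0. Qed.

End ContinuousComplexFunctions.

(** * Identification of [s] and of its derivative *)

Section ExplicitS.
Variable R : realType.
Local Notation C := R[i].
Local Notation mu := (@lebesgue_measure R).
Variables (n kappa : nat) (q : 'I_kappa -> nat).
Local Notation p := (\sum_j q j)%N.
Variables (theta1 theta2 : 'M[C]_(n, p)) (beta : 'M[C]_n) (dt : 'I_kappa -> R).
Variables (U : 'M[C]_p) (M eta : R).
Hypotheses (M_gt0 : 0 < M) (eta_lt : eta < - (2 * M)).
Hypothesis spec_beta : forall a : C,
  eigenvalue (beta + ('i%C * M%:C%C)%:M) a -> 0 < complex.Im a.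
Variable H : R -> 'M[C]_n.
Local Notation B := (two_i_beta beta).
Hypotheses (H0 : H 0 = 0) (dH : forall x, isdM H x (expxA B x)).

Local Notation s0 := (s_explicit theta1 theta2 dt U H).
Local Notation dcol := (@dcol R kappa q dt).

Let contC_H a b : contC (fun x => H x a b).
Proof. by apply: isdM_contC => x; eexists; exact: dH. Qed.

Lemma contC_phi_limit i k :
  contC (fun x => phi_limit theta1 theta2 dt U eta H x i k).
Proof.
under eq_fun do rewrite mxE.
apply: contC_sum => m; apply: contC_sum => b; apply: contC_sum => a.
apply: contCM; first exact: contC_cst.
apply: contCM; first exact: contC_cst.
apply: (@contC_comp _ (fun v => expc (- (- eta)%:C%C * v%:C%C) * H v a b)
  (fun x => Num.max (x - dcol m) 0)); last exact: max0_continuous.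
apply: contCM => //; apply: isdC_contC => x; eexists; exact: isdC_expc.
Qed.

Lemma contC_s0 i k : contC (fun x => s0 x i k).
Proof.
rewrite /s_explicit; under eq_fun do rewrite mxE.
apply: contCM; first exact: contC_cst.
apply: contC_mulmx => [a b|? ?]; last exact: contC_cst.
apply: contC_mulmx => [? ?|{}a m]; first exact: contC_cst.
under eq_fun do rewrite mxE.
apply: contC_mulmx => [c d|? ?]; last exact: contC_cst.
exact: (contC_comp (contC_H c d) (max0_continuous (d := dcol m))).
Qed.

Lemma phi_limit_in_mean : is_lim_in_mean
  (phi_integral theta1 theta2 beta dt U eta) (phi_limit theta1 theta2 dt U eta H).
Proof.
move=> l l0; split; first exact/contC_in_L2/contC_phi_limit.
move=> i k; apply: ereal_cvg0 => [a|e e0]; first exact: sqr_normL2_ge0.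
have e'0 : 0 < Num.sqrt (e / l) by rewrite sqrtr_gt0 divr_gt0.
have := phi_integral_cvg theta1 theta2 dt U M_gt0 eta_lt spec_beta H0 dH e'0.
apply: filterS => a ha.
rewrite (le_trans (sqr_normL2_le (e := Num.sqrt (e / l)) (ltW l0) _))//.
have el : 0 <= e / l := ltW (divr_gt0 e0 l0).
by rewrite lee_fin sqr_sqrtr// divfK// gt_eqF.
Qed.

Lemma is_s_explicit : is_s (phi theta1 theta2 beta dt U) eta s0.
Proof.
split=> [i k|].
  have [h1 h2] := contC_s0 i k.
  by split; exact: continuous_subspaceT.
exists (phi_limit theta1 theta2 dt U eta H); split; first exact: phi_limit_in_mean.
by move=> x _; rewrite phi_limit_s.
Qed.

(** On the half-line the limit in mean [L] is [s] times a smooth weight, hence continuous at every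
    [x0 > 0]. There it must agree with the uniform limit of the truncated integrals. *)
Lemma is_s_unique s : is_s (phi theta1 theta2 beta dt U) eta s ->
  forall x, 0 < x -> s x = s0 x.
Proof.
move=> [cs [L [hL sE]]] x0 x0_gt0.
suff LE : L x0 = phi_limit theta1 theta2 dt U eta H x0.
  by rewrite sE ?ltW// LE phi_limit_s.
apply/matrixP => i k.
have l0 : 0 < x0 + 1 by rewrite addr_gt0.
have [_ /(_ i k) hLik] := hL _ l0.
(* The inverse of the prefactor [i / (2 pi) e^(- eta x)]. *)
pose w x : C := - (2 * pi)%:C%C * 'i%C * (expR (eta * x))%:C%C.
have LsE x : 0 <= x -> L x i k = w x * s x i k.
  move=> xx0; rewrite sE// mxE mulrA -[LHS]mul1r; congr (_ * _).
  have pi0 : (2 * pi)%:C%C != 0 :> C.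
    by rewrite eq_complex /= eqxx andbT gt_eqF// mulr_gt0// pi_gt0.
  have ii : 'i%C * 'i%C = -1 :> C by rewrite -expr2 sqr_i.
  have ee : (expR (eta * x))%:C%C * (expR (- (eta * x)))%:C%C = 1 :> C.
    by rewrite -rmorphM -expRD subrr expR0.
  transitivity (- ('i%C * 'i%C) * ((expR (eta * x))%:C%C * (expR (- (eta * x)))%:C%C) : C).
    by rewrite ii ee; ring.
  rewrite /w; move: pi0; set c : C := (2 * pi)%:C%C; move: c => c c0.
  by field.
have [/continuous_within_itvcyP[c1 _] /continuous_within_itvcyP[c2 _]] := cs i k.
have x0in : x0 \in `]0, +oo[ by rewrite in_itv/= andbT.
have cs_at : contC_at (fun x => s x i k) x0 by split; [exact: c1|exact: c2].
have cw : contC w.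
  apply: contCM; first exact: contC_cst.
  split; last by move=> y; exact: cvg_cst.
  exact: (is_derive_continuous (is_derive_expRM eta)).
have cL : contC_at (fun x => L x i k) x0.
  apply: contC_at_near (contC_atM (contC_contC_at x0 cw) cs_at).
  have : \forall y \near x0, 0 < y by exact: lt_nbhsr.
  by apply: filterS => y y0; rewrite LsE// ltW.
have [cd1 cd2] := contC_atB cL (contC_contC_at x0 (contC_phi_limit i k)).
apply: (mean_square_limit_unique hLik _ cd1 cd2).
  move=> e e0.
  have := phi_integral_cvg theta1 theta2 dt U M_gt0 eta_lt spec_beta H0 dH e0.
  by apply: filterS => a ha x _; exact: ha.
by rewrite x0_gt0 ltrDl ltr01.
Qed.

(** The strict inequality fixes a value at the jumps [x = d_m], where it need not be the derivative
    of [s]; comparisons with that derivative exclude these points. *)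
Definition k_explicit (x : R) : 'M[C]_p := 2 *: (theta1 ^t* *m
  (\matrix_(a, m) (if dcol m < x then (expxA B (x - dcol m) *m theta2) a m else 0)) *m U).

Lemma isdM_s_explicit x : (forall m, x != dcol m) -> isdM s0 x (k_explicit x).
Proof.
move=> xd; apply/isdM_scalel/isdM_mulmxr/isdM_mulmxl => a m.
rewrite [X in isdC _ _ X]mxE; have [xm|mx] := ltP (dcol m) x.
  have : isdM (fun y => H (1 * y + - dcol m) *m theta2) x (1%:C%C *: expxA B (x - dcol m) *m theta2).
    by apply: isdM_mulmxr; apply: isdM_comp_affine; rewrite mul1r; exact: dH.
  rewrite scale1r => /(_ a m); apply: isdC_near.
  have : \forall y \near x, dcol m < y by exact: lt_nbhsr.
  by apply: filterS => y ym; rewrite mul1r [RHS]mxE max_l// subr_ge0 ltW.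
have {}mx : x < dcol m by rewrite lt_neqAle xd mx.
apply: isdC_near (isdC_cst 0 x).
have : \forall y \near x, y < dcol m by exact: lt_nbhsl.
apply: filterS => y ym; rewrite [RHS]mxE max_r ?subr_le0 ?ltW//.
by rewrite H0 mul0mx mxE.
Qed.

(** Splitting [E (x - d_m)] as [E x] times [E (- d_m)] moves the delays into [nu], so the columns
    interact with [x] only through a diagonal projection. *)
Lemma k_explicitE x : k_explicit x = 2 *: (theta1 ^t* *m expxA B x *m
  nu theta2 beta dt *m diag_mx (\row_m (dcol m < x)%R%:R) *m U).
Proof.
congr (_ *: (_ *m _)); rewrite -!mulmxA; congr (_ *m _).
apply/matrixP => a m; rewrite mulmxA mul_mx_diag mxE [RHS]mxE [X in _ = _ * X]mxE.
have E : (expxA B x *m nu theta2 beta dt) a m = (expxA B (x - dcol m) *m theta2) a m.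
  rewrite expxAD -mulmxA !mxE; apply: eq_bigr => b _; congr (_ * _).
  by rewrite nuE.
rewrite E; by case: ifP => _; rewrite ?mulr1// mulr0.
Qed.

Lemma is_s_derive s x : is_s (phi theta1 theta2 beta dt U) eta s -> 0 < x ->
  (forall m, x != dcol m) -> isdM s x (k_explicit x).
Proof.
move=> hs x0 xd i k; apply: isdC_near (isdM_s_explicit xd i k).
have : \forall y \near x, 0 < y by exact: lt_nbhsr.
by apply: filterS => y y0; rewrite (is_s_unique hs).
Qed.

Lemma isdM_derivmx (F : R -> 'M[C]_p) x D : isdM F x D -> derivmx F x = D.
Proof.
move=> h; apply/matrixP => i j; rewrite mxE; have [[_ h1] [_ h2]] := h i j.
by apply: complexP => /=; rewrite derive1E.
Qed.

Lemma is_s_derivmx s x : is_s (phi theta1 theta2 beta dt U) eta s -> 0 < x ->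
  (forall m, x != dcol m) -> derivmx s x = k_explicit x.
Proof. by move=> hs x0 xd; apply: isdM_derivmx; exact: is_s_derive. Qed.

End ExplicitS.

(** * Bounded measurable functions and square integrability *)

Section BoundedMeasurable.
Variable R : realType.
Local Notation C := R[i].
Local Notation mu := (@lebesgue_measure R).

Lemma Re_if (b : bool) (x y : C) :
  complex.Re (if b then x else y) =
  if b then complex.Re x else complex.Re y.
Proof. by case: b. Qed.

Lemma Im_if (b : bool) (x y : C) :
  complex.Im (if b then x else y) =
  if b then complex.Im x else complex.Im y.
Proof. by case: b. Qed.

(* The derivative of [s] is a junk value at the finitely many jumps of [k], so
   identities between kernels hold only off finite sets. *)
Lemma measurable_fun_eq_off_finite (N D : set R) (f g : R -> R) : finite_set N ->
  measurable D -> measurable_fun D g -> (forall x, D x -> ~ N x -> f x = g x) ->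
  measurable_fun D f.
Proof.
move=> fN mD mg fg.
have mfin (A : set R) : finite_set A -> measurable A.
  move=> fA; apply: countable_measurable; last exact: finite_set_countable.
  by move=> t; exact: measurable_set1.
have mN := mfin N fN.
have -> : D = (D `&` N) `|` (D `\` N) by rewrite setUIDK.
apply/measurable_funU; [exact: measurableI|exact: measurableD|split].
  move=> _ Y mY; apply: mfin; apply: sub_finite_set fN.
  by move=> x [[]].
apply: (eq_measurable_fun g).
  by move=> x /set_mem[Dx Nx]; rewrite fg.
by apply: measurable_funS mg => // x [].
Qed.

Lemma Rintegral_eq_off_finite (N D : set R) (f g : R -> R) : finite_set N ->
  measurable D -> measurable_fun D g -> (forall x, D x -> ~ N x -> f x = g x) ->
  \int[mu]_(x in D) f x = \int[mu]_(x in D) g x.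
Proof.
move=> fN mD mg fg; congr fine; apply: ae_eq_integral => //.
- by apply/measurable_EFinP; exact: measurable_fun_eq_off_finite fg.
- exact/measurable_EFinP.
exists N; split.
- apply: countable_measurable; last exact: finite_set_countable.
  by move=> t; exact: measurable_set1.
- by apply: countable_lebesgue_measure0; exact: finite_set_countable.
by move=> x /= /not_implyP[Dx fgx]; apply: contrapT => Nx; apply: fgx; rewrite fg.
Qed.

Lemma integralC_eq_off_finite (N D : set R) (f g : R -> C) : finite_set N ->
  measurable D -> measurable_fun D (fun x => complex.Re (g x)) ->
  measurable_fun D (fun x => complex.Im (g x)) ->
  (forall x, D x -> ~ N x -> f x = g x) -> integralC D f = integralC D g.
Proof.
move=> fN mD m1 m2 fg; rewrite /integralC.
by congr Complex; apply: Rintegral_eq_off_finite fN mD _ _ => // x Dx Nx; rewrite fg.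
Qed.

Variable l : R.

(** A class that contains the derivative of [s] and the factors of [K], is stable under the
    operations used to build them, and multiplies L^2 functions on the bounded interval into
    integrable ones. *)
Definition bmeasC (f : R -> C) : Prop :=
  [/\ measurable_fun `]0, l[ (fun x => complex.Re (f x)),
      measurable_fun `]0, l[ (fun x => complex.Im (f x)) &
      exists c, forall x, 0 < x < l -> n1 (f x) <= c].

Lemma bmeasC_cont f : contC f -> bmeasC f.
Proof.
move=> [h1 h2]; split.
- by apply: measurable_funTS; exact: continuous_measurable_fun.
- by apply: measurable_funTS; exact: continuous_measurable_fun.
have [l0|l0] := leP l 0.
  by exists 0 => x /andP[x0 xl]; have := lt_trans x0 xl; rewrite ltNge l0.
have cn : {within `[0, l], continuous (fun x => n1 (f x))}.
  apply: continuous_subspaceT => x; apply: cvgD; apply: cvg_norm; [exact: h1|exact: h2].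
have [c _ hc] := EVT_max (ltW l0) cn.
by exists (n1 (f c)) => x /andP[x0 xl]; apply: hc; rewrite in_itv/= !ltW.
Qed.

Lemma bmeasC_eq f g : (forall x, 0 < x < l -> f x = g x) -> bmeasC g -> bmeasC f.
Proof.
move=> fg [m1 m2 [c hc]]; split.
- by apply: eq_measurable_fun m1 => x; rewrite inE/= in_itv/= => /fg ->.
- by apply: eq_measurable_fun m2 => x; rewrite inE/= in_itv/= => /fg ->.
by exists c => x xl; rewrite fg// hc.
Qed.

Lemma bmeasC_step (d : R) f : bmeasC f -> bmeasC (fun x => if d < x then f x else 0).
Proof.
move=> [m1 m2 [c hc]].
have mb : measurable_fun `]0, l[ (fun x : R => d < x).
  by apply: measurable_fun_ltr => //; exact: measurable_id.
split.
- under [X in measurable_fun _ X]eq_fun do rewrite Re_if.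
  apply: measurable_fun_if => //.
  by apply: measurable_funS m1 => // x [].
- under [X in measurable_fun _ X]eq_fun do rewrite Im_if.
  apply: measurable_fun_if => //.
  by apply: measurable_funS m2 => // x [].
exists `|c| => x xl; case: ifP => _; last by rewrite n1_0.
exact: le_trans (hc x xl) (ler_norm _).
Qed.

Lemma bmeasCD f g : bmeasC f -> bmeasC g -> bmeasC (fun x => f x + g x).
Proof.
move=> [f1 f2 [c hc]] [g1 g2 [d hd]]; split.
- by under [X in measurable_fun _ X]eq_fun do rewrite ReD; exact: measurable_funD.
- by under [X in measurable_fun _ X]eq_fun do rewrite ImD; exact: measurable_funD.
by exists (c + d) => x xl; apply: (le_trans (n1D _ _)); rewrite lerD ?hc ?hd.
Qed.

Lemma bmeasCM f g : bmeasC f -> bmeasC g -> bmeasC (fun x => f x * g x).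
Proof.
move=> [f1 f2 [c hc]] [g1 g2 [d hd]]; split.
- by under [X in measurable_fun _ X]eq_fun do rewrite ReM; apply: measurable_funB; exact: measurable_funM.
- by under [X in measurable_fun _ X]eq_fun do rewrite ImM; apply: measurable_funD; exact: measurable_funM.
exists (c * d) => x xl; apply: (le_trans (n1M _ _)).
by rewrite ler_pM ?n1_ge0 ?hc ?hd.
Qed.

Lemma bmeasC_sum (I : Type) (r : seq I) (F : I -> R -> C) :
  (forall i, bmeasC (F i)) -> bmeasC (fun x => \sum_(i <- r) F i x).
Proof.
move=> h; elim: r => [|i r IH].
  by under eq_fun do rewrite big_nil; exact/bmeasC_cont/contC_cst.
by under eq_fun do rewrite big_cons; exact: bmeasCD.
Qed.

Lemma bmeasC_conj f : bmeasC f -> bmeasC (fun x => conjc (f x)).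
Proof.
move=> [m1 m2 [c hc]]; split.
- by under [X in measurable_fun _ X]eq_fun do rewrite Re_conj.
- by under [X in measurable_fun _ X]eq_fun do rewrite Im_conj; exact: measurable_funN.
by exists c => x xl; rewrite /n1 Re_conj Im_conj normrN; exact: hc.
Qed.

Lemma bmeasC_eq_off_finite (N : set R) f g : finite_set N ->
  (forall x, 0 < x < l -> ~ N x -> f x = g x) -> bmeasC g -> bmeasC f.
Proof.
move=> fN fg [m1 m2 [c hc]]; split.
- by apply: (measurable_fun_eq_off_finite fN) m1 _ => // x; rewrite /= in_itv/= => xl Nx; rewrite fg.
- by apply: (measurable_fun_eq_off_finite fN) m2 _ => // x; rewrite /= in_itv/= => xl Nx; rewrite fg.
have [s sN] : exists s : seq R, N = [set` s] by exact/finite_seqP.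
(* Whatever the values at the exceptional points are, there are finitely many of them, and their sum
   is added to the bound. *)
exists (`|c| + \sum_(y <- s) n1 (f y)) => x xl.
have [Nx|Nx] := pselect (N x).
  apply: ler_wpDl; first exact: normr_ge0.
  have xs : x \in s by move: Nx; rewrite sN.
  by rewrite (big_rem x xs)/= lerDl sumr_ge0// => y _; exact: n1_ge0.
rewrite fg//; apply: ler_wpDr; first by apply: sumr_ge0 => y _; exact: n1_ge0.
exact: le_trans (hc x xl) (ler_norm _).
Qed.

Lemma bmeasC_L2 f : 0 <= l -> bmeasC f -> (sqr_normL2 l f < +oo)%E.
Proof.
by move=> l0 [_ _ [c hc]]; apply: le_lt_trans (sqr_normL2_le l0 hc) _; rewrite ltry.
Qed.

End BoundedMeasurable.

(** * Square integrable functions and their primitives *)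

Section SquareIntegrable.
Variable R : realType.
Local Notation C := R[i].
Local Notation mu := (@lebesgue_measure R).
Variable l : R.

Lemma in_L2P m n (F : R -> 'M[C]_(m, n)) : in_L2 l F <-> forall i j,
  [/\ measurable_fun `]0, l[ (fun x => complex.Re (F x i j)),
      measurable_fun `]0, l[ (fun x => complex.Im (F x i j)) &
      mu.-integrable `]0, l[ (fun x => (Normc.normc (F x i j) ^+ 2)%:E)].
Proof.
have mn i j : measurable_fun `]0, l[ (fun x => complex.Re (F x i j)) ->
    measurable_fun `]0, l[ (fun x => complex.Im (F x i j)) ->
    measurable_fun `]0, l[ (fun x => Normc.normc (F x i j) ^+ 2).
  move=> m1 m2; under [X in measurable_fun _ X]eq_fun do rewrite normc2E !expr2.
  by apply: measurable_funD; exact: measurable_funM.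
have nE i j : (\int[mu]_(x in `]0%R, l[) `|(Normc.normc (F x i j) ^+ 2)%:E| = sqr_normL2 l (fun x => F x i j))%E.
  by apply: eq_integral => x _; rewrite gee0_abs// lee_fin sqr_ge0.
split=> h i j; have [m1 m2 h3] := h i j; split=> //.
  by apply/integrableP; split; [apply/measurable_EFinP; exact: mn|rewrite nE].
by have /integrableP[_] := h3; rewrite nE.
Qed.

(** From [|y| <= 1 + y^2] and the finite measure of the interval. *)
Lemma L2_bmeasC_intC (f g : R -> C) :
  measurable_fun `]0, l[ (fun x => complex.Re (f x)) ->
  measurable_fun `]0, l[ (fun x => complex.Im (f x)) ->
  mu.-integrable `]0, l[ (fun x => (Normc.normc (f x) ^+ 2)%:E) -> bmeasC l g ->
  intC `]0, l[ (fun x => g x * f x).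
Proof.
move=> m1 m2 hf [g1 g2 [c hc]].
have hi : mu.-integrable `]0, l[ (fun x => (`|c|%:E * (2%:E + (Normc.normc (f x) ^+ 2)%:E))%E).
  apply: integrableZl => //; apply: integrableD => //.
  have c2 : continuous (cst 2 : R -> R) by move=> x; exact: cvg_cst.
  apply: integrableS (continuous_integrable_itv 0 l c2) => //; exact: subset_itv_oo_cc.
have bound x : 0 < x < l -> n1 (g x * f x) <= `|c| * (2 + Normc.normc (f x) ^+ 2).
  move=> xl; apply: (le_trans (n1M _ _)); rewrite ler_pM ?n1_ge0//.
    exact: le_trans (hc x xl) (ler_norm _).
  rewrite normc2E /n1.
  have h (y : R) : `|y| <= 1 + y ^+ 2.
    by rewrite -[y ^+ 2]real_normK ?num_real//; have := sqr_ge0 (`|y| - 1); nra.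
  by have := h (complex.Re (f x)); have := h (complex.Im (f x)); lra.
split; apply: le_integrable hi => //.
- apply/measurable_EFinP; under [X in measurable_fun _ X]eq_fun do rewrite ReM.
  by apply: measurable_funB; exact: measurable_funM.
- move=> x /=; rewrite in_itv/= => /bound hx.
  rewrite lee_fin; apply: (le_trans (Re_le_n1 _)).
  exact: le_trans hx (ler_norm _).
- apply/measurable_EFinP; under [X in measurable_fun _ X]eq_fun do rewrite ImM.
  by apply: measurable_funD; exact: measurable_funM.
- move=> x /=; rewrite in_itv/= => /bound hx.
  rewrite lee_fin; apply: (le_trans (Im_le_n1 _)).
  exact: le_trans hx (ler_norm _).
Qed.

(** The primitive is continuous on [[0, l]], hence measurable, and bounded by the L^1 norm of [g].
    The upper limit is written as a cut-off inside a fixed domain, the form in which it arises when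
    [K] is split at [t = x]. *)
Lemma Rintegral_primitive (g : R -> R) : 0 <= l ->
  mu.-integrable `]0, l[ (fun x => (g x)%:E) ->
  let G x := \int[mu]_(t in `]0, l[) (if t <= x then g t else 0) in
  measurable_fun `]0, l[ G /\ exists c, forall x, 0 < x < l -> `|G x| <= c.
Proof.
move=> l0 hg G.
pose g0 := g \_ `]0, l[.
have hg0 : mu.-integrable setT (EFin \o g0).
  by rewrite /g0 -restrict_EFin; apply/integrable_restrict => //=; rewrite setTI.
have hg0l : mu.-integrable `[0, l] (EFin \o g0).
  by apply: integrableS hg0.
have GE x : 0 < x < l -> G x = \int[mu]_(t in `[0, x]) g0 t.
  move=> /andP[x0 xl]; rewrite /G [LHS]Rintegral_mkcond [RHS]Rintegral_mkcond.
  congr Rintegral; apply/funext => t; rewrite /g0 !patchE.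
  case: ifPn => [/set_mem|/negP tl]; last first.
    case: ifPn => // _; case: ifPn => // h; by case: tl.
  rewrite /= in_itv/= => /andP[t0 tl].
  case: ifPn => tx.
    by rewrite mem_set ?mem_set//= in_itv/= ?t0// ltW.
  rewrite memNset//= in_itv/= => /andP[_ tx']; by rewrite tx' in tx.
split.
  have /subspace_continuous_measurable_fun h := parameterized_integral_continuous l0 hg0l.
  have hm : measurable_fun `]0, l[ (fun x => \int[mu]_(t in `[0, x]) g0 t).
    apply: measurable_funS (h _) => //; exact: subset_itv_oo_cc.
  by apply: eq_measurable_fun hm => x; rewrite inE/= in_itv/= => /GE ->.
exists (fine (\int[mu]_(t in `]0%R, l[) `|(g t)%:E|)%E) => x /GE ->.
have hx : mu.-integrable `[0, x] (EFin \o g0) by apply: integrableS hg0.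
rewrite (le_trans (le_normr_Rintegral _ hx))//.
rewrite fine_le//.
- by apply: integrable_fin_num => //; exact: integrable_norm hx.
- by apply: integrable_fin_num => //; exact: integrable_norm hg.
rewrite [leLHS]integral_mkcond [leRHS]integral_mkcond.
by apply: le_ge0_integral => t _; rewrite /g0 !patchE /=; case: ifPn => _ //;
  case: ifPn => _ //=; rewrite lee_fin ?normr0.
Qed.

Lemma bmeasC_primitive (g : R -> C) : 0 <= l -> intC `]0, l[ g ->
  bmeasC l (fun x => integralC `]0, l[ (fun t => if t <= x then g t else 0)).
Proof.
move=> l0 [h1 h2].
have [m1 [c1 hc1]] := Rintegral_primitive l0 h1.
have [m2 [c2 hc2]] := Rintegral_primitive l0 h2.
pose I x := integralC `]0, l[ (fun t => if t <= x then g t else 0).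
have ReI x : complex.Re (I x) = \int[mu]_(t in `]0, l[) (if t <= x then complex.Re (g t) else 0).
  by apply: eq_Rintegral => t _; rewrite Re_if.
have ImI x : complex.Im (I x) = \int[mu]_(t in `]0, l[) (if t <= x then complex.Im (g t) else 0).
  by apply: eq_Rintegral => t _; rewrite Im_if.
split.
- by rewrite (funext ReI).
- by rewrite (funext ImI).
by exists (c1 + c2) => x xl; rewrite -/(I x) /n1 ReI ImI lerD ?hc1 ?hc2.
Qed.

Lemma in_L2D_bmeasC m n (F G : R -> 'M[C]_(m, n)) : in_L2 l F ->
  (forall i j, bmeasC l (fun x => G x i j)) -> in_L2 l (fun x => F x + G x).
Proof.
move=> /in_L2P hF hG i j; have [m1 m2 hi] := hF i j; have [g1 g2 [c hc]] := hG i j.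
have E x : (F x + G x) i j = F x i j + G x i j by rewrite mxE.
split.
- by under [X in measurable_fun _ X]eq_fun do rewrite E ReD; exact: measurable_funD.
- by under [X in measurable_fun _ X]eq_fun do rewrite E ImD; exact: measurable_funD.
pose h x := (2%:E * (Normc.normc (F x i j) ^+ 2)%:E + (2 * c ^+ 2)%:E)%E.
have hh : mu.-integrable `]0, l[ h.
  apply: integrableD => //; first exact: integrableZl.
  have c2 : continuous (cst (2 * c ^+ 2) : R -> R) by move=> x; exact: cvg_cst.
  apply: integrableS (continuous_integrable_itv 0 l c2) => //; exact: subset_itv_oo_cc.
apply: (@le_lt_trans _ _ (\int[mu]_(x in `]0%R, l[) h x)%E).
  apply: le_ge0_integral => x; first by rewrite lee_fin sqr_ge0.
  rewrite /= in_itv/= => xl; rewrite E /h -EFinM -EFinD lee_fin !normc2E ReD ImD.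
  have := hc x xl; rewrite /n1.
  move: (complex.Re (F _ _ _)) (complex.Im (F _ _ _)) (complex.Re _) (complex.Im _) => a b u v uv.
  have h1 : u ^+ 2 + v ^+ 2 <= c ^+ 2.
    rewrite -[u ^+ 2]real_normK ?num_real// -[v ^+ 2]real_normK ?num_real//.
    have := normr_ge0 u; have := normr_ge0 v; nra.
  by have := sqr_ge0 (a - u); have := sqr_ge0 (b - v); nra.
rewrite -ge0_fin_numE; first exact: integrable_fin_num.
by apply: integral_ge0 => x _; rewrite /h -EFinM -EFinD lee_fin addr_ge0// mulr_ge0// sqr_ge0.
Qed.

End SquareIntegrable.

(** * The kernel *)

Section StepIntegral.
Variable R : realType.
Local Notation C := R[i].
Local Notation mu := (@lebesgue_measure R).
Implicit Types (a b c : R).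

Lemma integrable_step (f : R -> R) a b c : continuous f ->
  mu.-integrable `[a, b] (fun r => (if c < r then f r else 0)%:E).
Proof.
move=> cf; have := continuous_integrable_itv a b cf.
apply: le_integrable => //.
  apply/measurable_EFinP; apply: measurable_fun_if => //.
    by apply: measurable_fun_ltr => //; exact: measurable_id.
  by apply: measurable_funTS; exact: continuous_measurable_fun.
by move=> r _; rewrite lee_fin; case: ifP => //; rewrite normr0.
Qed.

Lemma Rintegral_step (f F : R -> R) a b c : a <= c -> continuous f ->
  (forall x : R, is_derive x 1 F (f x)) ->
  \int[mu]_(r in `[a, b]) (if c < r then f r else 0) = if c < b then F b - F c else 0.
Proof.
move=> ac cf dF; have [cb|bc] := ltP c b.
  rewrite -(Rintegral_is_derive (ltW cb) cf dF) -(@Rintegral_itv_obnd_cbnd R c (BRight b) f); last first.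
    by apply: integrableS (continuous_integrable_itv c b cf) => //; exact: subset_itv_oc_cc.
  rewrite [LHS]Rintegral_mkcond [RHS]Rintegral_mkcond.
  congr Rintegral; apply/funext => r; rewrite !patchE.
  have [cr|rc] := ltP c r.
    have [rb|br] := leP r b.
      by rewrite !mem_set//= in_itv/= ?cr ?rb// (le_trans ac (ltW cr)).
    by rewrite !memNset//= in_itv/= => /andP[_]; rewrite leNgt br.
  rewrite [RHS]ifN; first by rewrite if_same.
  by rewrite memNset//= in_itv/= => /andP[]; rewrite ltNge rc.
rewrite /Rintegral integral0_eq// => r.
by rewrite /= in_itv/= => /andP[_ rb]; rewrite ltNge (le_trans rb bc).
Qed.

Lemma intC_step (f : R -> C) a b c : contC f -> intC `[a, b] (fun r => if c < r then f r else 0).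
Proof.
move=> [h1 h2]; split.
  by under [X in _.-integrable _ X]eq_fun do rewrite Re_if; exact: integrable_step.
by under [X in _.-integrable _ X]eq_fun do rewrite Im_if; exact: integrable_step.
Qed.

Lemma integralC_step (f F : R -> C) a b c : a <= c -> contC f ->
  (forall x, isdC F x (f x)) ->
  integralC `[a, b] (fun r => if c < r then f r else 0) = if c < b then F b - F c else 0.
Proof.
move=> ac [h1 h2] dF; apply: complexP.
  rewrite Re_if ReD ReN -(Rintegral_step b ac h1 (fun x => (dF x).1)).
  by apply: eq_Rintegral => r _; rewrite Re_if.
rewrite Im_if ImD ImN -(Rintegral_step b ac h2 (fun x => (dF x).2)).
by apply: eq_Rintegral => r _; rewrite Im_if.
Qed.

End StepIntegral.

Section KernelFormula.
Variable R : realType.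
Local Notation C := R[i].
Local Notation mu := (@lebesgue_measure R).
Variables (n kappa : nat) (q : 'I_kappa -> nat).
Local Notation p := (\sum_j q j)%N.
Variables (theta1 theta2 : 'M[C]_(n, p)) (beta : 'M[C]_n) (dt : 'I_kappa -> R).
Variables (U : 'M[C]_p) (M eta : R).
Hypotheses (M_gt0 : 0 < M) (eta_lt : eta < - (2 * M)).
Hypothesis spec_beta : forall a : C,
  eigenvalue (beta + ('i%C * M%:C%C)%:M) a -> 0 < complex.Im a.
Hypotheses (U_unitary : U \is unitarymx) (dt_ge0 : forall j, 0 <= dt j).
Variable X : 'I_kappa -> 'M[C]_n.
Hypothesis hX : forall j, solves_identity theta2 beta dt j (X j).
Variable s : R -> 'M[C]_p.
Hypothesis hs : is_s (phi theta1 theta2 beta dt U) eta s.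
Local Notation B := (two_i_beta beta).
Local Notation dcol := (@dcol R kappa q dt).
Local Notation k0 := (k_explicit theta1 theta2 beta dt U).
Local Notation Q := (Qmx theta2 beta dt).

Definition conj_flow (Y : 'M[C]_n) (v : R) : 'M[C]_n :=
  expxA B v *m Y *m (expxA B v) ^t*.

(** The derivative brings out [B X_j] plus [X_j] times the adjoint of [B], which is twice the left
    side of the identity for [X_j]. *)
Lemma isdM_conj_flow j v : isdM (conj_flow (X j)) v (2 *: conj_flow (Q j) v).
Proof.
have dE := isdM_expxA B v.
apply: isdM_eq; first exact: isdMM (isdM_mulmxr (X j) dE) (isdM_trmxC dE).
rewrite -expxA_comm trmxC_mul -(hX j) /conj_flow.
have -> : B ^t* = - (2 * 'i%C) *: beta ^t*.
  apply/matrixP => a b; rewrite !mxE rmorphM /=; congr (_ * _).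
  by apply: complexP; rewrite !(ReM, ImM, ReN, ImN, Re_conj, Im_conj) /=; ring.
have -> : 2 *: (expxA B v *m ('i%C *: (beta *m X j - X j *m beta ^t*)) *m (expxA B v) ^t*) =
    expxA B v *m (B *m X j + X j *m (- (2 * 'i%C) *: beta ^t*)) *m (expxA B v) ^t*.
  rewrite -scalemxAl -scalemxAr scaleNr mulmxN -scalemxAl -scalemxAr -scalerBr.
  by rewrite -scalemxAr -[in RHS]scalemxAl scalerA.
by rewrite mulmxDr mulmxDl !mulmxA.
Qed.

(** [U] cancels against its adjoint. Since [v <= u], the column projections at [u] and [v] multiply
    to the one at [v], which is the sum of the [P_j] with [dt j < v]; finally [E u] is split as
    [E (u - v)] times [E v]. *)
Lemma k_explicit_mul (u v : R) : v <= u ->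
  k0 u *m (k0 v) ^t* = \sum_j (if dt j < v then
    4 *: (theta1 ^t* *m expxA B (u - v) *m conj_flow (Q j) v *m theta1) else 0).
Proof.
move=> vu; rewrite !k_explicitE.
pose chi (v : R) : 'M[C]_p := diag_mx (\row_m (dcol m < v)%R%:R).
have chiC : (chi v) ^t* = chi v.
  apply/matrixP => a b; rewrite !mxE eq_sym; case: eqP => [->|_].
    by rewrite !mulr1n rmorph_nat.
  by rewrite !mulr0n rmorph0.
have chiM : chi u *m chi v = chi v.
  rewrite mulmx_diag; congr diag_mx; apply/rowP => m; rewrite !mxE.
  case: (ltP (dcol m) v) => [mv|_]; last by rewrite mulr0.
  by rewrite (lt_le_trans mv vu) mulr1.
have chiE : chi v = \sum_j (if dt j < v then Pmx R q j else 0).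
  apply/matrixP => a b; rewrite summxE !mxE [RHS](bigD1 (tagnat.sig1 a))//=.
  rewrite [X in _ + X]big1 ?addr0.
    rewrite /dcol; case: ifP => _; last by rewrite mul0rn mxE.
    by rewrite PmxE !mxE eqxx.
  move=> j ja; case: ifP => _; last by rewrite mxE.
  by rewrite PmxE !mxE eq_sym (negbTE ja) mul0rn.
set T := theta1 ^t*.
rewrite -/(chi u) -/(chi v).
have -> : (2 *: (T *m expxA B v *m nu theta2 beta dt *m chi v *m U)) ^t* =
    2 *: (U ^t* *m chi v *m (nu theta2 beta dt) ^t* *m (expxA B v) ^t* *m theta1).
  rewrite linearZ /= map_mxZ rmorph_nat; congr (_ *: _).
  by rewrite !trmxC_mul chiC trmxCK !mulmxA.
rewrite -scalemxAl -scalemxAr scalerA -natrM.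
have -> : T *m expxA B u *m nu theta2 beta dt *m chi u *m U *m
    (U ^t* *m chi v *m (nu theta2 beta dt) ^t* *m (expxA B v) ^t* *m theta1) =
    T *m expxA B u *m (nu theta2 beta dt *m chi v *m (nu theta2 beta dt) ^t*) *m
    (expxA B v) ^t* *m theta1.
  rewrite !mulmxA -(mulmxA _ U) (unitarymxP U_unitary) mulmx1.
  by rewrite -(mulmxA _ (chi u)) chiM.
rewrite chiE mulmx_sumr !(mulmx_suml, mulmx_sumr) scaler_sumr.
apply: eq_bigr => j _; case: ifP => _; last by rewrite !(mulmx0, mul0mx) scaler0.
congr (_ *: _); rewrite /conj_flow !mulmxA.
by rewrite -[in RHS](mulmxA _ (expxA B (u - v)) (expxA B v)) -expxAD subrK.
Qed.

(** Each difference of [conj_flow] is twice the integral of [conj_flow (Q j)] from [dt j] to [t]. *)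
Definition kernel_explicit (x t : R) : 'M[C]_p :=
  2 *: (theta1 ^t* *m expxA B (x - t) *m
    (\sum_j (if dt j < t then conj_flow (X j) t - conj_flow (X j) (dt j) else 0)) *m theta1).

(** As [r] runs over the interval, [v = (r + t - x) / 2] runs from [0] to [t]. The chain rule factor
    [1 / 2] cancels the [2] in the derivative of [conj_flow], and the [1 / 2] in [kernelK] turns the
    [4] of the integrand into [2]. *)
Lemma kernelK_explicit (x t : R) : 0 < t -> t <= x -> kernelK s x t = kernel_explicit x t.
Proof.
move=> t0 tx; have xt0 : 0 <= x - t by rewrite subr_ge0.
have [H [H0 dH]] := expxA_primitive B.
rewrite /kernelK ger0_norm//.
(* The excluded values of [r]: the left end, where [v = 0], and those for which [v] or
   [(r + x - t) / 2] hits a delay. *)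
pose N : set R := [set` (x - t) :: [seq 2 * dcol m + (x - t) | m : 'I_p]
  ++ [seq 2 * dcol m - (x - t) | m : 'I_p]].
pose f i k j r : C := (4 *: (theta1 ^t* *m expxA B (x - t) *m
  conj_flow (Q j) (2^-1 * r + (t - x) / 2) *m theta1)) i k.
pose F i k j r : C := (4 *: (theta1 ^t* *m expxA B (x - t) *m
  conj_flow (X j) (2^-1 * r + (t - x) / 2) *m theta1)) i k.
have dF i k j r : isdC (F i k j) r (f i k j r).
  have : isdM (fun r => 4 *: (theta1 ^t* *m expxA B (x - t) *m
      conj_flow (X j) (2^-1 * r + (t - x) / 2) *m theta1)) r
      (4 *: (theta1 ^t* *m expxA B (x - t) *m ((2^-1)%:C%C *: (2 *:
      conj_flow (Q j) (2^-1 * r + (t - x) / 2))) *m theta1)).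
    by apply/isdM_scalel/isdM_mulmxr/isdM_mulmxl/isdM_comp_affine/isdM_conj_flow.
  rewrite scalerA (_ : (2^-1)%:C%C * 2 = 1) ?scale1r; first exact.
  by apply: complexP; rewrite !(ReM, ImM) /=; field.
have cf i k j : contC (f i k j).
  apply: isdM_contC => r; eexists; apply/isdM_scalel/isdM_mulmxr/isdM_mulmxl/isdM_comp_affine.
  apply: isdMM; first by apply: isdM_mulmxr; exact: isdM_expxA.
  exact/isdM_trmxC/isdM_expxA.
apply/matrixP => i k; rewrite mxE mxE.
pose g r := \sum_j (if 2 * dt j + (x - t) < r then f i k j r else 0).
have ig j : intC `[x - t, x + t] (fun r => if 2 * dt j + (x - t) < r then f i k j r else 0).
  exact: intC_step.
have [mg1 mg2] : intC `[x - t, x + t] g by apply: intC_sum.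
rewrite (@integralC_eq_off_finite _ N _ _ g).
- rewrite integralC_sum// [RHS]mxE !(mulmx_sumr, mulmx_suml) summxE mulr_sumr [RHS]mulr_sumr.
  apply: eq_bigr => j _.
  (* Nonnegative delays place the threshold [2 * dt j + (x - t)] at or to the right of the left end
     [x - t]. *)
  rewrite (integralC_step (x + t) _ (cf i k j) (dF i k j)) ?lerDr ?mulr_ge0//.
  have -> : (2 * dt j + (x - t) < x + t) = (dt j < t) by apply/idP/idP => h; lra.
  case: ifP => _; last by rewrite mulmx0 mul0mx mxE !mulr0.
  rewrite /F (_ : 2^-1 * (x + t) + (t - x) / 2 = t); last by field.
  rewrite (_ : 2^-1 * (2 * dt j + (x - t)) + (t - x) / 2 = dt j); last by field.
  move: (_ *m expxA B (x - t)) (conj_flow (X j) t) (conj_flow (X j) (dt j)) => A Y Z.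
  rewrite mulmxBr mulmxBl; move: (A *m Y *m theta1) (A *m Z *m theta1) => Y' Z'.
  by rewrite !mxE; field.
- by apply/finite_seqP; eexists.
- exact: measurable_itv.
- by apply/measurable_EFinP; exact: measurable_int mg1.
- by apply/measurable_EFinP; exact: measurable_int mg2.
move=> r; rewrite /= in_itv/= => /andP[r1 r2] Nr.
have /and3P[Nr1 Nr2 Nr3] : [&& r != x - t, r \notin [seq 2 * dcol m + (x - t) | m : 'I_p]
    & r \notin [seq 2 * dcol m - (x - t) | m : 'I_p]].
  apply/and3P; split; apply/negP => h; apply: Nr; rewrite /N /= in_cons mem_cat.
  - by rewrite h.
  - by rewrite h orbT.
  - by rewrite h !orbT.
have {}r1 : x - t < r by rewrite lt_neqAle eq_sym Nr1.
rewrite (is_s_derivmx M_gt0 eta_lt spec_beta H0 dH hs).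
- rewrite (is_s_derivmx M_gt0 eta_lt spec_beta H0 dH hs).
  + rewrite k_explicit_mul; last by lra.
    rewrite summxE; apply: eq_bigr => j _.
    have -> : (2 * dt j + (x - t) < r) = (dt j < (r + t - x) / 2) by apply/idP/idP => h; lra.
    case: ifP => _; last by rewrite mxE.
    have -> : (r + x - t) / 2 - (r + t - x) / 2 = x - t by field.
    by rewrite /f; have -> : 2^-1 * r + (t - x) / 2 = (r + t - x) / 2 by field.
  + by lra.
  + move=> m; apply: contraNneq Nr2 => h; apply/mapP; exists m; first by rewrite mem_enum.
    by rewrite -h; field.
- by lra.
move=> m; apply: contraNneq Nr3 => h; apply/mapP; exists m; first by rewrite mem_enum.
by rewrite -h; field.
Qed.

End KernelFormula.

(** * Symmetry of the kernel, the operator on L^2, and the formula on the intervals *)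

Section Consequences.
Variable R : realType.
Local Notation C := R[i].
Local Notation mu := (@lebesgue_measure R).

(* No integrability is needed, since [fine] sends both infinities to [0]. *)
Lemma RintegralN_total (D : set R) (f : R -> R) :
  \int[mu]_(x in D) - f x = - \int[mu]_(x in D) f x.
Proof.
rewrite /Rintegral [in LHS]integralE [in RHS]integralE.
rewrite (_ : (fun x => (- f x)%:E) = \- (EFin \o f))%E; last by apply/funext.
rewrite funeposN funenegN.
have h (a b : \bar R) : fine (a - b)%E = - fine (b - a)%E.
  by case: a b => [a| |] [b| |] //=; rewrite ?oppr0 ?opprB.
exact: h.
Qed.

Lemma integralC_conj (D : set R) (f : R -> C) :
  integralC D (fun x => (f x)^*) = (integralC D f)^*.
Proof.
apply: complexP; first by rewrite Re_conj; apply: eq_Rintegral => x _; rewrite Re_conj.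
rewrite Im_conj /= -RintegralN_total; apply: eq_Rintegral => x _; exact: Im_conj.
Qed.

(** The interval of integration is symmetric in [x] and [t], and exchanging them exchanges the two
    factors [k]. This holds for every [s], as conjugation commutes with [integralC]
    unconditionally. *)
Lemma kernelK_trmxC p (s : R -> 'M[C]_p) x t : kernelK s x t = (kernelK s t x) ^t*.
Proof.
rewrite /kernelK distrC [t + x]addrC linearZ /= map_mxZ fmorphV rmorph_nat.
congr (_ *: _); apply/matrixP => i j; rewrite !mxE; apply: etrans (integralC_conj _ _).
have E (P Q : 'M[C]_p) : (P *m Q ^t*) i j = ((Q *m P ^t*) j i)^*.
  by rewrite -[P in LHS]trmxCK -trmxC_mul !mxE.
by rewrite /integralC; congr Complex; apply: eq_Rintegral => r _; rewrite E.
Qed.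

Lemma intC_cut (l x : R) (g : R -> C) : intC `]0, l[ g ->
  intC `]0, l[ (fun t => if t <= x then g t else 0).
Proof.
have h (f : R -> R) : mu.-integrable `]0, l[ (fun t => (f t)%:E) ->
    mu.-integrable `]0, l[ (fun t => (if t <= x then f t else 0)%:E).
  move=> hf; apply: le_integrable (hf) => //.
    have /measurable_EFinP mf := measurable_int _ hf.
    apply/measurable_EFinP; apply: measurable_fun_if => //.
      by apply: measurable_fun_ler => //; exact: measurable_id.
    by apply: measurable_funS mf => // t [].
  by move=> t _; rewrite lee_fin; case: ifP => //; rewrite normr0.
move=> [h1 h2]; split.
  by under [X in _.-integrable _ X]eq_fun do rewrite Re_if; exact: h.
by under [X in _.-integrable _ X]eq_fun do rewrite Im_if; exact: h.
Qed.

(** Splitting at [t = x] turns the integral into bounded factors in [x] times primitives of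
    integrable functions, so [integral_op] adds to [f] a bounded measurable function. *)
Lemma in_L2_integral_op p n (l : R) (K : R -> R -> 'M[C]_p)
    (F : R -> 'M[C]_(p, n)) (G : R -> 'M[C]_(n, p)) (f : R -> 'cV[C]_p) : 0 < l ->
  (forall i a, bmeasC l (fun x => F x i a)) -> (forall a k, bmeasC l (fun x => G x a k)) ->
  (forall x t, 0 < t -> t <= x -> x < l -> K x t = F x *m G t) ->
  (forall x t, K x t = (K t x) ^t*) ->
  in_L2 l f -> in_L2 l (integral_op l K f).
Proof.
move=> l0 mF mG KE KC hf; have /in_L2P hf' := hf; apply: in_L2D_bmeasC => // i o.
have mI : measurable (`]0, l[ : set R) by exact: measurable_itv.
have hG a k : intC `]0, l[ (fun t => G t a k * f t k 0).
  by have [m1 m2 hi] := hf' k 0; exact: L2_bmeasC_intC.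
have hF a k : intC `]0, l[ (fun t => (F t k a)^* * f t k 0).
  by have [m1 m2 hi] := hf' k 0; apply: L2_bmeasC_intC => //; exact: bmeasC_conj.
(* The part over [t > x] is written as the whole integral minus the part over [t <= x], so that only
   primitives starting at [0] occur. *)
pose T x k a t := F x i a * (if t <= x then G t a k * f t k 0 else 0) + (G x a i)^* *
  ((F t k a)^* * f t k 0 + -1 * (if t <= x then (F t k a)^* * f t k 0 else 0)).
pose S x := \sum_k \sum_a (F x i a * integralC `]0, l[ (fun t => if t <= x then G t a k * f t k 0 else 0)
  + (G x a i)^* * (integralC `]0, l[ (fun t => (F t k a)^* * f t k 0) +
     -1 * integralC `]0, l[ (fun t => if t <= x then (F t k a)^* * f t k 0 else 0))).
apply: (@bmeasC_eq _ _ _ S).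
  move=> x xl; rewrite mxE.
  have cG k a := intC_cut x (hG a k).
  have cF k a := intC_cut x (hF a k).
  have cFN k a := intCM (-1) mI (cF k a).
  have cFD k a := intCD mI (hF a k) (cFN k a).
  have iT k a : intC `]0, l[ (T x k a).
    by apply: intCD => //; exact: intCM.
  transitivity (integralC `]0, l[ (fun t => \sum_k \sum_a T x k a t)).
    have E t : `]0, l[%classic t -> (K x t *m f t) i o = \sum_k \sum_a T x k a t.
      rewrite /= in_itv/= => tl; rewrite mxE; apply: eq_bigr => k _.
      rewrite /T (ord1 o); have [tx|xt] := leP t x.
        rewrite KE//; [|by case/andP: tl|by case/andP: xl].
        rewrite mxE mulr_suml; apply: eq_bigr => a _.
        by rewrite mulN1r subrr mulr0 addr0 mulrA.
      rewrite KC KE; [|by case/andP: xl|exact: ltW|by case/andP: tl].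
      rewrite !mxE rmorph_sum mulr_suml; apply: eq_bigr => a _.
      by rewrite rmorphM /= !mulr0 add0r addr0 mulrCA mulrA.
    by rewrite /integralC; congr Complex; apply: eq_Rintegral => t; rewrite inE => /E ->.
  rewrite integralC_sum// => [|k]; last exact: intC_sum.
  apply: eq_bigr => k _; rewrite integralC_sum//; apply: eq_bigr => a _.
  rewrite integralCD//; [|exact: intCM|exact: intCM].
  by rewrite integralCM// integralCM// integralCD// integralCM.
apply: bmeasC_sum => k; apply: bmeasC_sum => a; apply: bmeasCD; apply: bmeasCM => //.
- exact: (bmeasC_primitive (ltW l0)).
- exact: bmeasC_conj.
apply: bmeasCD; first exact/bmeasC_cont/contC_cst.
apply: bmeasCM; first exact/bmeasC_cont/contC_cst.
exact: (bmeasC_primitive (ltW l0)).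
Qed.

Variables (n kappa : nat) (q : 'I_kappa -> nat).
Local Notation p := (\sum_j q j)%N.
Variables (theta1 theta2 : 'M[C]_(n, p)) (beta : 'M[C]_n) (dt : 'I_kappa -> R).
Local Notation B := (two_i_beta beta).

(** Since [Q_j] is self-adjoint, the adjoint of a solution is a solution, and the identity is
    affine, so the mean of the two is one as well. *)
Lemma solves_identity_selfadjoint j (X : 'M[C]_n) : solves_identity theta2 beta dt j X ->
  solves_identity theta2 beta dt j (2^-1 *: (X + X ^t*)).
Proof.
rewrite /solves_identity => hX.
have QC : (Qmx theta2 beta dt j) ^t* = Qmx theta2 beta dt j.
  rewrite /Qmx !trmxC_mul trmxCK mulmxA; congr (_ *m _ *m _).
  apply/matrixP => a b; rewrite !PmxE !mxE (eq_sym b a); case: (eqVneq a b) => [->|_].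
    by rewrite !mulr1n rmorph_nat.
  by rewrite !mulr0n rmorph0.
have hXC : 'i%C *: (beta *m X ^t* - X ^t* *m beta ^t*) = Qmx theta2 beta dt j.
  have trmxCB (P Q : 'M[C]_n) : ('i%C *: (P - Q)) ^t* = ('i%C)^* *: (P ^t* - Q ^t*).
    by apply/matrixP => a b; rewrite !mxE rmorphM rmorphB.
  rewrite -QC -hX trmxCB !trmxC_mul trmxCK.
  have -> : ('i%C)^* = - 'i%C :> C by apply: complexP; rewrite ?Re_conj ?Im_conj /= ?oppr0.
  by rewrite scaleNr -scalerN opprB.
have -> : beta *m (2^-1 *: (X + X ^t*)) - 2^-1 *: (X + X ^t*) *m beta ^t* =
    2^-1 *: ((beta *m X - X *m beta ^t*) + (beta *m X ^t* - X ^t* *m beta ^t*)).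
  by rewrite -scalemxAr -scalemxAl -scalerBr mulmxDr mulmxDl opprD addrACA.
rewrite scalerA mulrC -scalerA scalerDr hX hXC.
by apply/matrixP => a b; move: (Qmx _ _ _ _) => Y; rewrite !mxE; field.
Qed.

Variables (U : 'M[C]_p) (M eta : R).
Hypotheses (M_gt0 : 0 < M) (eta_lt : eta < - (2 * M)).
Hypothesis spec_beta : forall a : C,
  eigenvalue (beta + ('i%C * M%:C%C)%:M) a -> 0 < complex.Im a.

Lemma contC_expxA (a b : 'I_n) (c : R) : contC (fun x => expxA B (x - c) a b).
Proof.
apply: isdM_contC => x; eexists.
have -> : (fun x => expxA B (x - c)) = (fun x => expxA B (1 * x + - c)).
  by apply/funext => y; rewrite mul1r.
apply: isdM_comp_affine; exact: isdM_expxA.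
Qed.

Lemma bmeasC_k_explicit (l : R) i k :
  bmeasC l (fun x => k_explicit theta1 theta2 beta dt U x i k).
Proof.
have cst (z : C) : bmeasC l (fun=> z) by exact/bmeasC_cont/contC_cst.
rewrite /k_explicit; under eq_fun do rewrite mxE mxE.
apply: bmeasCM => //; apply: bmeasC_sum => m; apply: bmeasCM => //.
under eq_fun do rewrite mxE; apply: bmeasC_sum => a; apply: bmeasCM => //.
under eq_fun do rewrite mxE; apply/bmeasC_step/bmeasC_cont.
apply: contC_mulmx => [? ?|? ?]; [exact: contC_expxA|exact: contC_cst].
Qed.

(** Off the finite set of delays the derivative is [k_explicit], which is bounded and measurable on
    every [(0, l)]. *)
Lemma is_s_L2loc_derivative s : is_s (phi theta1 theta2 beta dt U) eta s ->
  has_L2loc_derivative s.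
Proof.
move=> hs; have [H [H0 dH]] := expxA_primitive B.
pose N : set R := [set` [seq dcol dt m | m : 'I_p]].
have fN : finite_set N by apply/finite_seqP; eexists.
have NP x : ~ N x -> forall m : 'I_p, x != dcol dt m.
  move=> Nx m; apply/negP => /eqP xm; apply: Nx.
  by apply/mapP; exists m; rewrite ?mem_enum.
split.
  exists N; split.
  - apply: countable_measurable; last exact: finite_set_countable.
    by move=> t; exact: measurable_set1.
  - by apply: countable_lebesgue_measure0; exact: finite_set_countable.
  move=> x /= /not_implyP[x0 hx]; apply: contrapT => Nx; apply: hx => i k.
  have hd := is_s_derive M_gt0 eta_lt spec_beta H0 dH hs x0 (NP x Nx).
  by have [[h1 _] [h2 _]] := hd i k.
move=> l l0 i k.
have hb : bmeasC l (fun x => derivmx s x i k).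
  apply: (bmeasC_eq_off_finite fN) (bmeasC_k_explicit l i k).
  move=> x /andP[x0 _] Nx.
  by rewrite (is_s_derivmx M_gt0 eta_lt spec_beta H0 dH hs x0 (NP x Nx)).
by have [m1 m2 _] := hb; split => //; exact: bmeasC_L2 (ltW l0) hb.
Qed.

Variable X : 'I_kappa -> 'M[C]_n.

(** [E (x - t)] is [E x] times [E (- t)]: the variables separate with inner dimension [n]. *)
Definition left_factor (x : R) : 'M[C]_(p, n) := 2 *: (theta1 ^t* *m expxA B x).

Definition right_factor (t : R) : 'M[C]_(n, p) := expxA B (- t) *m
  (\sum_j (if dt j < t then conj_flow beta (X j) t - conj_flow beta (X j) (dt j) else 0))
  *m theta1.

Lemma kernel_explicit_factor x t :
  kernel_explicit theta1 beta dt X x t = left_factor x *m right_factor t.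
Proof. by rewrite /kernel_explicit /left_factor /right_factor expxAD -scalemxAl !mulmxA. Qed.

Lemma bmeasC_left_factor l i a : bmeasC l (fun x => left_factor x i a).
Proof.
apply: bmeasC_cont; rewrite /left_factor; under eq_fun do rewrite mxE.
apply: contCM; first exact: contC_cst.
apply: contC_mulmx => [? ?|b c]; first exact: contC_cst.
by apply: isdM_contC => x; eexists; exact: isdM_expxA.
Qed.

Lemma bmeasC_right_factor l a k : bmeasC l (fun x => right_factor x a k).
Proof.
have cst (z : C) : bmeasC l (fun=> z) by exact/bmeasC_cont/contC_cst.
rewrite /right_factor; under eq_fun do rewrite mxE.
apply: bmeasC_sum => c; apply: bmeasCM => //; under eq_fun do rewrite mxE.
apply: bmeasC_sum => b; apply: bmeasCM.
  apply/bmeasC_cont/isdM_contC => x; eexists; exact: isdM_expxAN.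
under eq_fun do rewrite summxE; apply: bmeasC_sum => j.
apply: (@bmeasC_eq _ _ _ (fun x => if dt j < x then
  (conj_flow beta (X j) x - conj_flow beta (X j) (dt j)) b c else 0)).
  by move=> x _; case: ifP => // _; rewrite mxE.
apply: bmeasC_step; under eq_fun do rewrite mxE; apply: bmeasCD.
  apply/bmeasC_cont/isdM_contC => x; eexists.
  apply: isdMM; first by apply: isdM_mulmxr; exact: isdM_expxA.
  exact/isdM_trmxC/isdM_expxA.
by under eq_fun do rewrite mxE.
Qed.

(** Mind the shift of indices: [dt j] is the delay numbered [j + 1]. Thus [j < m] puts it at or
    below the left end of the interval, and [j >= m] at or above [dtilde dt x m.+1]; for [m = kappa]
    no such [j] exists. *)
Lemma dtilde_lt (x t : R) m (j : 'I_kappa) :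
  (forall i j : 'I_kappa, (i < j)%N -> dt i < dt j) -> (m <= kappa)%N ->
  dtilde dt x m < t < Num.min x (dtilde dt x m.+1) -> (dt j < t) = (j < m)%N.
Proof.
move=> dt_incr mk; rewrite lt_min => /and3P[mt _ tm].
have dt_le (a b : 'I_kappa) : (a <= b)%N -> dt a <= dt b.
  by rewrite leq_eqVlt => /predU1P[/val_inj ->//|/dt_incr/ltW].
have [jm|mj] := ltnP j m.
  case: m mk mt tm jm => // m mk mt _ jm.
  apply: le_lt_trans mt; rewrite /= insubT /=.
  exact: dt_le.
apply/negbTE; rewrite -leNgt; apply/ltW/(lt_le_trans tm).
have mk' : (m < kappa)%N by apply: leq_ltn_trans mj (ltn_ord j).
by rewrite /= insubT /=; exact: dt_le.
Qed.

(** In the values of [conj_flow] at [t], [E (x - t)] and [E t] combine into [E x], which gives the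
    term with [Zmx]; the values at [dt j] are the summands of [Ztmx]. *)
Lemma kernel_explicit_formula (x t : R) m :
  (forall i j : 'I_kappa, (i < j)%N -> dt i < dt j) -> (m <= kappa)%N ->
  dtilde dt x m < t < Num.min x (dtilde dt x m.+1) ->
  kernel_explicit theta1 beta dt X x t = kernel_formula theta1 beta dt X m x t.
Proof.
move=> dt_incr mk ht; rewrite /kernel_explicit /kernel_formula.
congr (_ *: _); rewrite -[in LHS]mulmxA [in LHS]mulmxA -!mulmxA; congr (_ *m _).
rewrite mulmxA; congr (_ *m _).
under eq_bigr => j _ do rewrite (dtilde_lt j dt_incr mk ht).
rewrite -big_mkcond /= sumrB mulmxBr; congr (_ - _).
  rewrite /Zmx exp2i_trmxC !exp2iE opprK -trmxC_expxA.
  rewrite !(mulmx_sumr, mulmx_suml); apply: eq_bigr => j _.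
  by rewrite /conj_flow !mulmxA -expxAD subrK.
rewrite [exp2i (x - t) beta]exp2iE /Ztmx; congr (_ *m _); apply: eq_bigr => j _.
by rewrite exp2i_trmxC exp2iE opprK -trmxC_expxA.
Qed.

End Consequences.

Lemma hermitian_part_trmxC (R : realType) n (X : 'M[R[i]]_n) :
  (2^-1 *: (X + X ^t*)) ^t* = 2^-1 *: (X + X ^t*).
Proof.
apply/matrixP => a b; rewrite !mxE rmorphM rmorphD fmorphV rmorph_nat.
by congr (_ * _); rewrite [LHS]addrC; congr (_ + _); exact: conjCK.
Qed.

Theorem proposition4p5 (R : realType) (n kappa : nat) (q : 'I_kappa -> nat)
  (theta1 theta2 : 'M[R[i]]_(n, (\sum_j q j)%N)) (beta : 'M[R[i]]_n)
  (U : 'M[R[i]]_(\sum_j q j)%N) (dt : 'I_kappa -> R) (M eta : R)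
  (n_gt0 : (0 < n)%N) (kappa_gt0 : (0 < kappa)%N)
  (q_gt0 : forall j, (0 < q j)%N)
  (U_unitary : U \is unitarymx)
  (dt_ge0 : forall j, 0 <= dt j)
  (dt_incr : forall i j : 'I_kappa, (i < j)%N -> dt i < dt j)
  (M_gt0 : 0 < M)
  (spec_beta : forall a : R[i],
     eigenvalue (beta + ('i%C * M%:C%C)%:M) a -> 0 < complex.Im a)
  (eta_lt : eta < - (2 * M))
  (solvable : forall j, exists X, solves_identity theta2 beta dt j X) :
  (exists X : 'I_kappa -> 'M[R[i]]_n,
     forall j, (X j) ^t* = X j /\ solves_identity theta2 beta dt j (X j)) /\
  (exists s, is_s (phi theta1 theta2 beta dt U) eta s) /\
  (forall s, is_s (phi theta1 theta2 beta dt U) eta s ->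
   has_L2loc_derivative s /\
   forall X : 'I_kappa -> 'M[R[i]]_n,
     (forall j, (X j) ^t* = X j /\ solves_identity theta2 beta dt j (X j)) ->
   forall l : R, 0 < l ->
     (forall f, in_L2 l f -> in_L2 l (integral_op l (kernelK s) f)) /\
     semiseparable l (kernelK s) /\
     (forall x t : R, 0 < x < l -> 0 < t < l ->
        kernelK s x t = (kernelK s t x) ^t*) /\
     (forall (m : nat) (x t : R), (m <= kappa)%N -> 0 < t -> t < x -> x < l ->
        dtilde dt x m < t < Num.min x (dtilde dt x m.+1) ->
        kernelK s x t = kernel_formula theta1 beta dt X m x t)).
Proof.
have [X hX] := choice solvable.
have [H [H0 dH]] := expxA_primitive (two_i_beta beta).
split.
  exists (fun j => 2^-1 *: (X j + (X j) ^t*)) => j; split; last first.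
    exact: solves_identity_selfadjoint.
  exact: hermitian_part_trmxC.
split; first by eexists; exact: (is_s_explicit theta1 theta2 dt U M_gt0 eta_lt spec_beta H0 dH).
move=> s hs; split; first exact: (is_s_L2loc_derivative M_gt0 eta_lt spec_beta hs).
move=> {hX}X hX l l0.
have KE x t : 0 < t -> t <= x -> kernelK s x t = kernel_explicit theta1 beta dt X x t.
  exact: (kernelK_explicit M_gt0 eta_lt spec_beta U_unitary dt_ge0 (fun j => (hX j).2) hs).
have KC := kernelK_trmxC s.
pose F := left_factor (q := q) theta1 beta; pose G := right_factor theta1 beta dt X.
have KFG x t : 0 < t -> t <= x -> kernelK s x t = F x *m G t.
  by move=> t0 tx; rewrite KE// kernel_explicit_factor.
split.
  move=> f; apply: (in_L2_integral_op (F := F) (G := G) l0) => //.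
  - exact: bmeasC_left_factor.
  - exact: bmeasC_right_factor.
  - by move=> x t t0 tx _; exact: KFG.
split.
  (* Above the diagonal, the symmetry of the kernel makes the adjoints of [G] and [F] the two
     factors. *)
  exists n, F, (fun x => (G x) ^t*), G, (fun t => (F t) ^t*); split=> // x t.
  move=> /andP[x0 _] /andP[t0 _]; split=> [tx|xt]; first by rewrite KFG// ltW.
  by rewrite KC KFG ?trmxC_mul// ltW.
split=> [x t _ _|m x t mk t0 tx _ ht]; first exact: KC.
by rewrite KE ?(ltW tx)//; exact: kernel_explicit_formula.
Qed.
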